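(* Let $(M,g)$ be a Riemannian manifold with curvature tensor $R_{pijk}$, let $N\subset M$ be an open contractible subset, and let $\Pi_{ab}$ be a field of symmetric bilinear forms on $N$ satisfying $$R_{pijk}=\Pi_{pj}\Pi_{ik}-\Pi_{pk}\Pi_{ij}\qquad\text{and}\qquad \Pi_{a[b;c]}=0 .$$ Then for any point $p\in N$ and any initial conditions at $p$ (a value for $h$ and a covector value for $h_{;a}$) with $g^{ab}h_{;a}h_{;b}<1$ at $p$, there is a maximal open connected set $S\subset N$ with $p\in S$ on which there exists a scalar field $h$ satisfying $$\Pi_{ab}=\frac{h_{;ab}}{(1-g^{mn}h_{;m}h_{;n})^{1/2}}$$ and the initial conditions at $p$. The field $h$ is unique.
   Context: All objects are smooth. '';'' is covariant differentiation with respect to the Levi-Civita connection of $g$; repeated upper/lower indices are summed; $\Pi_{a[b;c]}=\frac12(\Pi_{ab;c}-\Pi_{ac;b})$. Curvature sign convention: the unit round sphere has $R_{pijk}=g_{pj}g_{ik}-g_{pk}g_{ij}$. For $h$ to satisfy the displayed equation for $\Pi_{ab}$ on a set is understood to include $g^{mn}h_{;m}h_{;n}<1$ on that set, so that the right-hand side is defined and real. *)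

(* Defs.v *)
From HB Require Import structures.
From mathcomp Require Import all_boot all_order all_algebra.
From mathcomp Require Import all_classical all_reals all_analysis.
Set Implicit Arguments.
Unset Strict Implicit.
Unset Printing Implicit Defensive.
Import Order.TTheory GRing.Theory Num.Theory.
Import numFieldNormedType.Exports.
Local Open Scope classical_set_scope.
Local Open Scope ring_scope.

Section Calculus.
Context {R : realType} {n : nat}.

Definition partial (i : 'I_n) (f : 'rV[R]_n -> R) (y : 'rV[R]_n) : R :=
  'D_(delta_mx 0 i) f y.

(* C^k on U; meant for U open, where only the values of f on U matter. *)
Fixpoint Ck_on (k : nat) (U : set 'rV[R]_n) (f : 'rV[R]_n -> R) : Prop :=
  (forall y, U y -> {for y, continuous f}) /\
  if k is k'.+1 then
    forall i : 'I_n,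
      (forall y, U y -> derivable f y (delta_mx 0 i)) /\
      Ck_on k' U (partial i f)
  else True.

Definition smooth_on (U : set 'rV[R]_n) (f : 'rV[R]_n -> R) : Prop :=
  forall k, Ck_on k U f.

End Calculus.

(* A smooth n-manifold: a Hausdorff, second countable space with a (not
   necessarily maximal) smooth atlas indexed by [atlas].  The chart [a] is the
   homeomorphism [coord a] from the open set [dom a] onto an open subset of
   R^n, with inverse [param a]; values outside these sets are irrelevant. *)
Structure manifold (R : realType) (n : nat) := Manifold {
  carrier :> topologicalType;
  carrier_hausdorff : hausdorff_space carrier;
  carrier_second_countable : @second_countable carrier;
  atlas : Type;
  dom : atlas -> set carrier;
  coord : atlas -> carrier -> 'rV[R]_n;
  param : atlas -> 'rV[R]_n -> carrier;
  dom_cover : forall x, exists a, dom a x;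
  dom_open : forall a, open (dom a);
  coord_open : forall a, open (coord a @` dom a);
  coordK : forall a x, dom a x -> param a (coord a x) = x;
  coord_continuous : forall a x, dom a x -> {for x, continuous (coord a)};
  param_continuous : forall a y, (coord a @` dom a) y ->
    {for y, continuous (param a)};
  transition_smooth : forall a b (j : 'I_n),
    smooth_on (coord a @` (dom a `&` dom b))
      (fun y => coord b (param a y) 0 j)
}.

Section Geometry.
Context {R : realType} {n : nat} {M : manifold R n}.

(* Tensor fields of valence (0,1) and (0,2) are given by their components in
   every chart; [T a x] is meaningful for x in [dom a]. *)
Definition cov1 := atlas M -> M -> 'rV[R]_n.
Definition cov2 := atlas M -> M -> 'M[R]_n.

Definition smooth_in_chart (U : set M) (a : atlas M) (f : M -> R) : Prop :=
  smooth_on (coord a @` (U `&` dom a)) (f \o param a).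

Definition scalar_field_on (U : set M) (h : M -> R) : Prop :=
  forall a, smooth_in_chart U a h.

(* Entry (i, j) is the derivative of the j-th b-coordinate with respect to the
   i-th a-coordinate. *)
Definition change_of_coord (a b : atlas M) (x : M) : 'M[R]_n :=
  'J (coord b \o param a) (coord a x).

Record sym_form_on (U : set M) (T : cov2) : Prop := SymFormOn {
  sym_form_smooth : forall a i j, smooth_in_chart U a (fun x => T a x i j);
  sym_form_sym : forall a x, U x -> dom a x -> (T a x)^T = T a x;
  sym_form_transform : forall a b x, U x -> dom a x -> dom b x ->
    T a x =
      change_of_coord a b x *m T b x *m (change_of_coord a b x)^T
}.

Definition riemannian_metric (g : cov2) : Prop :=
  sym_form_on setT g /\
  forall a x, dom a x ->
    forall v : 'rV[R]_n, v != 0 -> 0 < (v *m g a x *m v^T) 0 0.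

Definition pd (a : atlas M) (i : 'I_n) (f : M -> R) (x : M) : R :=
  partial i (f \o param a) (coord a x).

Section LeviCivita.
Variable g : cov2.

(* [ginv a x i j] is g^{ij}. *)
Definition ginv (a : atlas M) (x : M) : 'M[R]_n := invmx (g a x).

(* [christoffel a k i j x] is Gamma^k_{ij}. *)
Definition christoffel (a : atlas M) (k i j : 'I_n) (x : M) : R :=
  2^-1 * \sum_l ginv a x k l *
    (pd a i (fun y => g a y j l) x + pd a j (fun y => g a y i l) x
     - pd a l (fun y => g a y i j) x).

(* R^p_{ijk} = d_j Gamma^p_{ki} - d_k Gamma^p_{ji}
     + Gamma^p_{jm} Gamma^m_{ki} - Gamma^p_{km} Gamma^m_{ji};
   once p is lowered, the unit round sphere has
   R_{pijk} = g_{pj} g_{ik} - g_{pk} g_{ij}. *)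
Definition riemann_up (a : atlas M) (x : M) (p i j k : 'I_n) : R :=
  pd a j (christoffel a p k i) x - pd a k (christoffel a p j i) x
  + \sum_m christoffel a p j m x * christoffel a m k i x
  - \sum_m christoffel a p k m x * christoffel a m j i x.

Definition riemann (a : atlas M) (x : M) (p i j k : 'I_n) : R :=
  \sum_m g a x p m * riemann_up a x m i j k.

(* w_{b;c} *)
Definition covD1 (w : cov1) (a : atlas M) (x : M) (b c : 'I_n) : R :=
  pd a c (fun y => w a y 0 b) x
  - \sum_d christoffel a d b c x * w a x 0 d.

(* T_{eb;c} *)
Definition covD2 (T : cov2) (a : atlas M) (x : M) (e b c : 'I_n) : R :=
  pd a c (fun y => T a y e b) x
  - \sum_d christoffel a d e c x * T a x d b
  - \sum_d christoffel a d b c x * T a x e d.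

Definition dscalar (h : M -> R) : cov1 := fun a x => \row_i pd a i h x.

(* h_{;bc} *)
Definition hessian (h : M -> R) : atlas M -> M -> 'I_n -> 'I_n -> R :=
  covD1 (dscalar h).

(* g^{mn} w_m w_n at x, for a covector w given by its components in chart a *)
Definition covector_normsq (a : atlas M) (x : M) (w : 'rV[R]_n) : R :=
  \sum_i \sum_j ginv a x i j * w 0 i * w 0 j.

Definition gauss_equation_on (U : set M) (T : cov2) : Prop :=
  forall a x, U x -> dom a x -> forall p i j k,
    riemann a x p i j k =
      T a x p j * T a x i k - T a x p k * T a x i j.

Definition codazzi_equation_on (U : set M) (T : cov2) : Prop :=
  forall a x, U x -> dom a x -> forall e b c,
    2^-1 * (covD2 T a x e b c - covD2 T a x e c b) = 0.

Definition hessian_equation_on (U : set M) (T : cov2) (h : M -> R) : Prop :=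
  forall a x, U x -> dom a x ->
    covector_normsq a x (dscalar h a x) < 1 /\
    forall b c, T a x b c =
      hessian h a x b c
        / Num.sqrt (1 - covector_normsq a x (dscalar h a x)).

(* The scalar field h solves the equation on S, with value h0 at p and with
   h_{;i} at p having components w in the chart a. *)
Definition solution_on (T : cov2) (p : M) (a : atlas M) (h0 : R)
    (w : 'rV[R]_n) (S : set M) (h : M -> R) : Prop :=
  [/\ scalar_field_on S h, hessian_equation_on S T h,
      h p = h0 & dscalar h a p = w].

Definition solution_domain (N : set M) (T : cov2) (p : M) (a : atlas M)
    (h0 : R) (w : 'rV[R]_n) (S : set M) : Prop :=
  [/\ open S, connected S, S `<=` N, S p &
      exists h : M -> R, solution_on T p a h0 w S h].

End LeviCivita.
End Geometry.
Arguments cov1 {R n} M.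
Arguments cov2 {R n} M.

(* A, as a subspace of T, is contractible: its identity map is homotopic,
   within A, to a constant map. *)
Definition contractible_set (R : realType) (T : topologicalType)
    (A : set T) : Prop :=
  exists (q : T) (H : R * T -> T),
    [/\ A q,
        {within `[0, 1]%classic `*` A, continuous H},
        forall t x, 0 <= t <= 1 -> A x -> A (H (t, x)),
        forall x, A x -> H (0, x) = x &
        forall x, A x -> H (1, x) = q].

(* Main.v *)
Require Import Defs.
From HB Require Import structures.
From mathcomp Require Import all_boot all_order all_algebra.
From mathcomp Require Import all_classical all_reals all_analysis.
From mathcomp Require Import ring lra.
Import Defs.
Set Implicit Arguments.
Unset Strict Implicit.
Unset Printing Implicit Defensive.
Import Order.TTheory GRing.Theory Num.Theory.
Import numFieldNormedType.Exports.
Local Open Scope classical_set_scope.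
Local Open Scope ring_scope.

(** Let u = dh and f = (1 - |u|^2)^(1/2). The equation for h says that the covariant
    derivative of u is f Pi, and differentiating f^2 + |u|^2 = 1 then gives
    df = - Pi(u^#, .). Together with dh = u these are linear equations of first order
    for the triple (h, u, f): it is parallel for a linear connection on a bundle of
    rank n + 2 over N. The Gauss and Codazzi equations say that this connection is
    flat ([conn_flat]). Hence parallel triples exist on small coordinate cubes with an
    arbitrary value at an arbitrary point, which determines them
    ([flat_system_local], [flat_section_basis]); and since a contractible set has no
    monodromy, the triple (h0, w, (1 - |w|^2)^(1/2)) at p extends to a parallel
    triple G on all of N ([global_section]).

    A solution on a connected open set S' with the given initial conditions yields a
    parallel triple on S' ([solution_parallel]) that agrees with G at p, hence on S'.
    So all solutions are restrictions of the first component of G, which is itself a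
    solution on the union S of all their domains, and S is the largest domain. The
    global triple is essential: two solutions agree on the intersection of their
    domains although that intersection may be disconnected. The union is not empty,
    because near p the parallel triple has f > 0 and f^2 + |u|^2 = 1, so that its
    component h is a solution ([local_solution]).

    The local theorem for flat systems d_c Y = Y A_c solves the linear ordinary
    differential equation dF/dt = F B along each ray from a point, by Picard
    iteration, and takes the end value. When the end point moves by d in the
    direction e and F becomes F', the deviation D = F' - F - d t F A_e satisfies
    dD/dt = D B + O(d^2), because flatness cancels the terms of first order; so D is
    O(d^2), which identifies the partial derivatives of the end value ([flow_step]).

    The equation is required in all charts, while parallel triples are constructed in
    one chart; this is bridged by the tensorial character of the Hessian
    ([hessian_transition]), which rests on the change of the Christoffel symbols
    ([christoffel_change]) and the symmetry of second derivatives ([partialC]). *)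

(** * Mean values and differentiability on cubes of R^n *)

Section DirectionalMeanValue.
Context {R : realType} {V : normedModType R}.

Lemma is_derive_line (f : V -> R) (y v : V) (s : R) :
  derivable f (y + s *: v) v ->
  is_derive s 1 (fun t : R => f (y + t *: v)) ('D_v f (y + s *: v)).
Proof.
move=> dv.
suff E : (fun h : R => h^-1 *: (((fun t : R => f (y + t *: v)) \o shift s) (h *: (1 : R))
    - f (y + s *: v) : R)) = (fun h : R => h^-1 *: ((f \o shift (y + s *: v)) (h *: v)
    - f (y + s *: v) : R)).
  by split; rewrite /derivable /derive E.
apply/funext => h /=; congr (_ *: (f _ - _)).
by rewrite /shift /= -[h *: 1]/(h * 1) mulr1 scalerDl addrCA.
Qed.

Lemma mvt_derive (f df : R -> R) (a b : R) : a <= b ->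
  (forall t, t \in `[a, b]%R -> is_derive t 1 f (df t)) ->
  exists2 c, c \in `[a, b]%R & f b - f a = df c * (b - a).
Proof.
move=> ab fd.
have C : {within `[a, b], continuous f}.
  by apply: derivable_within_continuous => t /fd; case.
have D : forall x, x \in `]a, b[%R -> is_derive x 1 f (df x).
  by move=> t tab; apply: fd; exact: (subset_itv_oo_cc tab).
exact: (MVT_segment ab D C).
Qed.

(** Writing the intermediate point as y + (s * d) v with s in [0, 1] keeps it on
    the segment whatever the sign of d. *)
Lemma mvt_line (f : V -> R) (y v : V) (d : R) :
  (forall s, 0 <= s <= 1 -> derivable f (y + (s * d) *: v) v) ->
  exists2 s, 0 <= s <= 1 &
    f (y + d *: v) - f y = d * 'D_v f (y + (s * d) *: v).
Proof.
move=> fd; pose g (t : R) := f (y + t *: v).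
have [->|d0] := eqVneq d 0.
  by exists 0; rewrite ?lexx ?ler01// scale0r addr0 subrr mul0r.
have gd s : 0 <= s <= 1 -> is_derive (s * d) 1 g ('D_v f (y + (s * d) *: v)).
  by move=> /fd; exact: is_derive_line.
have toseg (t a b : R) : (a, b) = (0, d) \/ (a, b) = (d, 0) -> a <= t <= b ->
    exists2 s, 0 <= s <= 1 & t = s * d.
  move=> E /andP[at_ tb]; exists (t / d); last by rewrite divfK.
  case: E at_ tb => -[-> ->] at_ tb.
  - have dp : 0 < d by rewrite lt_def d0 (le_trans at_).
    by rewrite divr_ge0// ?(ltW dp)// ler_pdivrMr// mul1r.
  - have dn : d < 0 by rewrite lt_def eq_sym d0 (le_trans at_).
    by rewrite -mulrNN -invrN divr_ge0 ?oppr_ge0// ?(ltW dn)//=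
      ler_pdivrMr ?oppr_gt0// mul1r lerN2.
have [d_ge|d_lt] := leP 0 d.
- have [||c] := @mvt_derive g (fun t => 'D_v f (y + t *: v)) 0 d => //.
    move=> t; rewrite in_itv/= => /(toseg _ _ _ (or_introl erefl))[s s01 ->].
    exact: gd.
  rewrite in_itv/= => /(toseg _ _ _ (or_introl erefl))[s s01 ->] E.
  exists s => //; move: E; rewrite /g scale0r addr0 subr0 => ->.
  by rewrite mulrC.
- have [||c] := @mvt_derive g (fun t => 'D_v f (y + t *: v)) d 0 => //.
  + exact: ltW.
  + move=> t; rewrite in_itv/= => /(toseg _ _ _ (or_intror erefl))[s s01 ->].
    exact: gd.
  rewrite in_itv/= => /(toseg _ _ _ (or_intror erefl))[s s01 ->] E.
  exists s => //; move: E; rewrite /g scale0r addr0 => E.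
  by rewrite -opprB E sub0r mulrN opprK mulrC.
Qed.

End DirectionalMeanValue.

Lemma continuous_sum_at (R : realType) (T : topologicalType) (I : finType)
    (F : I -> T -> R) (x : T) :
  (forall i, {for x, continuous (F i)}) ->
  {for x, continuous (fun z => \sum_i F i z)}.
Proof.
move=> cF; rewrite /prop_for; elim: (index_enum I) => [|i s IH].
  by under eq_fun do rewrite big_nil; exact: cst_continuous.
under eq_fun do rewrite big_cons.
by apply: continuousD => //; exact: cF.
Qed.

Section Cubes.
Context {R : realType} {n : nat}.
Implicit Types (x y z : 'rV[R]_n) (r : R).

Notation e_ i := (delta_mx 0 i : 'rV[R]_n).

Lemma cubeP x r y : 0 < r ->
  ball x r y <-> forall j, `|x 0 j - y 0 j| < r.
Proof.
move=> r0; split; first by move=> [_ H] j; exact: H.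
by move=> H; split => // i j; rewrite ord1; exact: H.
Qed.

Lemma cube_convex x r y v (s d : R) : 0 <= s <= 1 ->
  ball x r y -> ball x r (y + d *: v) -> ball x r (y + (s * d) *: v).
Proof.
move=> /andP[s0 s1] [r0 xy] [_ xyv]; split => // i j.
have := xy i j; have := xyv i j.
rewrite /ball /= !mxE => H1 H2.
have -> : x i j - (y i j + s * d * v i j)
  = (1 - s) * (x i j - y i j) + s * (x i j - (y i j + d * v i j)) by ring.
have [s_eq0|sn0] := eqVneq s 0.
  by rewrite s_eq0 !mul0r addr0 subr0 mul1r.
apply: le_lt_trans (ler_normD _ _) _; rewrite !normrM (ger0_norm s0).
rewrite (@ger0_norm _ (1 - s)) ?subr_ge0//.
have sp : 0 < s by rewrite lt_def sn0.
have -> : r = (1 - s) * r + s * r by ring.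
by rewrite ler_ltD// ?ler_wpM2l ?subr_ge0// ?ltr_pM2l// ltW.
Qed.

(** Changing one coordinate at a time stays inside a cube, so the increment is a
    sum of one-variable increments to which the mean value theorem applies. With
    c = 0 this is a Lipschitz bound; with c the partial derivatives at a point it
    compares f with its linear part. *)
Lemma partial_approx (x0 : 'rV[R]_n) (r e : R) (c : 'I_n -> R) (f : 'rV[R]_n -> R) :
  (forall z, ball x0 r z -> forall i, derivable f z (e_ i)) ->
  (forall z, ball x0 r z -> forall i, `|partial i f z - c i| <= e) ->
  forall y y', ball x0 r y -> ball x0 r y' ->
  `|f y' - f y - \sum_i c i * (y' 0 i - y 0 i)| <= e * \sum_i `|y' 0 i - y 0 i|.
Proof.
move=> fd fc y y' By By'.
have r0 : 0 < r by case: By.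
pose z k := \row_(j < n) (if (j < k)%N then y' 0 j else y 0 j).
have Bz k : ball x0 r (z k).
  apply/cubeP => // j; rewrite mxE; case: ifP => _.
    by move/(cubeP _ _ r0) : By'; exact.
  by move/(cubeP _ _ r0) : By; exact.
have z0 : z 0%N = y by apply/rowP => j; rewrite mxE.
have zn : z n = y' by apply/rowP => j; rewrite mxE ltn_ord.
have zS (k : 'I_n) : z k.+1 = z k + (y' 0 k - y 0 k) *: e_ k.
  apply/rowP => j; rewrite !mxE eqxx/=.
  have [->|jk] := eqVneq j k; first by rewrite ltnS leqnn ltnn mulr1 addrC subrK.
  by rewrite mulr0 addr0 ltnS leq_eqVlt (negbTE (jk : (j : nat) != k)).
have -> : f y' - f y = \sum_(k < n) (f (z k.+1) - f (z k)).
  by rewrite -(big_mkord xpredT (fun k => f (z k.+1) - f (z k))) telescope_sumr// z0 zn.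
rewrite -sumrB mulr_sumr (le_trans (ler_norm_sum _ _ _))//.
apply: ler_sum => k _.
rewrite [in f _]zS.
have [|s s01 ->] := @mvt_line _ _ f (z k) (e_ k) (y' 0 k - y 0 k).
  move=> s s01; apply: fd; apply: cube_convex => //.
  by rewrite -zS.
rewrite [in X in X - _]mulrC -mulrBl normrM ler_wpM2r//.
by apply: fc; apply: cube_convex => //; rewrite -zS.
Qed.

Lemma partial_lipschitz (x0 : 'rV[R]_n) (r C : R) (f : 'rV[R]_n -> R) :
  (forall z, ball x0 r z -> forall i, derivable f z (e_ i)) ->
  (forall z, ball x0 r z -> forall i, `|partial i f z| <= C) ->
  forall y y', ball x0 r y -> ball x0 r y' ->
  `|f y' - f y| <= C * \sum_i `|y' 0 i - y 0 i|.
Proof.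
move=> fd fc y y' By By'.
have := @partial_approx x0 r C (fun=> 0) f fd _ y y' By By'.
rewrite big1 ?subr0; last by move=> i _; rewrite mul0r.
by apply=> z Bz i; rewrite subr0; exact: fc.
Qed.

Lemma coord_le_norm (v : 'rV[R]_n) i : `|v 0 i| <= `|v|.
Proof.
rewrite [leRHS]/Num.Def.normr/= mx_normrE.
exact: (le_bigmax _ (fun ij : 'I_1 * 'I_n => `|v ij.1 ij.2|) (0, i)).
Qed.

Lemma sum_coord_le (v : 'rV[R]_n) : \sum_i `|v 0 i| <= n%:R * `|v|.
Proof.
have -> : n%:R * `|v| = \sum_(i < n) `|v| by rewrite sumr_const card_ord mulr_natl.
by apply: ler_sum => i _; exact: coord_le_norm.
Qed.

Definition linear_form (c : 'I_n -> R) (v : 'rV[R]_n) : R := \sum_i c i * v 0 i.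

Fact linear_form_linear c : linear (linear_form c).
Proof.
move=> a u v; rewrite /linear_form scaler_sumr -big_split /=.
apply: eq_bigr => i _; rewrite !mxE mulrDr; congr (_ + _).
by rewrite mulrCA.
Qed.
HB.instance Definition _ c := GRing.isLinear.Build R 'rV[R]_n R *:%R
  (linear_form c) (linear_form_linear c).

Lemma linear_form_continuous c : continuous (linear_form c).
Proof.
move=> v; rewrite /linear_form.
apply: (@continuous_sum_at _ _ _ (fun i (v : 'rV[R]_n) => c i * v 0 i)) => i.
by apply: continuousM; [exact: cst_continuous|exact: (@matrix_normedtype.coord_continuous R 1 n 0 i v)].
Qed.

(** On a small cube the partial derivatives are close to their values at y, and
    [partial_approx] bounds the distance of f to its linear part accordingly. *)
Lemma differentiable_partials (f : 'rV[R]_n -> R) y :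
  (\forall z \near y, forall i : 'I_n, derivable f z (e_ i)) ->
  (forall i, {for y, continuous (partial i f)}) ->
  differentiable f y.
Proof.
move=> fd fc; pose c i := partial i f y.
have L (e : R) : 0 < e -> \forall v \near (0 : 'rV[R]_n),
    `|f (v + y) - f y - linear_form c v| <= e * `|v|.
  move=> e0.
  have e'0 : 0 < e / n.+1%:R by rewrite divr_gt0.
  have nc : \forall z \near y, forall i : 'I_n, `|partial i f z - c i| <= e / n.+1%:R.
    apply: (@filter_forall _ _ _ _ (@nbhs_filter 'rV[R]_n y)) => i.
    have /cvgrPdist_le/(_ _ e'0) := fc i.
    by apply: filterS => z; rewrite distrC.
  have /nbhs_ballP[d /= d0 bd] : \forall z \near y,
      (forall i : 'I_n, derivable f z (e_ i)) /\
      (forall i, `|partial i f z - c i| <= e / n.+1%:R).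
    by apply: filterS2 fd nc.
  apply/nbhs_ballP; exists d => // v; rewrite -ball_normE /= sub0r normrN => vd.
  have Bv : ball y d (v + y).
    by rewrite -ball_normE /= opprD addrCA subrr addr0 normrN.
  have := partial_approx (fun z Bz => (bd z Bz).1) (fun z Bz => (bd z Bz).2)
    (ballxx y d0) Bv.
  under eq_bigr do rewrite mxE addrK.
  under [X in _ <= _ * X -> _]eq_bigr do rewrite mxE addrK.
  move=> /le_trans; apply.
  rewrite -mulrA ler_pM2l// (le_trans (ler_wpM2l _ (sum_coord_le v)))//.
  rewrite mulrA ler_piMl// mulrC ler_pdivrMr// mul1r ler_nat.
  exact: leqnSn.
have dL : 'd f y = linear_form c :> ('rV[R]_n -> R).
  apply: diff_unique; first exact: linear_form_continuous.
  apply/eqaddoP => e /L; apply: filterS => v.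
  by rewrite !fctE /= opprD addrA.
apply/diff_locallyP; rewrite dL; split; first exact: linear_form_continuous.
apply/eqaddoP => e /L; apply: filterS => v.
by rewrite !fctE /= opprD addrA.
Qed.

Lemma derive_partials (f : 'rV[R]_n -> R) y v : differentiable f y ->
  'D_v f y = \sum_i v 0 i * partial i f y.
Proof.
move=> fd; rewrite deriveE// {1}[v]row_sum_delta linear_sum.
by apply: eq_bigr => i _; rewrite linearZ /partial deriveE.
Qed.

End Cubes.

Section ChainRule.
Context {R : realType} {n m : nat}.
Notation e_ i := (delta_mx 0 i : 'rV[R]_n).

Lemma differentiable_row (phi : 'rV[R]_n -> 'rV[R]_m) y :
  (forall j, differentiable (fun z => phi z 0 j) y) -> differentiable phi y.
Proof.
move=> phid.
have -> : phi = \sum_j (fun z => phi z 0 j *: (delta_mx 0 j : 'rV[R]_m)).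
  apply/funext => z; rewrite fct_sumE; exact: row_sum_delta.
by apply: differentiable_sum => j; exact: differentiableZl.
Qed.

Lemma derive_row (phi : 'rV[R]_n -> 'rV[R]_m) y i :
  differentiable phi y ->
  'D_(e_ i) phi y = \row_j partial i (fun z => phi z 0 j) y.
Proof.
move=> phid; rewrite derive_mx; last exact: diff_derivable.
by apply/rowP => j; rewrite !mxE.
Qed.

(** The Jacobian is defined from the Frechet differential, an arbitrary linear map
    where f is not differentiable: differentiability must be known first. *)
Lemma jacobian_partial (phi : 'rV[R]_n -> 'rV[R]_m) y i j :
  differentiable phi y -> ('J phi y) i j = partial i (fun z => phi z 0 j) y.
Proof.
move=> phid; have := deriveEjacobian (e_ i) phid.
by rewrite -rowE derive_row// => /rowP/(_ j); rewrite !mxE.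
Qed.

Lemma partial_comp (f : 'rV[R]_m -> R) (phi : 'rV[R]_n -> 'rV[R]_m) y i :
  differentiable phi y -> differentiable f (phi y) ->
  partial i (f \o phi) y
    = \sum_j partial i (fun z => phi z 0 j) y * partial j f (phi y).
Proof.
move=> phid fd; rewrite /partial deriveE; last exact: differentiable_comp.
rewrite diff_comp//= -(deriveE (e_ i) phid) -deriveE// derive_partials//.
by apply: eq_bigr => j _; rewrite derive_row// mxE.
Qed.

End ChainRule.

(** * Calculus of C^k functions *)

Lemma continuous_row (R : realType) (T : topologicalType) (m : nat)
    (phi : T -> 'rV[R]_m) (y : T) :
  (forall j, {for y, continuous (fun z => phi z 0 j)}) -> {for y, continuous phi}.
Proof.
move=> cphi A /= [P Pn PA].
have : \forall z \near y, forall j, P 0 j (phi z 0 j).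
  apply: (@filter_forall _ _ _ _ (@nbhs_filter T y)) => j; exact: cphi (Pn 0 j).
by apply: filterS => z Pz; apply: PA => i j; rewrite ord1.
Qed.

Section CkCalculus.
Context {R : realType} {n : nat}.
Implicit Types (f g : 'rV[R]_n -> R) (U V : set 'rV[R]_n).
Notation e_ i := (delta_mx 0 i : 'rV[R]_n).

Lemma Ck_continuous k U f y : Ck_on k U f -> U y -> {for y, continuous f}.
Proof. by case: k => [|k] [cf _]; exact: cf. Qed.

Lemma Ck_derivable k U f y i : Ck_on k.+1 U f -> U y -> derivable f y (e_ i).
Proof. by move=> [_ df] Uy; exact: (df i).1. Qed.

Lemma Ck_partial k U f i : Ck_on k.+1 U f -> Ck_on k U (partial i f).
Proof. by move=> [_ df]; exact: (df i).2. Qed.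

Lemma Ck_pred k U f : Ck_on k.+1 U f -> Ck_on k U f.
Proof.
elim: k f => [|k IH] f [cf df]; split => // i.
by split=> [y Uy|]; [exact: (df i).1|exact: IH (df i).2].
Qed.

Lemma Ck_sub k U V f : V `<=` U -> Ck_on k U f -> Ck_on k V f.
Proof.
move=> VU; elim: k f => [|k IH] f [cf df]; split => //.
- by move=> y /VU; exact: cf.
- by move=> y /VU; exact: cf.
- by move=> i; split=> [y /VU|]; [exact: (df i).1|exact: IH (df i).2].
Qed.

Lemma open_near U y (P : 'rV[R]_n -> Prop) : open U -> U y ->
  (forall z, U z -> P z) -> \forall z \near y, P z.
Proof. by move=> oU Uy UP; apply: filterS (open_nbhs_nbhs (conj oU Uy)). Qed.

Lemma eq_partial U f g y i : open U -> U y -> (forall z, U z -> f z = g z) ->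
  partial i f y = partial i g y.
Proof. by move=> oU Uy fg; apply: near_eq_derive; exact: open_near oU Uy fg. Qed.

Lemma eq_Ck k U f g : open U -> (forall z, U z -> f z = g z) ->
  Ck_on k U f -> Ck_on k U g.
Proof.
move=> oU; elim: k f g => [|k IH] f g fg [cf df].
  split=> // y Uy; have nfg := open_near oU Uy fg.
  rewrite /prop_for /continuous_at -(fg y Uy).
  by apply: (cvg_trans _ (cf y Uy)); exact: (near_eq_cvg nfg).
split=> [y Uy|i].
  have nfg := open_near oU Uy fg.
  rewrite /prop_for /continuous_at -(fg y Uy).
  by apply: (cvg_trans _ (cf y Uy)); exact: (near_eq_cvg nfg).
split=> [y Uy|].
  by apply: near_eq_derivable ((df i).1 y Uy); exact: open_near oU Uy fg.
by apply: IH (df i).2 => z Uz; exact: eq_partial oU Uz fg.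
Qed.

Lemma Ck_differentiable k U f y : open U -> Ck_on k.+1 U f -> U y ->
  differentiable f y.
Proof.
move=> oU Cf Uy; apply: differentiable_partials.
  by apply: open_near oU Uy _ => z Uz i; exact: Ck_derivable Cf Uz.
by move=> i; exact: Ck_continuous (Ck_partial i Cf) Uy.
Qed.

Lemma partial_cst c y i : partial i (fun _ : 'rV[R]_n => c) y = 0.
Proof. exact: derive_cst. Qed.

Lemma Ck_cst k U c : Ck_on k U (fun=> c).
Proof.
elim: k c => [|k IH] c; first by split=> // y _; exact: cst_continuous.
split=> [y _|i]; first exact: cst_continuous.
split=> [y _|]; first exact: derivable_cst.
by rewrite (_ : partial i _ = fun=> 0); [exact: IH|apply/funext => y; exact: partial_cst].
Qed.

Lemma partialD f g y i : derivable f y (e_ i) -> derivable g y (e_ i) ->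
  partial i (fun z => f z + g z) y = partial i f y + partial i g y.
Proof. by move=> fd gd; rewrite /partial [LHS](deriveD fd gd). Qed.

Lemma partialM f g y i : derivable f y (e_ i) -> derivable g y (e_ i) ->
  partial i (fun z => f z * g z) y = f y * partial i g y + g y * partial i f y.
Proof. by move=> fd gd; rewrite /partial [LHS](deriveM fd gd). Qed.

Lemma partialN f y i : derivable f y (e_ i) ->
  partial i (fun z => - f z) y = - partial i f y.
Proof. by move=> fd; rewrite /partial [LHS](deriveN fd). Qed.

Lemma partialV f y i : f y != 0 -> derivable f y (e_ i) ->
  partial i (fun z => (f z)^-1) y = - (f y) ^- 2 * partial i f y.
Proof. by move=> f0 fd; rewrite /partial [LHS](deriveV f0 fd). Qed.

Lemma partial_sum (I : finType) (F : I -> 'rV[R]_n -> R) y i :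
  (forall j, derivable (F j) y (e_ i)) ->
  partial i (fun z => \sum_j F j z) y = \sum_j partial i (F j) y.
Proof.
move=> Fd; suff [] : derivable (fun z => \sum_j F j z) y (e_ i) /\
  partial i (fun z => \sum_j F j z) y = \sum_j partial i (F j) y by [].
elim: (index_enum I) => [|j s [IHd IH]].
  under eq_fun do rewrite big_nil.
  by rewrite big_nil partial_cst; split=> //; exact: derivable_cst.
under eq_fun do rewrite big_cons.
rewrite big_cons -IH; split; first exact: derivableD (Fd j) IHd.
exact: partialD (Fd j) IHd.
Qed.

Section Open.
Variables (U : set 'rV[R]_n) (oU : open U).

Lemma CkD k f g : Ck_on k U f -> Ck_on k U g -> Ck_on k U (fun z => f z + g z).
Proof.
have cD l f1 g1 : Ck_on l U f1 -> Ck_on l U g1 ->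
    forall y, U y -> {for y, continuous (fun z => f1 z + g1 z)}.
  move=> Cf Cg y Uy.
  by apply: continuousD; [exact: Ck_continuous Cf Uy|exact: Ck_continuous Cg Uy].
elim: k f g => [|k IH] f g Cf Cg; first by split=> //; exact: cD Cf Cg.
split=> [|i]; first exact: cD Cf Cg.
split=> [y Uy|].
  by apply: derivableD; [exact: Ck_derivable Cf Uy|exact: Ck_derivable Cg Uy].
apply: eq_Ck (IH _ _ (Ck_partial i Cf) (Ck_partial i Cg)) => // z Uz.
by rewrite partialD//; [exact: Ck_derivable Cf Uz|exact: Ck_derivable Cg Uz].
Qed.

Lemma CkM k f g : Ck_on k U f -> Ck_on k U g -> Ck_on k U (fun z => f z * g z).
Proof.
have cM l f1 g1 : Ck_on l U f1 -> Ck_on l U g1 ->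
    forall y, U y -> {for y, continuous (fun z => f1 z * g1 z)}.
  move=> Cf Cg y Uy.
  by apply: continuousM; [exact: Ck_continuous Cf Uy|exact: Ck_continuous Cg Uy].
elim: k f g => [|k IH] f g Cf Cg; first by split=> //; exact: cM Cf Cg.
split=> [|i]; first exact: cM Cf Cg.
split=> [y Uy|].
  by apply: derivableM; [exact: Ck_derivable Cf Uy|exact: Ck_derivable Cg Uy].
have [Cf' Cg'] := (Ck_pred Cf, Ck_pred Cg).
apply: eq_Ck (CkD (IH _ _ Cf' (Ck_partial i Cg)) (IH _ _ Cg' (Ck_partial i Cf))) => // z Uz.
by rewrite partialM//; [exact: Ck_derivable Cf Uz|exact: Ck_derivable Cg Uz].
Qed.

Lemma CkN k f : Ck_on k U f -> Ck_on k U (fun z => - f z).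
Proof.
move=> Cf; apply: eq_Ck (CkM (Ck_cst k U (- 1)) Cf) => // z _.
by rewrite mulN1r.
Qed.

Lemma CkB k f g : Ck_on k U f -> Ck_on k U g -> Ck_on k U (fun z => f z - g z).
Proof. by move=> Cf Cg; exact: CkD Cf (CkN Cg). Qed.

Lemma Ck_sum k (I : finType) (F : I -> 'rV[R]_n -> R) :
  (forall j, Ck_on k U (F j)) -> Ck_on k U (fun z => \sum_j F j z).
Proof.
move=> CF; elim: (index_enum I) => [|j s IH].
  by under eq_fun do rewrite big_nil; exact: Ck_cst.
by under eq_fun do rewrite big_cons; exact: CkD.
Qed.

Lemma Ck_prod k (I : finType) (F : I -> 'rV[R]_n -> R) :
  (forall j, Ck_on k U (F j)) -> Ck_on k U (fun z => \prod_j F j z).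
Proof.
move=> CF; elim: (index_enum I) => [|j s IH].
  by under eq_fun do rewrite big_nil; exact: Ck_cst.
by under eq_fun do rewrite big_cons; exact: CkM.
Qed.

Lemma CkV k f : (forall z, U z -> f z != 0) -> Ck_on k U f ->
  Ck_on k U (fun z => (f z)^-1).
Proof.
move=> f0.
have cV l : Ck_on l U f -> forall y, U y -> {for y, continuous (fun z => (f z)^-1)}.
  by move=> Cf y Uy; apply: continuousV; [exact: f0|exact: Ck_continuous Cf Uy].
elim: k => [|k IH] Cf; first by split=> //; exact: cV Cf.
split=> [|i]; first exact: cV Cf.
split=> [y Uy|].
  by apply: derivableV; [exact: f0|exact: Ck_derivable Cf Uy].
have CV := IH (Ck_pred Cf).
apply: eq_Ck (CkM (CkN (CkM CV CV)) (Ck_partial i Cf)) => // z Uz.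
by rewrite partialV ?f0//; [rewrite -exprVn expr2|exact: Ck_derivable Cf Uz].
Qed.

Lemma Ck_det k m (A : 'rV[R]_n -> 'M[R]_m) :
  (forall i j, Ck_on k U (fun z => A z i j)) -> Ck_on k U (fun z => \det (A z)).
Proof.
move=> CA; apply: Ck_sum => s; apply: CkM; first exact: Ck_cst.
by apply: Ck_prod => i; exact: CA.
Qed.

(** The inverse is the adjugate divided by the determinant. *)
Lemma Ck_invmx k m (A : 'rV[R]_n -> 'M[R]_m) :
  (forall z, U z -> A z \in unitmx) ->
  (forall i j, Ck_on k U (fun z => A z i j)) ->
  forall i j, Ck_on k U (fun z => invmx (A z) i j).
Proof.
move=> uA CA i j.
have C : Ck_on k U (fun z => (\det (A z))^-1 * \adj (A z) i j).
  apply: CkM.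
    by apply: CkV => [z Uz|]; [rewrite -unitfE -unitmxE uA|exact: Ck_det].
  rewrite (_ : (fun z => \adj (A z) i j) =
    fun z => (-1) ^+ (j + i) * \det (row' j (col' i (A z)))); last first.
    by apply/funext => z; rewrite mxE.
  apply: CkM; first exact: Ck_cst.
  apply: Ck_det => k1 l; apply: eq_Ck (CA (lift j k1) (lift i l)) => // z _.
  by rewrite !mxE.
by apply: eq_Ck C => // z Uz; rewrite /invmx uA// !mxE.
Qed.

End Open.

(** By induction on k: the chain rule writes the partial derivatives of the
    composite as sums of products of functions of one class less. *)
Lemma Ck_comp k U V (phi : 'rV[R]_n -> 'rV[R]_n) f : open U -> open V ->
  (forall z, U z -> V (phi z)) -> (forall j, Ck_on k U (fun z => phi z 0 j)) ->
  Ck_on k V f -> Ck_on k U (f \o phi).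
Proof.
move=> oU oV UV; elim: k f => [|k IH] f Cphi Cf.
  split=> // y Uy; apply: continuous_comp.
    by apply: continuous_row => j; exact: Ck_continuous (Cphi j) Uy.
  exact: Ck_continuous Cf (UV _ Uy).
have dphi y : U y -> differentiable phi y.
  by move=> Uy; apply: differentiable_row => j; exact: Ck_differentiable oU (Cphi j) Uy.
have df y : U y -> differentiable f (phi y).
  by move=> /UV; exact: Ck_differentiable oV Cf.
split=> [y Uy|i].
  by apply: differentiable_continuous; apply: differentiable_comp; [exact: dphi|exact: df].
split=> [y Uy|].
  by apply: diff_derivable; apply: differentiable_comp; [exact: dphi|exact: df].
have C : Ck_on k U (fun y => \sum_j partial i (fun z => phi z 0 j) y * partial j f (phi y)).
  apply: (Ck_sum oU) => j; apply: (CkM oU); first exact: Ck_partial (Cphi j).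
  by apply: (IH (partial j f)); [move=> l; exact: Ck_pred (Cphi l)|exact: Ck_partial Cf].
by apply: eq_Ck C => // z Uz; rewrite partial_comp; [|exact: dphi|exact: df].
Qed.

Lemma is_derive_translate f (c z v : 'rV[R]_n) : derivable f (z + c) v ->
  is_derive z v (fun x => f (x + c)) ('D_v f (z + c)).
Proof.
move=> fd.
suff E : (fun h : R => h^-1 *: (((fun x => f (x + c)) \o shift z) (h *: v)
    - f (z + c) : R)) = (fun h : R => h^-1 *: ((f \o shift (z + c)) (h *: v)
    - f (z + c) : R)).
  by split; rewrite /derivable /derive E.
by apply/funext => h /=; rewrite /shift /= addrA.
Qed.

Lemma ball_corner (y : 'rV[R]_n) (d a b : R) i j : 0 < d ->
  `|a| <= d -> `|b| <= d -> ball y (d *+ 3) (y + a *: e_ i + b *: e_ j).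
Proof.
move=> d0 ad bd; have d3 : 0 < d *+ 3 by rewrite pmulrn_lgt0.
apply/cubeP => // l; rewrite !mxE eqxx/=.
set p := (l == i)%:R : R; set q := (l == j)%:R : R.
have -> : y 0 l - (y 0 l + a * p + b * q) = - (a * p + b * q) by ring.
rewrite normrN (le_lt_trans (ler_normD _ _))//.
have bit (c : R) (u : bool) : `|c| <= d -> `|c * u%:R| <= d.
  by case: u => cd; rewrite ?mulr1// mulr0 normr0 ltW.
by rewrite (le_lt_trans (lerD (bit a _ ad) (bit b _ bd)))// !mulrS mulr0n addr0 ltrD2l ltrDl.
Qed.

(** The second difference over a small square is, by the mean value theorem along
    one side and then along the other, a mixed partial derivative. *)
Lemma second_difference f y d i j : 0 < d ->
  (forall z, ball y (d *+ 3) z -> derivable f z (e_ i)) ->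
  (forall z, ball y (d *+ 3) z -> derivable (partial i f) z (e_ j)) ->
  exists2 z, ball y (d *+ 3) z &
    f (y + d *: e_ i + d *: e_ j) - f (y + d *: e_ i)
      - f (y + d *: e_ j) + f y = d ^+ 2 * partial j (partial i f) z.
Proof.
move=> d0 df ddf; have ld : `|d| <= d by rewrite gtr0_norm.
have l0 : `|0 : R| <= d by rewrite normr0 ltW.
have sd s : 0 <= s <= 1 -> `|s * d| <= d.
  move=> /andP[s0 s1]; rewrite normrM (ger0_norm s0) (gtr0_norm d0).
  by rewrite ler_piMl// ltW.
pose g z := f (z + d *: e_ j) - f z.
have gd s : 0 <= s <= 1 -> is_derive (y + (s * d) *: e_ i) (e_ i) g
    (partial i f (y + (s * d) *: e_ i + d *: e_ j) - partial i f (y + (s * d) *: e_ i)).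
  move=> s01; apply: is_deriveB.
    by apply: is_derive_translate; apply: df; apply: ball_corner => //; exact: sd.
  apply: derivableP; apply: df.
  by have := @ball_corner y d (s * d) 0 i j d0 (sd _ s01) l0; rewrite scale0r addr0.
have [s s01 E1] := @mvt_line _ _ g y (e_ i) d (fun s s01 => (@ex_derive _ _ _ _ _ _ _ (gd s s01))).
have [t t01 E2] := @mvt_line _ _ (partial i f) (y + (s * d) *: e_ i) (e_ j) d
  (fun t t01 => ddf _ (ball_corner y i j d0 (sd _ s01) (sd _ t01))).
exists (y + (s * d) *: e_ i + (t * d) *: e_ j).
  by apply: ball_corner => //; exact: sd.
move: E1; rewrite (@derive_val _ _ _ _ _ _ _ (gd s s01)) E2 /g /partial expr2 -mulrA => <-.
rewrite opprB addrA; exact: addrAC.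
Qed.

(** The second difference is symmetric in i and j, and both mixed derivatives are
    limits of its quotient by the area of the square. *)
Lemma partialC U f y i j : open U -> Ck_on 2 U f -> U y ->
  partial i (partial j f) y = partial j (partial i f) y.
Proof.
move=> oU Cf Uy; apply/eqP; rewrite -subr_eq0 -normr_eq0 eq_le normr_ge0 andbT.
apply/ler_addgt0Pl => e e0; rewrite addr0.
have e20 : 0 < e / 2 by rewrite divr_gt0.
pose close k l := \forall z \near y,
  `|partial l (partial k f) y - partial l (partial k f) z| <= e / 2.
have near_close k l : close k l.
  have := Ck_continuous (Ck_partial l (Ck_partial k Cf)) Uy.
  by move=> /cvgrPdist_le/(_ _ e20).
have /nbhs_ballP[r /= r0 Br] : \forall z \near y, U z /\
    (`|partial j (partial i f) y - partial j (partial i f) z| <= e / 2 /\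
     `|partial i (partial j f) y - partial i (partial j f) z| <= e / 2).
  exact: (filterI (open_near oU Uy (fun z Uz => Uz))
    (filterI (near_close i j) (near_close j i))).
(* the corners of the square of side d stay in the cube of radius 3 d = r *)
pose d := r / 3.
have d0 : 0 < d by rewrite divr_gt0.
have d3 : d *+ 3 = r by rewrite -mulr_natr divfK// pnatr_eq0.
have H k l := @second_difference f y d k l d0.
rewrite d3 in H.
have dB k z : ball y r z -> derivable f z (e_ k).
  by move=> /Br[Uz _]; exact: Ck_derivable Cf Uz.
have ddB k l z : ball y r z -> derivable (partial k f) z (e_ l).
  by move=> /Br[Uz _]; exact: Ck_derivable (Ck_partial k Cf) Uz.
have [z Bz Ez] := H i j (dB i) (ddB i j).
have [z' Bz' Ez'] := H j i (dB j) (ddB j i).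
have E : partial j (partial i f) z = partial i (partial j f) z'.
  apply: (mulfI (x := d ^+ 2)); first by rewrite expf_neq0// gt_eqF.
  have Ey : y + d *: e_ j + d *: e_ i = y + d *: e_ i + d *: e_ j.
    exact: addrAC.
  apply: etrans (esym Ez) (etrans _ Ez'); rewrite Ey; congr (_ + _).
  exact: addrAC.
have [_ [c1 _]] := Br _ Bz; have [_ [_ c2]] := Br _ Bz'.
rewrite (splitr e); rewrite -E in c2.
set u := partial j (partial i f) z in c1 c2 *.
have -> : partial i (partial j f) y - partial j (partial i f) y =
  (partial i (partial j f) y - u) + (u - partial j (partial i f) y).
  by rewrite addrA subrK.
apply: le_trans (ler_normD _ _) _; apply: lerD; first exact: c2.
by rewrite distrC; exact: c1.
Qed.

End CkCalculus.

Lemma Ck_local (R : realType) (n k : nat) (U : set 'rV[R]_n) (f : 'rV[R]_n -> R) :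
  (forall y, U y -> exists2 V, V y & Ck_on k V f) -> Ck_on k U f.
Proof.
elim: k f => [|k IH] f loc.
  by split=> // y Uy; have [V Vy CV] := loc y Uy; exact: Ck_continuous CV Vy.
split=> [y Uy|i].
  by have [V Vy CV] := loc y Uy; exact: Ck_continuous CV Vy.
split=> [y Uy|]; first by have [V Vy CV] := loc y Uy; exact: Ck_derivable CV Vy.
apply: IH => y Uy; have [V Vy CV] := loc y Uy.
by exists V => //; exact: Ck_partial.
Qed.

Lemma is_derive_sqrt (R : realType) (n : nat) (f : 'rV[R]_n -> R) y v :
  0 < f y -> differentiable f y ->
  is_derive y v (fun z => Num.sqrt (f z)) ((2 * Num.sqrt (f y))^-1 * 'D_v f y).
Proof.
move=> f0 fd.
have sd : differentiable (@Num.sqrt R) (f y).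
  by apply/derivable1_diffP; have [] := is_derive1_sqrt f0.
have cd : differentiable (@Num.sqrt R \o f) y by exact: differentiable_comp.
split; first exact: diff_derivable cd.
rewrite [LHS](deriveE v cd) diff_comp//= -[in LHS](deriveE v fd).
have -> : 'd (@Num.sqrt R) (f y) ('D_v f y) = 'D_v f y * 'd (@Num.sqrt R) (f y) 1.
  by rewrite -[X in 'd _ _ X]mulr1 -[_ * 1]/('D_v f y *: (1 : R)) linearZ.
by rewrite -deriveE// derive_sqrt// mulrC.
Qed.

Lemma C1_sqrt (R : realType) (n : nat) (U : set 'rV[R]_n) (f : 'rV[R]_n -> R) :
  open U -> (forall y, U y -> 0 < f y) -> Ck_on 1 U f ->
  Ck_on 1 U (fun y => Num.sqrt (f y)).
Proof.
move=> oU f0 Cf.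
have sc y : U y -> {for y, continuous (fun y => Num.sqrt (f y))}.
  move=> Uy; apply: continuous_comp; first exact: Ck_continuous Cf Uy.
  exact: sqrt_continuous.
have sd i y (Uy : U y) := is_derive_sqrt (delta_mx 0 i) (f0 y Uy)
  (Ck_differentiable oU Cf Uy).
split=> [|i]; first exact: sc.
split=> [y Uy|]; first by have [] := sd i y Uy.
apply: (@eq_Ck _ _ 0 U (fun y => (2 * Num.sqrt (f y))^-1 * partial i f y)) => // [y Uy|].
  by have d := sd i y Uy; rewrite /partial derive_val.
apply: (CkM oU); last exact: Ck_partial.
apply: (CkV oU) => [y Uy|]; first by rewrite mulf_neq0 ?pnatr_eq0// gt_eqF// sqrtr_gt0 f0.
by apply: (CkM oU); [exact: Ck_cst|split].
Qed.

(** * Linear ordinary differential equations on the unit interval *)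

Section UnitInterval.
Context {R : realType}.
Implicit Types (t : R).

Lemma is_derive_sum_fin (V : normedModType R) (I : finType) (F : I -> V -> R)
    (dF : I -> R) (x v : V) :
  (forall j, is_derive x v (F j) (dF j)) ->
  is_derive x v (fun z => \sum_j F j z) (\sum_j dF j).
Proof.
move=> Fd; elim: (index_enum I) => [|j s IH].
  by under eq_fun do rewrite big_nil; rewrite big_nil; exact: is_derive_cst.
under eq_fun do rewrite big_cons.
by rewrite big_cons; exact: is_deriveD.
Qed.

Lemma is_derive_continuous (f : R -> R) t df :
  is_derive t 1 f df -> {for t, continuous f}.
Proof. by move=> [fd _]; exact/differentiable_continuous/derivable1_diffP. Qed.

Lemma mvt_unit (f df : R -> R) t : 0 <= t <= 1 ->
  (forall s : R, 0 <= s <= 1 -> is_derive s 1 f (df s)) ->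
  exists2 s, 0 <= s <= 1 & f t - f 0 = df s * t.
Proof.
move=> /andP[t0 t1] fd.
have [s /[!in_itv]/= /andP[s0 st]|s] := @mvt_derive R f df 0 t t0.
  by apply: fd; rewrite s0 (le_trans st).
rewrite in_itv/= subr0 => /andP[s0 st] E.
by exists s => //; rewrite s0 (le_trans st).
Qed.

(** A Gronwall estimate: at the time where the l1-norm of D is largest, the mean
    value theorem bounds that norm by half of itself plus the constant terms. *)
Lemma contraction_bound (I : finType) (D dD : R -> I -> R) (k e d : R) :
  0 <= k -> #|I|%:R * k <= 2^-1 ->
  (forall t : R, 0 <= t <= 1 -> forall i, is_derive t 1 (D^~ i) (dD t i)) ->
  (forall t : R, 0 <= t <= 1 -> forall i, `|dD t i| <= k * (\sum_l `|D t l|) + e) ->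
  (forall i, `|D 0 i| <= d) ->
  forall t : R, 0 <= t <= 1 -> \sum_l `|D t l| <= 2 * (#|I|%:R * (d + e)).
Proof.
move=> k0 kI Dd dDb D0 t t01.
pose N s := \sum_l `|D s l|.
have cN : {within `[0, 1], continuous N}.
  apply/continuous_in_subspaceT => s; rewrite inE/= in_itv/= => s01.
  apply: (@continuous_sum_at _ _ _ (fun l s => `|D s l|)) => l.
  apply: continuous_comp; last exact: norm_continuous.
  exact: is_derive_continuous (Dd s s01 l).
have [m /[!in_itv]/= m01 Nm] := EVT_max (@ler01 R) cN.
have {}Nm s : 0 <= s <= 1 -> N s <= N m by move=> s01; apply: Nm; rewrite in_itv.
have bi i : `|D m i| <= d + (k * N m + e).
  have [s s01 E] := @mvt_unit (D^~ i) (dD^~ i) m m01 (fun s s01 => Dd s s01 i).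
  rewrite -(subrK (D 0 i) (D m i)) addrC (le_trans (ler_normD _ _))// lerD//.
  rewrite E normrM; case/andP: m01 => m0 m1; rewrite (ger0_norm m0).
  rewrite (le_trans (ler_piMr _ m1))// (le_trans (dDb s s01 i))// lerD2r.
  by rewrite ler_wpM2l// Nm.
have : N m <= #|I|%:R * (d + (k * N m + e)).
  by rewrite mulr_natl -sumr_const; apply: ler_sum => i _; exact: bi.
have N0 : 0 <= N m by rewrite sumr_ge0.
have := ler_wpM2r N0 kI.
have := Nm t t01; rewrite -/(N t) => H1 H2 H3; nra.
Qed.

Lemma antiderivative (f : R -> R) (c : R) : continuous f ->
  exists2 G : R -> R, G 0 = c & forall t : R, 0 <= t <= 1 -> is_derive t 1 G (f t).
Proof.
move=> cf; pose F (x : R) := (\int[lebesgue_measure]_(t in `[(-1 : R), x]) f t)%R.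
have Fd t : 0 <= t <= 1 -> is_derive t 1 F (f t).
  move=> /andP[t0 t1].
  have [||||dF EF] := @continuous_FTC1_closed R f (-1) t 2.
  - by rewrite (le_lt_trans t1)// ltr1n.
  - apply: continuous_compact_integrable; first exact: segment_compact.
    by apply: continuous_subspaceT.
  - by rewrite (lt_le_trans _ t0)// ltrN10.
  - exact: cf.
  by split; [exact: dF|rewrite -derive1E; exact: EF].
(* the integral starts at -1, so that the derivative at 0 is two-sided *)
exists (fun x => F x - F 0 + c); first by rewrite subrr add0r.
move=> t t01; have := Fd t t01 => Ft.
by apply: is_derive_eq; rewrite subr0 addr0.
Qed.

(** The sequences u k - 2 C / 2^k and u k + 2 C / 2^k are monotone and enclose the
    supremum of the first one. *)
Lemma geometric_limit (u : nat -> R) (C : R) :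
  (forall k, `|u k.+1 - u k| <= C * 2^-1 ^+ k) ->
  exists l, forall k, `|l - u k| <= 2 * C * 2^-1 ^+ k.
Proof.
move=> uC.
have uu k : u k - 2 * C * 2^-1 ^+ k <= u k.+1 - 2 * C * 2^-1 ^+ k.+1 /\
            u k.+1 + 2 * C * 2^-1 ^+ k.+1 <= u k + 2 * C * 2^-1 ^+ k.
  have := uC k; rewrite exprS ler_norml; set q := 2^-1 ^+ k.
  have -> : 2 * C * (2^-1 * q) = C * q by rewrite mulrA [2 * C]mulrC mulfK.
  by move=> /andP[H1 H2]; split; lra.
have C0 : 0 <= C by have := le_trans (normr_ge0 _) (uC 0%N); rewrite expr0 mulr1.
have q0 k : 0 <= 2 * C * 2^-1 ^+ k.
  by rewrite !mulr_ge0// exprn_ge0// invr_ge0.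
have mono j k : u j - 2 * C * 2^-1 ^+ j <= u (j + k)%N - 2 * C * 2^-1 ^+ (j + k).
  by elim: k => [|k IH]; rewrite ?addn0// addnS (le_trans IH)// (uu _).1.
have anti j k : u (j + k)%N + 2 * C * 2^-1 ^+ (j + k) <= u j + 2 * C * 2^-1 ^+ j.
  by elim: k => [|k IH]; rewrite ?addn0// addnS (le_trans _ IH)// (uu _).2.
have cross j k : u j - 2 * C * 2^-1 ^+ j <= u k + 2 * C * 2^-1 ^+ k.
  have := mono j k; have := anti k j; rewrite [(k + j)%N]addnC.
  by have := q0 (j + k)%N; lra.
pose E := [set a | exists k, a = u k - 2 * C * 2^-1 ^+ k].
have Eub k : ubound E (u k + 2 * C * 2^-1 ^+ k) by move=> _ [j ->]; exact: cross.
have hsE : has_sup E.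
  by split; [exists (u 0%N - 2 * C * 2^-1 ^+ 0), 0%N|exists (u 0%N + 2 * C * 2^-1 ^+ 0)].
exists (sup E) => k; rewrite ler_distl; apply/andP; split.
  by apply: ub_le_sup; [case: hsE|exists k].
by apply: ge_sup; [case: hsE|exact: Eub].
Qed.

(** Composition with clamp makes a function continuous on the whole line out of
    one continuous at the points of [0, 1], without changing it there. *)
Definition clamp t : R := Num.max 0 (Num.min t 1).

Lemma clamp_continuous : continuous clamp.
Proof.
move=> t.
apply: (@continuous_max _ _ (fun=> 0) (fun t => Num.min t 1)).
  exact: cst_continuous.
by apply: (@continuous_min _ _ id (fun=> 1)); [exact: cvg_id|exact: cst_continuous].
Qed.

Lemma clamp_unit t : 0 <= clamp t <= 1.
Proof. by rewrite /clamp le_max lexx/= ge_max ler01/= ge_min lexx orbT. Qed.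

Lemma clamp_id t : 0 <= t <= 1 -> clamp t = t.
Proof. by move=> /andP[t0 t1]; rewrite /clamp min_l// max_r. Qed.

Lemma clamp_comp_continuous (f : R -> R) :
  (forall t : R, 0 <= t <= 1 -> {for t, continuous f}) -> continuous (f \o clamp).
Proof.
move=> cf t; apply: continuous_comp; first exact: clamp_continuous.
exact/cf/clamp_unit.
Qed.

End UnitInterval.

Lemma geometric_small {R : realType} (c e : R) : 0 <= c -> 0 < e ->
  exists m, c * 2^-1 ^+ m <= e.
Proof.
move=> c0 e0; exists (Num.bound (c / e)).
have := archi_boundP (divr_ge0 c0 (ltW e0)); set m := Num.bound _ => cm.
rewrite exprVn ler_pdivrMr ?exprn_gt0// mulrC -ler_pdivrMr//.
by rewrite (le_trans (ltW cm))// -natrX ler_nat ltnW// ltn_expl.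
Qed.

Lemma eq_of_geometric {R : realType} (a b c : R) :
  (forall m, `|a - b| <= c * 2^-1 ^+ m) -> a = b.
Proof.
move=> H; apply/eqP; rewrite -subr_eq0 -normr_eq0 eq_le normr_ge0 andbT.
apply/ler_addgt0Pl => e e0; rewrite addr0.
have c0 : 0 <= c by have := le_trans (normr_ge0 _) (H 0%N); rewrite expr0 mulr1.
by have [m] := geometric_small c0 e0; exact/le_trans/H.
Qed.

Section PicardIteration.
Context {R : realType} {I : finType}.
Variables (B : R -> I -> I -> R) (k : R) (y0 : I -> R).
Hypotheses (k0 : 0 <= k) (kI : #|I|%:R * k <= 2^-1).
Hypothesis cB : forall t : R, 0 <= t <= 1 -> forall l i,
  {for t, continuous (fun t => B t l i)}.
Hypothesis kB : forall t : R, 0 <= t <= 1 -> forall l i, `|B t l i| <= k.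
Implicit Types (X : R -> I -> R) (t : R).

Let antider (c : R) (f : R -> R) : R -> R := xget (fun=> 0)
  [set G | G 0 = c /\ forall t : R, 0 <= t <= 1 -> is_derive t 1 G (f t)].

Let step X t i := antider (y0 i)
  (fun s => \sum_l X (clamp s) l * B (clamp s) l i) t.

Let clamp_cont X := forall i, continuous (fun s => X (clamp s) i).

Let step_spec X i : clamp_cont X -> step X 0 i = y0 i /\
  forall t, 0 <= t <= 1 ->
    is_derive t 1 (fun t => step X t i) (\sum_l X t l * B t l i).
Proof.
move=> cX; pose f s := \sum_l X (clamp s) l * B (clamp s) l i.
have cf : continuous f.
  move=> s.
  apply: (@continuous_sum_at _ _ _ (fun l s => X (clamp s) l * B (clamp s) l i)) => l.
  apply: continuousM; first exact: cX.
  exact: (@clamp_comp_continuous R (fun t => B t l i) (fun t t01 => @cB t t01 l i) s).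
have [G G0 Gd] := antiderivative (y0 i) cf.
have [H0 Hd] : [set G | G 0 = y0 i /\ forall t, 0 <= t <= 1 ->
    is_derive t 1 G (f t)] (antider (y0 i) f).
  by rewrite /antider; apply: (xgetPex (fun=> 0)); exists G.
split=> // t t01; have := Hd t t01.
suff -> : f t = \sum_l X t l * B t l i by [].
by apply: eq_bigr => l _; rewrite clamp_id.
Qed.

Let step_cont X : clamp_cont X -> clamp_cont (step X).
Proof.
move=> cX i; apply: (@clamp_comp_continuous R (fun t => step X t i)) => t t01.
exact: is_derive_continuous ((step_spec i cX).2 t t01).
Qed.

(** The increment of a step is at most the largest value of its derivative, and
    the factor #|I| * k <= 1/2 halves the l1-distance. *)
Let step_contracts X X' c : clamp_cont X -> clamp_cont X' ->
  (forall t, 0 <= t <= 1 -> \sum_l `|X' t l - X t l| <= c) ->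
  forall t, 0 <= t <= 1 -> \sum_i `|step X' t i - step X t i| <= c * 2^-1.
Proof.
move=> cX cX' Xc t t01.
have c0 : 0 <= c by apply: le_trans (Xc t t01); rewrite sumr_ge0.
have bi i : `|step X' t i - step X t i| <= k * c.
  have [X0 Xd] := step_spec i cX; have [X0' Xd'] := step_spec i cX'.
  have [s s01] := @mvt_unit R (fun t => step X' t i - step X t i) _ t t01
    (fun s s01 => is_deriveB (Xd' s s01) (Xd s s01)).
  rewrite X0 X0' subrr subr0 => ->.
  case/andP: t01 => t0 t1; rewrite normrM (ger0_norm t0).
  rewrite (le_trans (ler_piMr _ t1))// -sumrB.
  apply: le_trans (ler_wpM2l k0 (Xc s s01)).
  rewrite mulr_sumr (le_trans (ler_norm_sum _ _ _))//.
  by apply: ler_sum => l _; rewrite -mulrBl normrM mulrC ler_wpM2r// kB.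
rewrite (@le_trans _ _ (\sum_(i in I) k * c))//; first exact: ler_sum.
by rewrite sumr_const -[_ *+ _]mulr_natl mulrA mulrC ler_wpM2l.
Qed.

(** The Picard iterates converge geometrically and uniformly on [0, 1]; their
    limit is continuous and is fixed by one more step, hence differentiable. *)
Lemma linear_ode_existence : exists F : R -> I -> R,
  (forall i, F 0 i = y0 i) /\
  forall t, 0 <= t <= 1 -> forall i,
    is_derive t 1 (fun t => F t i) (\sum_l F t l * B t l i).
Proof.
pose X m := iter m step (fun _ _ => 0).
have cX m : clamp_cont (X m).
  by elim: m => [|m IH]; [move=> i; exact: cst_continuous|exact: step_cont].
pose C := \sum_i `|y0 i|.
have XC m t : 0 <= t <= 1 -> \sum_i `|X m.+1 t i - X m t i| <= C * 2^-1 ^+ m.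
  elim: m t => [|m IH] t t01.
    rewrite expr0 mulr1; apply: ler_sum => i _; rewrite subr0.
    have [S0 Sd] := step_spec i (cX 0%N).
    have [s s01] := mvt_unit t01 Sd.
    rewrite big1 ?mul0r; last by move=> l _; rewrite mul0r.
    rewrite S0 => /eqP; rewrite subr_eq0 => /eqP E.
    by rewrite [X 1%N t i]E.
  by rewrite exprSr mulrA; exact: (step_contracts (cX m) (cX m.+1) IH t01).
have [L HL] : {L : R * I -> R & forall p : R * I, 0 <= p.1 <= 1 ->
    forall m, `|L p - X m p.1 p.2| <= 2 * C * 2^-1 ^+ m}.
  apply: (@choice _ _ (fun (p : R * I) l => 0 <= p.1 <= 1 ->
    forall m, `|l - X m p.1 p.2| <= 2 * C * 2^-1 ^+ m)) => -[t i] /=.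
  have [t01|] := boolP (0 <= t <= 1); last by exists 0.
  have [|l Hl] := @geometric_limit R (fun m => X m t i) C; last by exists l.
  move=> m; apply: le_trans (XC m t t01).
  by rewrite (bigD1 i)//= lerDl sumr_ge0.
pose Y t i := L (t, i).
have YX m t : 0 <= t <= 1 -> \sum_i `|Y t i - X m t i| <= #|I|%:R * (2 * C) * 2^-1 ^+ m.
  move=> t01; rewrite -mulrA mulr_natl -sumr_const; apply: ler_sum => i _.
  exact: (HL (t, i)).
have cY : clamp_cont Y.
  move=> i t; apply/cvgrPdist_le => e e0.
  have e3 : 0 < e / 3 by rewrite divr_gt0.
  have C0 : 0 <= 2 * C by rewrite mulr_ge0// sumr_ge0.
  have [m Hm] := geometric_small C0 e3.
  have /cvgrPdist_le/(_ _ e3) := cX m i t.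
  apply: filterS => s Hs.
  have H1 := le_trans (HL (clamp t, i) (clamp_unit t) m) Hm.
  have H2 := le_trans (HL (clamp s, i) (clamp_unit s) m) Hm.
  rewrite /= in H1 H2.
  move: H1 H2 Hs; rewrite /Y !ler_norml => /andP[? ?] /andP[? ?] /andP[? ?].
  by apply/andP; split; lra.
have YE t i : 0 <= t <= 1 -> Y t i = step Y t i.
  move=> t01; apply: (@eq_of_geometric _ _ _ (#|I|%:R * (2 * C))) => m.
  have H1 : `|Y t i - X m.+1 t i| <= #|I|%:R * (2 * C) * 2^-1 ^+ m * 2^-1.
    rewrite -mulrA -exprSr; apply: le_trans (YX m.+1 t t01).
    by rewrite (bigD1 i)//= lerDl sumr_ge0.
  have H2 : `|step Y t i - X m.+1 t i| <= #|I|%:R * (2 * C) * 2^-1 ^+ m * 2^-1.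
    apply: le_trans (step_contracts (cX m) cY (YX m) t01).
    by rewrite (bigD1 i)//= lerDl sumr_ge0.
  have -> : Y t i - step Y t i = (Y t i - X m.+1 t i) - (step Y t i - X m.+1 t i).
    by rewrite opprB addrA subrK.
  by rewrite (le_trans (ler_normB _ _))// [leRHS]splitr lerD.
exists (step Y); split=> [i|t t01 i]; first exact: (step_spec i cY).1.
have := (step_spec i cY).2 t t01.
suff -> : \sum_l Y t l * B t l i = \sum_l step Y t l * B t l i by [].
by apply: eq_bigr => l _; rewrite YE.
Qed.

End PicardIteration.

(** * Flat linear systems of first-order partial differential equations *)

Lemma is_derive_quadratic {R : realType} {V : normedModType R} (f : V -> R)
    (x v : V) (L K : R) :
  (\forall d \near (0 : R), `|f (x + d *: v) - f x - d * L| <= K * d ^+ 2) ->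
  is_derive x v f L.
Proof.
move=> fK.
have K0 : 0 <= Num.max K 1 by rewrite le_max ler01 orbT.
have L_lim : (fun h : R => h^-1 *: (((f \o shift x) (h *: v)) - f x : R)) @ 0^' --> L.
  apply/cvgrPdist_le => e e0.
  have eK : 0 < e / Num.max K 1.
    by rewrite divr_gt0// lt_max ltr01 orbT.
  have near0 : \forall d \near (0 : R), `|d| <= e / Num.max K 1.
    by apply: filterS (nbhsx_ballx (0 : R) _ eK) => d; rewrite /ball/= sub0r normrN => /ltW.
  rewrite near_withinE; near=> d => d0.
  have H1 : `|f (x + d *: v) - f x - d * L| <= K * d ^+ 2 by near: d.
  have H2 : `|d| <= e / Num.max K 1 by near: d.
  have -> : L - d^-1 *: (((f \o shift x) (d *: v)) - f x : R)
      = - (d^-1 * (f (x + d *: v) - f x - d * L)).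
    have E (D : R) : L - d^-1 * D = - (d^-1 * (D - d * L)).
      by rewrite mulrBr mulKf// opprB.
    by rewrite -E /= [d *: v + x]addrC.
  rewrite normrN normrM normfV ler_pdivrMl ?normr_gt0//.
  rewrite (le_trans H1)// -[d ^+ 2]real_normK ?num_real// expr2 mulrA mulrC.
  rewrite ler_pM2l ?normr_gt0//.
  rewrite ler_pdivlMr ?lt_max ?ltr01 ?orbT// in H2.
  by apply: le_trans H2; rewrite [leRHS]mulrC ler_wpM2r// le_max lexx.
split; first by apply/cvg_ex; exists L.
exact: cvg_lim L_lim.
Unshelve. all: by end_near. Qed.

Lemma lipschitz_continuous_at {R : realType} {n : nat} (f : 'rV[R]_n -> R)
    (x : 'rV[R]_n) (L : R) : 0 <= L ->
  (\forall y \near x, `|f y - f x| <= L * \sum_i `|y 0 i - x 0 i|) ->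
  {for x, continuous f}.
Proof.
move=> L0 fL; apply/(@cvgrPdist_le _ _ _ _ (@nbhs_filter 'rV[R]_n x)) => e e0.
have k0 : 0 < L * n%:R + 1 by rewrite ltr_wpDl// mulr_ge0.
have r0 : 0 < e / (L * n%:R + 1) by rewrite divr_gt0.
near=> y.
have H : `|y - x| < e / (L * n%:R + 1).
  have : ball x (e / (L * n%:R + 1)) y by near: y; exact: nbhsx_ballx.
  by rewrite -ball_normE /= distrC.
rewrite distrC; apply: (@le_trans _ _ (L * \sum_i `|y 0 i - x 0 i|)).
  by near: y.
apply: (@le_trans _ _ (L * (n%:R * `|y - x|))).
  rewrite ler_wpM2l//; have := sum_coord_le (y - x).
  by under eq_bigr do rewrite !mxE.
rewrite mulrA; apply: (@le_trans _ _ ((L * n%:R + 1) * `|y - x|)).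
  by rewrite ler_wpM2r// lerDl.
by rewrite mulrC -ler_pdivlMr// ltW.
Unshelve. all: by end_near. Qed.

Section LinearSystems.
Context {R : realType} {n : nat} {I : finType}.
Implicit Types (A : 'I_n -> 'rV[R]_n -> I -> I -> R) (Y : 'rV[R]_n -> I -> R)
  (U V : set 'rV[R]_n) (x y : 'rV[R]_n) (t : R).
Notation e_ i := (delta_mx 0 i : 'rV[R]_n).

Definition linear_solution U A Y := forall x, U x -> forall i,
  {for x, continuous (fun x => Y x i)} /\
  forall c : 'I_n, is_derive x (e_ c) (fun x => Y x i) (\sum_l Y x l * A c x l i).

(** Equality of the mixed second derivatives that the equations d_c Y = Y A_c
    force on Y; in other words, the vanishing of a curvature. *)
Definition flat_system U A := forall x, U x -> forall (c e : 'I_n) (l i : I),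
  partial c (fun x => A e x l i) x + \sum_k A c x l k * A e x k i =
  partial e (fun x => A c x l i) x + \sum_k A e x l k * A c x k i.

Lemma sum_assoc (F : I -> R) (P Q : I -> I -> R) i :
  \sum_l (\sum_k F k * P k l) * Q l i = \sum_k F k * (\sum_l P k l * Q l i).
Proof.
under eq_bigr do rewrite mulr_suml; rewrite exchange_big/=.
by apply: eq_bigr => k _; rewrite mulr_sumr; apply: eq_bigr => l _; rewrite mulrA.
Qed.

Section SmallCube.
Variables (x1 : 'rV[R]_n) (rho C : R) (A : 'I_n -> 'rV[R]_n -> I -> I -> R).
Let U := ball x1 rho.
Hypotheses (rho0 : 0 < rho) (C0 : 0 <= C).
Hypothesis A_C2 : forall c l i, Ck_on 2 U (fun x => A c x l i).
Hypothesis A_bound : forall x, U x -> forall c l i, `|A c x l i| <= C.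
Hypothesis dA_bound : forall x, U x -> forall c d l i,
  `|partial d (fun x => A c x l i) x| <= C.
Hypothesis ddA_bound : forall x, U x -> forall c d l i,
  `|partial d (partial d (fun x => A c x l i)) x| <= C.
Hypothesis small : #|I|%:R * (n%:R * rho * C) <= 2^-1.

Let ray x t := x1 + t *: (x - x1).
(** The matrix of the system along the ray from x1 to x: a solution Y satisfies
    dY/dt = Y B there. *)
Let B x t l i := \sum_c (x - x1) 0 c * A c (ray x t) l i.

Let oU : open U. Proof. exact: ball_open. Qed.

Let ray1 x : ray x 1 = x.
Proof. by rewrite /ray scale1r addrC subrK. Qed.

Let ray0 x : ray x 0 = x1.
Proof. by rewrite /ray scale0r addr0. Qed.

Let U_ray x t : U x -> 0 <= t <= 1 -> U (ray x t).
Proof.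
move=> Ux t01; rewrite /ray -[t]mulr1; apply: cube_convex => //.
  exact: ballxx.
by rewrite scale1r addrC subrK.
Qed.

Let coord_lt x c : U x -> `|(x - x1) 0 c| <= rho.
Proof.
by move=> /(cubeP _ _ rho0)/(_ c) H; rewrite !mxE distrC ltW.
Qed.

Let B_bound x t l i : U x -> 0 <= t <= 1 -> `|B x t l i| <= n%:R * rho * C.
Proof.
move=> Ux t01; rewrite (le_trans (ler_norm_sum _ _ _))//.
rewrite -mulrA -[in n%:R](card_ord n) mulr_natl -sumr_const.
apply: ler_sum => c _; rewrite normrM ler_pM//; first exact: coord_lt.
exact/A_bound/U_ray.
Qed.

Let is_derive_ray (f : 'rV[R]_n -> R) x t : Ck_on 1 U f -> U x -> 0 <= t <= 1 ->
  is_derive t 1 (fun t => f (ray x t))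
    (\sum_c (x - x1) 0 c * partial c f (ray x t)).
Proof.
move=> Cf Ux t01; have Ut := U_ray Ux t01.
have df := Ck_differentiable oU Cf Ut.
rewrite -(derive_partials _ df); apply: is_derive_line.
exact: diff_derivable.
Qed.

Let B_cont x t l i : U x -> 0 <= t <= 1 -> {for t, continuous (fun t => B x t l i)}.
Proof.
move=> Ux t01.
apply: (@continuous_sum_at _ _ _ (fun c t => (x - x1) 0 c * A c (ray x t) l i)) => c.
apply: continuousM; first exact: cst_continuous.
exact: is_derive_continuous (is_derive_ray (Ck_pred (A_C2 c l i)) Ux t01).
Qed.

Let kappa0 : 0 <= n%:R * rho * C.
Proof. by rewrite !mulr_ge0// ltW. Qed.

Section Uniqueness.
Variable W : set 'rV[R]_n.
Hypotheses (oW : open W) (WU : W `<=` U).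
Hypothesis W_ray : forall x t, W x -> 0 <= t <= 1 -> W (ray x t).

Let is_derive_solution_ray Y x t i : linear_solution W A Y -> W x -> 0 <= t <= 1 ->
  is_derive t 1 (fun t => Y (ray x t) i) (\sum_l Y (ray x t) l * B x t l i).
Proof.
move=> YA Wx t01; have Wt := W_ray Wx t01.
have C1Y : Ck_on 1 W (fun x => Y x i).
  split=> [y Wy|c]; first exact: (YA y Wy i).1.
  have dY y : W y -> partial c (fun x => Y x i) y = \sum_l Y y l * A c y l i.
    by move=> Wy; have [_ /(_ c) dY] := YA y Wy i; exact: derive_val.
  split=> [y Wy|]; first by have [_ /(_ c) []] := YA y Wy i.
  apply: (@eq_Ck _ _ 0 W (fun y => \sum_l Y y l * A c y l i)) => // [y Wy|].
    by rewrite dY.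
  apply: (Ck_sum oW) => l; apply: (CkM oW).
    by split=> // y Wy; exact: (YA y Wy l).1.
  exact: Ck_sub WU (Ck_pred (Ck_pred (A_C2 c l i))).
have dY := Ck_differentiable oW C1Y Wt.
have -> : \sum_l Y (ray x t) l * B x t l i
    = 'D_(x - x1) (fun x => Y x i) (ray x t).
  rewrite derive_partials//.
  under eq_bigr do rewrite mulr_sumr; rewrite exchange_big/=.
  apply: eq_bigr => c _; have [_ /(_ c) dYc] := YA _ Wt i.
  rewrite /partial derive_val mulr_sumr; apply: eq_bigr => l _.
  by rewrite mulrCA.
by apply: is_derive_line; exact: diff_derivable.
Qed.

(** Along a ray from x1 the difference of two solutions satisfies a homogeneous
    linear equation with initial value 0. *)
Lemma linear_solution_unique Y Y' : linear_solution W A Y -> linear_solution W A Y' ->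
  W x1 -> (forall i, Y x1 i = Y' x1 i) ->
  forall x, W x -> forall i, Y x i = Y' x i.
Proof.
move=> YA YA' Wx1 E x Wx i; have Ux := WU Wx.
have := @contraction_bound R I (fun t i => Y (ray x t) i - Y' (ray x t) i)
  (fun t i => \sum_l (Y (ray x t) l - Y' (ray x t) l) * B x t l i)
  (n%:R * rho * C) 0 0 kappa0 small.
move=> /(_ _ _ _ 1); rewrite addr0 !mulr0 ler01 lexx ray1 => H.
have {}H : \sum_l `|Y x l - Y' x l| <= 0.
  apply: H => //.
  - move=> t t01 j; have := is_deriveB (is_derive_solution_ray j YA Wx t01)
      (is_derive_solution_ray j YA' Wx t01).
    rewrite -sumrB; under eq_bigr do rewrite -mulrBl; exact.
  - move=> t t01 j; rewrite addr0 mulr_sumr (le_trans (ler_norm_sum _ _ _))//.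
    apply: ler_sum => l _; rewrite normrM mulrC ler_wpM2r//; exact: B_bound.
  - by move=> j; rewrite ray0 E subrr normr0.
apply/eqP; rewrite -subr_eq0 -normr_eq0 eq_le normr_ge0 andbT.
apply: le_trans H; rewrite (bigD1 i)//= lerDl; exact: sumr_ge0.
Qed.

End Uniqueness.

Let taylor1 f x d e : Ck_on 1 U f -> (forall y, U y -> `|partial e f y| <= C) ->
  U x -> U (x + d *: e_ e) -> `|f (x + d *: e_ e) - f x| <= C * `|d|.
Proof.
move=> Cf fC Ux Ux'.
have Us s : 0 <= s <= 1 -> U (x + (s * d) *: e_ e).
  by move=> s01; exact: cube_convex.
have [s s01 ->] := @mvt_line _ _ f x (e_ e) d
  (fun s s01 => Ck_derivable Cf (Us s s01)).
by rewrite normrM mulrC ler_wpM2r// fC//; exact: Us.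
Qed.

Let taylor2 f x d e : Ck_on 2 U f ->
  (forall y, U y -> `|partial e (partial e f) y| <= C) ->
  U x -> U (x + d *: e_ e) ->
  `|f (x + d *: e_ e) - f x - d * partial e f x| <= C * d ^+ 2.
Proof.
move=> Cf fC Ux Ux'.
have Us s : 0 <= s <= 1 -> U (x + (s * d) *: e_ e).
  by move=> s01; exact: cube_convex.
have [s s01 ->] := @mvt_line _ _ f x (e_ e) d
  (fun s s01 => Ck_derivable Cf (Us s s01)).
rewrite -mulrBr normrM -[d ^+ 2]real_normK ?num_real// expr2 mulrA mulrC.
rewrite ler_wpM2r//.
apply: le_trans (taylor1 (Ck_partial e Cf) fC Ux (Us s s01)) _.
rewrite ler_wpM2l// normrM; case/andP: s01 => s0 s1.
by rewrite (ger0_norm s0) ler_piMl.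
Qed.

Hypothesis A_flat : flat_system U A.

Section Flow.
Variables (y0 : I -> R) (F : 'rV[R]_n -> R -> I -> R).
Hypothesis F0 : forall x, U x -> forall i, F x 0 i = y0 i.
Hypothesis F_ode : forall x, U x -> forall t, 0 <= t <= 1 -> forall i,
  is_derive t 1 (fun t => F x t i) (\sum_l F x t l * B x t l i).

Let M := 2 * (#|I|%:R * (\sum_i `|y0 i|)).

Let M0 : 0 <= M.
Proof. by rewrite !mulr_ge0// sumr_ge0. Qed.

Lemma flow_bound x t : U x -> 0 <= t <= 1 -> \sum_l `|F x t l| <= M.
Proof.
move=> Ux t01; have -> : M = 2 * (#|I|%:R * (\sum_i `|y0 i| + 0)).
  by rewrite addr0.
apply: (contraction_bound kappa0 small (F_ode Ux)) => //.
- move=> s s01 i; rewrite addr0 mulr_sumr (le_trans (ler_norm_sum _ _ _))//.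
  by apply: ler_sum => l _; rewrite normrM mulrC ler_wpM2r//; exact: B_bound.
- by move=> i; rewrite F0// (bigD1 i)//= lerDl sumr_ge0.
Qed.

Section Step.
Variables (x : 'rV[R]_n) (e : 'I_n) (d : R).
Let x' := x + d *: e_ e.
Hypotheses (Ux : U x) (Ux' : U x').

Let ray' t : ray x' t = ray x t + (t * d) *: e_ e.
Proof. by rewrite /ray /x' addrAC scalerDr addrA scalerA. Qed.

Let coord' c : (x' - x1) 0 c = (x - x1) 0 c + d * (c == e)%:R.
Proof. by rewrite /x' !mxE eqxx/= addrAC. Qed.

(** The partial derivative of B in x in the direction e. *)
Let dB t l i := A e (ray x t) l i +
  t * \sum_c (x - x1) 0 c * partial e (fun y => A c y l i) (ray x t).

Let B' t l i : B x' t l i = \sum_c (x - x1) 0 c * A c (ray x' t) l i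
  + d * A e (ray x' t) l i.
Proof.
rewrite /B; under eq_bigr do rewrite coord' mulrDl.
rewrite big_split/=; congr (_ + _).
rewrite (bigD1 e)//= eqxx mulr1 big1 ?addr0// => c /negbTE ->.
by rewrite mulr0 mul0r.
Qed.

Let unit_le (t : R) : 0 <= t <= 1 -> `|t * d| <= `|d|.
Proof. by move=> /andP[t0 t1]; rewrite normrM (ger0_norm t0) ler_piMl. Qed.

Let K1 := n%:R * rho * C + C.

Let K10 : 0 <= K1.
Proof. exact: addr_ge0. Qed.

Let sum_coord_bound (G : 'I_n -> R) (b : R) : (forall c, `|G c| <= b) ->
  `|\sum_c (x - x1) 0 c * G c| <= n%:R * rho * b.
Proof.
move=> Gb; rewrite (le_trans (ler_norm_sum _ _ _))//.
rewrite -mulrA -[in n%:R](card_ord n) mulr_natl -sumr_const.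
by apply: ler_sum => c _; rewrite normrM ler_pM//; exact: coord_lt.
Qed.

Let B_lip t l i : 0 <= t <= 1 -> `|B x' t l i - B x t l i| <= K1 * `|d|.
Proof.
move=> t01; rewrite B' /B addrAC -sumrB.
under eq_bigr do rewrite -mulrBr.
have := U_ray Ux' t01; have := U_ray Ux t01; rewrite ray' => Ut Ut'.
rewrite /K1 mulrDl (le_trans (ler_normD _ _))// lerD//.
  rewrite -mulrA; apply: sum_coord_bound => c.
  apply: le_trans (taylor1 (Ck_pred (A_C2 c l i)) _ Ut Ut') _.
    by move=> y Uy; exact: dA_bound.
  by rewrite ler_wpM2l// unit_le.
by rewrite normrM mulrC ler_wpM2r// A_bound.
Qed.

Let dB_bound t l i : 0 <= t <= 1 -> `|dB t l i| <= K1.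
Proof.
move=> t01; have Ut := U_ray Ux t01.
rewrite /dB /K1 addrC (le_trans (ler_normD _ _))// lerD// ?A_bound//.
case/andP: (t01) => t0 t1; rewrite normrM (ger0_norm t0).
rewrite (le_trans (ler_piMl _ t1))//.
by apply: sum_coord_bound => c; exact: dA_bound.
Qed.

Let B_taylor t l i : 0 <= t <= 1 ->
  `|B x' t l i - B x t l i - d * dB t l i| <= K1 * d ^+ 2.
Proof.
move=> t01; have := U_ray Ux' t01; have := U_ray Ux t01; rewrite ray' => Ut Ut'.
have -> : B x' t l i - B x t l i - d * dB t l i =
   \sum_c (x - x1) 0 c * (A c (ray x' t) l i - A c (ray x t) l i
      - (t * d) * partial e (fun y => A c y l i) (ray x t))
   + d * (A e (ray x' t) l i - A e (ray x t) l i).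
  rewrite B' /B /dB; under [in RHS]eq_bigr do rewrite mulrBr mulrBr.
  rewrite !sumrB.
  under [X in _ = _ - X + _]eq_bigr do rewrite mulrCA.
  by rewrite -mulr_sumr; ring.
rewrite ray' /K1 mulrDl (le_trans (ler_normD _ _))// lerD//.
  rewrite -mulrA; apply: sum_coord_bound => c.
  apply: le_trans (taylor2 (A_C2 c l i) _ Ut Ut') _.
    by move=> y Uy; exact: ddA_bound.
  rewrite ler_wpM2l// -[leLHS]real_normK ?num_real// -[leRHS]real_normK ?num_real//.
  by rewrite lerXn2r ?nnegrE// unit_le.
rewrite normrM -[d ^+ 2]real_normK ?num_real// expr2 mulrA [leRHS]mulrC ler_wpM2l//.
apply: le_trans (taylor1 (Ck_pred (A_C2 e l i)) _ Ut Ut') _.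
  by move=> y Uy; exact: dA_bound.
by rewrite ler_wpM2l// unit_le.
Qed.

Let K2 := 2 * (#|I|%:R * (0 + M * K1 * `|d|)).

Let E t i := F x' t i - F x t i.

Let E_bound t : 0 <= t <= 1 -> \sum_l `|E t l| <= K2.
Proof.
move=> t01.
pose dE t i := \sum_l E t l * B x t l i
  + \sum_l F x' t l * (B x' t l i - B x t l i).
apply: (@contraction_bound _ _ E dE _ _ _ kappa0 small) => //.
- move=> s s01 i; have := is_deriveB (F_ode Ux' s01 i) (F_ode Ux s01 i).
  suff -> : dE s i = \sum_l F x' s l * B x' s l i - \sum_l F x s l * B x s l i by [].
  rewrite /dE -big_split -sumrB /=; apply: eq_bigr => l _; rewrite /E; ring.
- move=> s s01 i; rewrite (le_trans (ler_normD _ _))// lerD//.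
    rewrite mulr_sumr (le_trans (ler_norm_sum _ _ _))//.
    by apply: ler_sum => l _; rewrite normrM mulrC ler_wpM2r//; exact: B_bound.
  rewrite (le_trans (ler_norm_sum _ _ _))//.
  apply: (@le_trans _ _ (\sum_l `|F x' s l| * (K1 * `|d|))).
    by apply: ler_sum => l _; rewrite normrM ler_wpM2l// B_lip.
  rewrite -mulr_suml -mulrA; apply: ler_wpM2r; last exact: flow_bound.
  by rewrite mulr_ge0.
- by move=> i; rewrite /E !F0// subrr normr0.
Qed.

(** The deviation of the increment of F from the one expected from the system;
    the factor t accounts for the displacement of the ray at time t. *)
Let D t i := E t i - d * (t * \sum_l F x t l * A e (ray x t) l i).

Let dD t i := \sum_l D t l * B x t l i +
  (\sum_l F x' t l * (B x' t l i - B x t l i - d * dB t l i)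
   + d * \sum_l E t l * dB t l i).

(** Flatness makes the commutator of A e and B cancel against the difference of
    the partial derivatives of A; what is left besides D B is quadratic in d. *)
Let is_derive_D t i : 0 <= t <= 1 -> is_derive t 1 (fun t => D t i) (dD t i).
Proof.
move=> t01; have Ut := U_ray Ux t01.
pose S l := \sum_c (x - x1) 0 c * partial c (fun y => A e y l i) (ray x t).
pose T l := \sum_c (x - x1) 0 c * partial e (fun y => A c y l i) (ray x t).
have ST l : S l + \sum_k B x t l k * A e (ray x t) k i =
            T l + \sum_k A e (ray x t) l k * B x t k i.
  have -> : \sum_k B x t l k * A e (ray x t) k i = \sum_c (x - x1) 0 c *
      \sum_k A c (ray x t) l k * A e (ray x t) k i.
    rewrite /B; under eq_bigr do rewrite mulr_suml; rewrite exchange_big/=.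
    apply: eq_bigr => c _; rewrite mulr_sumr; apply: eq_bigr => k _.
    by rewrite mulrA.
  have -> : \sum_k A e (ray x t) l k * B x t k i = \sum_c (x - x1) 0 c *
      \sum_k A e (ray x t) l k * A c (ray x t) k i.
    rewrite /B; under eq_bigr do rewrite mulr_sumr; rewrite exchange_big/=.
    apply: eq_bigr => c _; rewrite mulr_sumr; apply: eq_bigr => k _.
    by rewrite mulrCA.
  rewrite -!big_split/=; apply: eq_bigr => c _.
  by rewrite -!mulrDr A_flat.
have dA l := is_derive_ray (Ck_pred (A_C2 e l i)) Ux t01.
have dFA := is_derive_sum_fin (fun l => is_deriveM (F_ode Ux t01 l) (dA l)).
have dt : is_derive t 1 (id : R -> R) 1 by exact: is_derive_id.
have [dd1 dd2] := is_deriveB (is_deriveB (F_ode Ux' t01 i) (F_ode Ux t01 i))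
  (is_deriveM (is_derive_cst d t 1) (is_deriveM dt dFA)).
split; [exact: dd1|rewrite [LHS]dd2 /dD].
pose a := \sum_l F x' t l * B x' t l i; pose b := \sum_l F x t l * B x t l i.
pose f := \sum_l F x' t l * B x t l i; pose q := \sum_l F x t l * A e (ray x t) l i.
pose p1 := \sum_l F x t l * T l.
pose p2 := \sum_k F x t k * (\sum_l A e (ray x t) k l * B x t l i).
have -> : \sum_l D t l * B x t l i = f - b - d * (t * p2).
  under eq_bigr do rewrite mulrBl -[d * _ * _]mulrA -[t * _ * _]mulrA.
  rewrite sumrB -!mulr_sumr sum_assoc; congr (_ - _).
  by under eq_bigr do rewrite mulrBl; rewrite sumrB.
have -> : \sum_l F x' t l * (B x' t l i - B x t l i - d * dB t l i)
    = a - f - d * \sum_l F x' t l * dB t l i.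
  under eq_bigr do rewrite !mulrBr mulrCA.
  by rewrite !sumrB -mulr_sumr.
have -> : \sum_l E t l * dB t l i = \sum_l F x' t l * dB t l i - (q + t * p1).
  under eq_bigr do rewrite mulrBl.
  rewrite sumrB; congr (_ - _).
  under eq_bigr do rewrite mulrDr mulrCA.
  by rewrite big_split/= -mulr_sumr.
have -> : \sum_j (F x t j *: (\sum_c (x - x1) 0 c *
      partial c (fun y => A e y j i) (ray x t)) +
    A e (ray x t) j i *: (\sum_l F x t l * B x t l j)) = p1 + p2.
  rewrite big_split/=.
  have -> : \sum_j A e (ray x t) j i *: (\sum_l F x t l * B x t l j)
      = \sum_k F x t k * (\sum_l B x t k l * A e (ray x t) l i).
    by rewrite -sum_assoc; apply: eq_bigr => l _; rewrite -[_ *: _]/(_ * _) mulrC.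
  rewrite /p1 /p2 -!big_split/=; apply: eq_bigr => l _.
  by rewrite -[_ *: _]/(_ * _) -!mulrDr; congr (_ * _); exact: ST.
rewrite -/a -/b !scaler0 addr0 -[d *: _]/(d * _) -[t *: _]/(t * _) -/q.
by rewrite -[_ *: _]/(_ * _); ring.
Qed.

(** D starts at 0 and satisfies dD/dt = D B + O(d^2), so that [contraction_bound]
    makes it O(d^2); at t = 1 this is a first-order expansion of the end value. *)
Lemma flow_step i :
  `|F x' 1 i - F x 1 i - d * \sum_l F x 1 l * A e x l i|
    <= 2 * (#|I|%:R * (M * K1 + 2 * (#|I|%:R * (M * K1)) * K1)) * d ^+ 2.
Proof.
have one : 0 <= (1 : R) <= 1 by rewrite ler01 lexx.
have d2 : d ^+ 2 = `|d| * `|d| by rewrite -[d ^+ 2]real_normK ?num_real// expr2.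
pose r := M * (K1 * d ^+ 2) + `|d| * (K2 * K1).
have H : \sum_l `|D 1 l| <= 2 * (#|I|%:R * (0 + r)).
  apply: (contraction_bound kappa0 small (fun t t01 i => is_derive_D i t01)) => //.
  - move=> t t01 j; rewrite (le_trans (ler_normD _ _))// lerD//.
      rewrite mulr_sumr (le_trans (ler_norm_sum _ _ _))//.
      by apply: ler_sum => l _; rewrite normrM mulrC ler_wpM2r//; exact: B_bound.
    rewrite (le_trans (ler_normD _ _))// lerD//.
      apply: (@le_trans _ _ (\sum_l `|F x' t l| * (K1 * d ^+ 2))).
        rewrite (le_trans (ler_norm_sum _ _ _))//.
        by apply: ler_sum => l _; rewrite normrM ler_wpM2l// B_taylor.
      rewrite -mulr_suml; apply: ler_wpM2r; last exact: flow_bound.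
      by rewrite mulr_ge0// sqr_ge0.
    rewrite normrM ler_wpM2l//.
    apply: (@le_trans _ _ (\sum_l `|E t l| * K1)).
      rewrite (le_trans (ler_norm_sum _ _ _))//.
      by apply: ler_sum => l _; rewrite normrM ler_wpM2l// dB_bound.
    by rewrite -mulr_suml ler_wpM2r// E_bound.
  - by move=> j; rewrite /D /E !F0// subrr mul0r mulr0 subrr normr0.
have -> : F x' 1 i - F x 1 i - d * \sum_l F x 1 l * A e x l i = D 1 i.
  by rewrite /D mul1r ray1.
apply: (@le_trans _ _ (\sum_l `|D 1 l|)).
  by rewrite (bigD1 i)//= lerDl sumr_ge0.
apply: le_trans H _; rewrite add0r -mulrA ler_wpM2l// -mulrA ler_wpM2l//.
by rewrite /r /K2 add0r d2 le_eqVlt; apply/orP; left; apply/eqP; ring.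
Qed.
End Step.
End Flow.

(** Solve along the rays from x1 and take the values at their ends. By [flow_step]
    the result has the required partial derivatives; they are bounded, so it is
    continuous. *)
Lemma linear_solution_exists (y0 : I -> R) :
  exists Y, (forall i, Y x1 i = y0 i) /\ linear_solution U A Y.
Proof.
have [F HF] : {F : 'rV[R]_n -> R -> I -> R & forall x, U x ->
    (forall i, F x 0 i = y0 i) /\
    forall t, 0 <= t <= 1 -> forall i,
      is_derive t 1 (fun t => F x t i) (\sum_l F x t l * B x t l i)}.
  apply: (@choice _ _ (fun x F => U x -> (forall i, F 0 i = y0 i) /\
    forall t, 0 <= t <= 1 -> forall i,
      is_derive t 1 (fun t => F t i) (\sum_l F t l * B x t l i))) => x.
  have [Ux|nUx] := pselect (U x); last by exists (fun _ _ => 0).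
  have [F HF] := linear_ode_existence y0 kappa0 small
    (fun t t01 l i => @B_cont x t l i Ux t01)
    (fun t t01 l i => @B_bound x t l i Ux t01).
  by exists F.
have F0 x Ux := (HF x Ux).1; have F_ode x Ux := (HF x Ux).2.
pose Y x i := F x 1 i.
have one : 0 <= (1 : R) <= 1 by rewrite ler01 lexx.
have dY x i c : U x -> is_derive x (e_ c) (fun x => Y x i) (\sum_l Y x l * A c x l i).
  move=> Ux; have := @flow_step y0 F F0 F_ode x c.
  set K := 2 * _ => step; apply: (@is_derive_quadratic _ _ _ _ _ _ K).
  have cl : (fun d : R => x + d *: e_ c) @ (0 : R) --> x + (0 : R) *: e_ c.
    apply: cvgD; first exact: cvg_cst.
    by apply: cvgZr_tmp; exact: cvg_id.
  rewrite scale0r addr0 in cl.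
  have : \forall d \near (0 : R), U (x + d *: e_ c).
    by apply: cl; exact: open_nbhs_nbhs.
  by apply: filterS => d Ud; exact: step.
exists Y; split.
  move=> i; rewrite /Y; have Ux1 : U x1 by exact: ballxx.
  have [s s01] := mvt_unit one (fun t t01 => F_ode _ Ux1 t t01 i).
  rewrite big1 ?mul0r ?F0//; first by move/eqP; rewrite subr_eq0 => /eqP.
  move=> l _; rewrite /B big1 ?mulr0// => c _.
  by rewrite subrr mxE mul0r.
move=> x Ux i; split=> [|c]; last exact: dY.
pose M := 2 * (#|I|%:R * (\sum_i `|y0 i|)) * C.
have M0 : 0 <= M by rewrite !mulr_ge0// sumr_ge0.
apply: (@lipschitz_continuous_at _ _ _ _ M) => //.
apply: (open_near oU Ux) => y Uy.
apply: (@partial_lipschitz _ _ x1 rho M (fun x => Y x i) _ _ x y Ux Uy) => z Uz c.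
  by have [] := dY z i c Uz.
have dz := dY z i c Uz; rewrite /partial derive_val.
rewrite (le_trans (ler_norm_sum _ _ _))//.
apply: (@le_trans _ _ (\sum_l `|Y z l| * C)).
  by apply: ler_sum => l _; rewrite normrM ler_wpM2l// A_bound.
by rewrite -mulr_suml ler_wpM2r//; exact: flow_bound F0 F_ode _ _ Uz one.
Qed.

End SmallCube.

Lemma locally_bounded (J : finType) (f : J -> 'rV[R]_n -> R) x :
  (forall j, {for x, continuous (f j)}) ->
  exists2 C : R, 0 <= C & \forall y \near x, forall j, `|f j y| <= C.
Proof.
move=> cf; exists (\sum_j `|f j x| + 1); first by rewrite addr_ge0// sumr_ge0.
apply: (@filter_forall _ _ _ _ (@nbhs_filter 'rV[R]_n x)) => j.
have /cvgrPdist_le/(_ _ ltr01) := cf j.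
apply: filterS => y H.
rewrite -(subrK (f j x) (f j y)) addrC (le_trans (ler_normD _ _))// lerD//.
  by rewrite (bigD1 j)//= lerDl sumr_ge0.
by rewrite distrC.
Qed.

(** Around every point there is a cube on which solutions are determined by, and
    may be prescribed at, an arbitrary point: a cube of radius r is contained in
    the cube of radius 2 r around each of its points. *)
Theorem flat_system_local V A x0 : open V -> V x0 ->
  (forall c l i, Ck_on 2 V (fun x => A c x l i)) -> flat_system V A ->
  exists r : R, [/\ 0 < r, ball x0 r `<=` V,
    forall x1 (y0 : I -> R), ball x0 r x1 ->
      exists Y, (forall i, Y x1 i = y0 i) /\ linear_solution (ball x0 r) A Y &
    forall x1 Y Y', ball x0 r x1 ->
      linear_solution (ball x0 r) A Y -> linear_solution (ball x0 r) A Y' ->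
      (forall i, Y x1 i = Y' x1 i) ->
      forall x, ball x0 r x -> forall i, Y x i = Y' x i].
Proof.
move=> oV Vx0 A_C2 A_flat.
have [C1 C10 H1] := @locally_bounded ('I_n * (I * I))%type
  (fun j y => A j.1 y j.2.1 j.2.2) x0 (fun j => Ck_continuous (A_C2 _ _ _) Vx0).
have [C2 C20 H2] := @locally_bounded (('I_n * 'I_n) * (I * I))%type
  (fun j y => partial j.1.2 (fun y => A j.1.1 y j.2.1 j.2.2) y) x0
  (fun j => Ck_continuous (Ck_partial _ (A_C2 _ _ _)) Vx0).
have [C3 C30 H3] := @locally_bounded (('I_n * 'I_n) * (I * I))%type
  (fun j y => partial j.1.2 (partial j.1.2 (fun y => A j.1.1 y j.2.1 j.2.2)) y) x0
  (fun j => Ck_continuous (Ck_partial _ (Ck_partial _ (A_C2 _ _ _))) Vx0).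
pose C := C1 + (C2 + C3).
have C0 : 0 <= C by rewrite !addr_ge0.
have [C1C C2C C3C] : [/\ C1 <= C, C2 <= C & C3 <= C] by rewrite /C; split; lra.
have HV : nbhs x0 V by exact: open_nbhs_nbhs.
have H : nbhs x0 (V `&` (_ `&` (_ `&` _))) := filterI HV (filterI H1 (filterI H2 H3)).
have {H}[rho /= rho0 Hrho] := (nbhs_ballP x0 _).1 (H _ _ _).
pose q := #|I|%:R * n%:R * C + 1.
have q0 : 0 < q by rewrite ltr_wpDl// !mulr_ge0.
(* r <= rho / 3 keeps the cubes of radius 2 r around points of the cube of radius r
   inside the cube of radius rho; the second bound is the contraction condition *)
pose r := Num.min (rho / 3) (4 * q)^-1.
have r0 : 0 < r by rewrite lt_min divr_gt0//= invr_gt0 mulr_gt0.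
have r_rho : r <= rho / 3 by rewrite ge_min lexx.
have r_q : r * (4 * q) <= 1.
  by rewrite -ler_pdivlMr ?mulr_gt0// mul1r ge_min lexx orbT.
have sub x1 : ball x0 r x1 -> ball x1 (r *+ 2) `<=` ball x0 rho.
  move=> Bx1 y By; apply: (@le_ball _ _ x0 (r + r *+ 2)); last exact: ball_triangle By.
  rewrite -mulrS -mulr_natr -ler_pdivlMr//.
have small : #|I|%:R * (n%:R * (r *+ 2) * C) <= 2^-1.
  have : r *+ 2 * q <= 2^-1 by rewrite mulr2n; lra.
  apply: le_trans.
  have -> : #|I|%:R * (n%:R * (r *+ 2) * C) = r *+ 2 * (#|I|%:R * n%:R * C) by ring.
  by apply: ler_wpM2l; [rewrite mulrn_wge0// ltW|rewrite lerDl].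
have r20 : 0 < r *+ 2 by rewrite pmulrn_lgt0.
have C2' x1 : ball x0 r x1 -> forall c l i,
    Ck_on 2 (ball x1 (r *+ 2)) (fun x => A c x l i).
  by move=> Bx1 c l i; apply: Ck_sub (A_C2 c l i) => y /(sub _ Bx1)/Hrho[].
have b1 x1 : ball x0 r x1 -> forall x, ball x1 (r *+ 2) x ->
    forall c l i, `|A c x l i| <= C.
  move=> Bx1 x /(sub _ Bx1)/Hrho[_ [H _]] c l i.
  exact: le_trans (H (c, (l, i))) C1C.
have b2 x1 : ball x0 r x1 -> forall x, ball x1 (r *+ 2) x -> forall c d l i,
    `|partial d (fun x => A c x l i) x| <= C.
  move=> Bx1 x /(sub _ Bx1)/Hrho[_ [_ [H _]]] c d l i.
  exact: le_trans (H ((c, d), (l, i))) C2C.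
have b3 x1 : ball x0 r x1 -> forall x, ball x1 (r *+ 2) x -> forall c d l i,
    `|partial d (partial d (fun x => A c x l i)) x| <= C.
  move=> Bx1 x /(sub _ Bx1)/Hrho[_ [_ [_ H]]] c d l i.
  exact: le_trans (H ((c, d), (l, i))) C3C.
have W x1 : ball x0 r x1 -> ball x0 r `<=` ball x1 (r *+ 2).
  by move=> Bx1 y By; rewrite mulr2n; apply: ball_triangle By; exact: ball_sym.
exists r; split=> //.
- move=> x Bx; have [|Vx _] // := Hrho x.
  by apply: le_ball Bx; apply: (le_trans r_rho); lra.
- move=> x1 y0 Bx1.
  have [] := @linear_solution_exists x1 (r *+ 2) C A r20 C0 (C2' _ Bx1) (b1 _ Bx1)
    (b2 _ Bx1) (b3 _ Bx1) small _ y0.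
    by move=> x /(sub _ Bx1)/Hrho[Vx _]; exact: A_flat.
  by move=> Y [Y0 HY]; exists Y; split=> // x /(W _ Bx1); exact: HY.
- move=> x1 Y Y' Bx1 HY HY' E x Bx i.
  apply: (@linear_solution_unique x1 (r *+ 2) C A r20 C0 (C2' _ Bx1) (b1 _ Bx1)
    small (ball x0 r) _ (W _ Bx1) _ Y Y' HY HY' Bx1 E) => //.
    exact: ball_open.
  move=> y t By t01; rewrite -[t]mulr1; apply: cube_convex => //.
  by rewrite scale1r addrC subrK.
Qed.

End LinearSystems.

(** The equations express the partial derivatives of Y through Y itself, which
    gains one derivative at a time. *)
Lemma linear_solution_smooth (R : realType) (n : nat) (I : finType) (V : set 'rV[R]_n)
    (A : 'I_n -> 'rV[R]_n -> I -> I -> R) (Y : 'rV[R]_n -> I -> R) :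
  open V -> (forall k c l i, Ck_on k V (fun y => A c y l i)) ->
  linear_solution V A Y -> forall k i, Ck_on k V (fun y => Y y i).
Proof.
move=> oV A_smooth YA; elim=> [|k IH] i.
  by split=> // y Vy; exact: (YA y Vy i).1.
split=> [y Vy|c]; first exact: (YA y Vy i).1.
split=> [y Vy|]; first by have [_ /(_ c) []] := YA y Vy i.
apply: (@eq_Ck _ _ k V (fun y => \sum_l Y y l * A c y l i)) => // [y Vy|].
  by have [_ /(_ c) dY] := YA y Vy i; rewrite /partial derive_val.
by apply: (Ck_sum oV) => l; exact: (CkM oV).
Qed.

(** * Continuation of sections over a contractible set *)

(** The set of points of A where P holds is open and closed in A. *)
Lemma connected_propagation (T : topologicalType) (A : set T) (P : T -> Prop) :
  connected A ->
  (forall x, A x -> exists U, [/\ open U, U x &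
    forall y z, A y -> U y -> A z -> U z -> P y -> P z]) ->
  forall x y, A x -> A y -> P x -> P y.
Proof.
move=> cA loc x y Ax Ay Px.
pose B := A `&` P.
suff BA : B = A by have [] : B y by rewrite BA.
apply: cA; first by exists x.
- exists (\bigcup_(U in [set U | open U /\ forall z, A z -> U z -> P z]) U).
    by apply: bigcup_open => U [].
  apply/seteqP; split=> z.
  + move=> [Az Pz]; split=> //; have [U [oU Uz HU]] := loc z Az.
    by exists U => //; split=> // w Aw Uw; exact: HU Pz.
  + by move=> [Az [U [_ HU] Uz]]; split=> //; exact: HU.
- exists (~` \bigcup_(U in [set U | open U /\ forall z, A z -> U z -> ~ P z]) U).
    by apply: open_closedC; apply: bigcup_open => U [].
  apply/seteqP; split=> z.
  + by move=> [Az Pz]; split=> // -[U [_ HU] Uz]; exact: HU Pz.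
  + move=> [Az nU]; split=> //; apply: contrapT => nPz; apply: nU.
    have [U [oU Uz HU]] := loc z Az; exists U => //; split=> // w Aw Uw Pw.
    by apply: nPz; exact: HU Pw.
Qed.

Lemma continuous_pair_at (T A B : topologicalType) (f : T -> A) (g : T -> B) t :
  {for t, continuous f} -> {for t, continuous g} ->
  {for t, continuous (fun t => (f t, g t))}.
Proof.
move=> cf cg V [[P Q] [/= Pt Qt] PQ].
have Pt' : \forall u \near t, P (f u) := cf _ Pt.
have Qt' : \forall u \near t, Q (g u) := cg _ Qt.
by apply: filterS2 Pt' Qt' => u Pu Qu; exact: PQ.
Qed.

Lemma near_fst (A B : topologicalType) (P : set A) (z : A * B) :
  nbhs z.1 P -> \forall w \near z, P w.1.
Proof.
case: z => a b Pa; exists (P, setT); first by split=> //; exact: filterT.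
by move=> w [].
Qed.

Lemma connected_ball (R : realType) (n : nat) (x : 'rV[R]_n) (r : R) :
  0 < r -> connected (ball x r).
Proof.
move=> r0.
have -> : ball x r = \bigcup_(y in ball x r) ((fun t : R => x + t *: (y - x)) @` `[0, 1]).
  apply/seteqP; split=> z.
    move=> Bz; exists z => //; exists 1; first by rewrite /= in_itv/= ler01 lexx.
    by rewrite scale1r addrC subrK.
  move=> [y By [t /=]]; rewrite in_itv/= => t01 <-.
  rewrite -[t]mulr1; apply: cube_convex => //; first exact: ballxx.
  by rewrite scale1r addrC subrK.
apply: bigcup_connected.
  exists x => y By; exists 0; first by rewrite /= in_itv/= ler01 lexx.
  by rewrite scale0r addr0.
move=> y By; apply: connected_continuous_connected; first exact: segment_connected.
apply: continuous_subspaceT => t; apply: cvgD; first exact: cvg_cst.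
by apply: cvgZr_tmp; exact: cvg_id.
Qed.

Section Monodromy.
Context {R : realType} {X : topologicalType} {St : Type}.
Variables (N : set X) (Sol : set X -> (X -> St) -> Prop).
Hypothesis Sol_sub : forall U V s, V `<=` U -> Sol U s -> Sol V s.

(** The behaviour of the parallel sections of a flat bundle over a small ball. *)
Definition transport_set U :=
  (forall x y, U x -> exists2 s, Sol U s & s x = y) /\
  (forall x s s', U x -> Sol U s -> Sol U s' -> s x = s' x ->
     forall z, U z -> s z = s' z).

Hypothesis transport_basis : forall x V, N x -> open V -> V x ->
  exists U, [/\ open U, U x, U `<=` V & transport_set U].

(** This compares sections on overlaps that need not be connected. *)
Lemma local_agreement U U' s s' x : N x -> open U -> open U' -> U x -> U' x ->
  Sol U s -> Sol U' s' -> exists W, [/\ open W, W x, W `<=` U `&` U' &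
    forall y z, W y -> W z -> s y = s' y -> s z = s' z].
Proof.
move=> Nx oU oU' Ux U'x Ss Ss'.
have [W [oW Wx WU [_ uniqW]]] := transport_basis Nx (openI oU oU') (conj Ux U'x).
exists W; split=> // y z Wy Wz E; apply: (uniqW y) => //.
- by apply: Sol_sub Ss => w /WU[].
- by apply: Sol_sub Ss' => w /WU[].
Qed.

Let I01 : set R := [set t | 0 <= t <= 1].

(** Local pull-backs of sections by H. Only points of Z are compared, so that Z may
    be a closed interval of times. *)
Definition lifted (P : topologicalType) (Z : set P) (H : P -> X) (Y : P -> St) :=
  forall z, Z z -> exists U s, [/\ open U, U (H z), Sol U s &
    \forall w \near z, Z w -> Y w = s (H w)].

Definition continuous_on (P : topologicalType) (Z : set P) (H : P -> X) :=
  forall z V, Z z -> open V -> V (H z) -> \forall w \near z, Z w -> V (H w).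

Lemma lifted_unique (P : topologicalType) (Z : set P) (H : P -> X) Y Y' :
  connected Z -> continuous_on Z H -> (forall z, Z z -> N (H z)) ->
  lifted Z H Y -> lifted Z H Y' ->
  forall z w, Z z -> Z w -> Y z = Y' z -> Y w = Y' w.
Proof.
move=> cZ cH HN HY HY'; apply: connected_propagation => // z Zz.
have [U [s [oU Us Ss Es]]] := HY z Zz.
have [U' [s' [oU' Us' Ss' Es']]] := HY' z Zz.
have [W [oW Wz _ HW]] := local_agreement (HN z Zz) oU oU' Us Us' Ss Ss'.
have : nbhs z (fun w => Z w -> Y w = s (H w) /\ Y' w = s' (H w) /\ W (H w)).
  apply: filterS3 Es Es' (cH z W Zz oW Wz) => w E1 E2 E3 Zw.
  by rewrite E1// E2//; split=> //; split=> //; exact: E3.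
rewrite nbhsE => -[V [oV Vz] HV]; exists V; split=> // u v Zu Vu Zv Vv.
have [-> [-> Wu]] := HV u Vu Zu; have [-> [-> Wv]] := HV v Vv Zv.
exact: HW.
Qed.

Lemma lifted_sub (P : topologicalType) (Z Z' : set P) H Y : Z' `<=` Z ->
  lifted Z H Y -> lifted Z' H Y.
Proof.
move=> ZZ HY z Zz; have [U [s [oU Us Ss E]]] := HY z (ZZ _ Zz).
by exists U, s; split=> //; apply: filterS E => w E /ZZ.
Qed.

Lemma lifted_comp (P Q : topologicalType) (Z : set P) (Z' : set Q) H Y (phi : Q -> P) :
  (forall z, Z' z -> Z (phi z)) -> (forall z, Z' z -> {for z, continuous phi}) ->
  lifted Z H Y -> lifted Z' (H \o phi) (Y \o phi).
Proof.
move=> ZZ cphi HY z Zz; have [U [s [oU Us Ss E]]] := HY _ (ZZ _ Zz).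
exists U, s; split=> //.
have : \forall w \near z, Z (phi w) -> Y (phi w) = s (H (phi w)) := cphi z Zz _ E.
by apply: filterS => w Hw /ZZ; exact: Hw.
Qed.

Section Tube.
Variables (H : R * X -> X) (q : X) (yq : St).
Let Z0 : set (R * X) := [set z | 0 <= z.1 <= 1 /\ N z.2].
Hypotheses (cH : continuous_on Z0 H) (HN : forall z, Z0 z -> N (H z)).
Hypotheses (Nq : N q) (H1 : forall x, N x -> H (1, x) = q).
Variables (x0 : X) (Nx0 : N x0).

Let slab (t : R) (W : set X) : set (R * X) :=
  [set z | t <= z.1 <= 1 /\ (W z.2 /\ N z.2)].

(** Sections can be continued backwards from the state yq at time 1 to the time t,
    along the tracks under H of all points of a neighbourhood of x0. *)
Let tube t := exists W Y, [/\ open W, W x0, lifted (slab t W) H Y &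
  forall x, W x -> N x -> Y (1, x) = yq].

Let tube_weaken t t' : t <= t' -> tube t -> tube t'.
Proof.
move=> tt' [W [Y [oW Wx HY Y1]]]; exists W, Y; split=> //.
apply: lifted_sub HY => z [/andP[tz z1] WNz]; split=> //.
by rewrite (le_trans tt').
Qed.

Let tube1 : tube 1.
Proof.
have [U [oU Uq _ [exU _]]] := transport_basis Nq openT I.
have [s Ss sq] := exU q yq Uq.
exists setT, (s \o H); split=> //; first exact: openT.
  move=> [t x] [/= t1 [_ Nx]]; exists U, s; split=> //.
    by rewrite (_ : t = 1) ?H1//; apply/eqP; rewrite eq_le andbC.
  by apply: filterE.
by move=> x _ Nx /=; rewrite H1.
Qed.

Let near_slab t (A : set (R * X)) : nbhs (t, x0) A ->
  exists2 e : R, 0 < e & exists W, [/\ open W, W x0 &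
    forall u x, `|t - u| < e -> W x -> A (u, x)].
Proof.
move=> [[B C] [/= /nbhs_ballP[e /= e0 Be]]].
rewrite nbhsE => -[W [oW Wx0] WC] BC.
exists e => //; exists W; split=> // u x tu Wx.
by apply: BC; split=> /=; [exact: Be|exact: WC].
Qed.

(** For times near t the track of x0 stays in one transport set U, and the section
    over U with the right value at time u continues a lift from u down to v. The
    section and the lift agree at time u only near x0: the neighbourhood W shrinks. *)
Let tube_extend t : 0 <= t <= 1 -> exists2 e : R, 0 < e &
  forall u v, 0 <= u <= 1 -> 0 <= v <= 1 -> `|t - u| < e -> `|t - v| < e ->
    tube u -> tube v.
Proof.
move=> t01; have Ztx : Z0 (t, x0) by split.
have [U [oU UH _ [exU _]]] := transport_basis (HN Ztx) openT I.
have [e e0 [W1 [oW1 W1x HW1]]] := near_slab (cH Ztx oU UH).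
have {}HW1 u x : 0 <= u <= 1 -> `|t - u| < e -> W1 x -> N x -> U (H (u, x)).
  by move=> u01 tu Wx Nx; apply: HW1.
exists e => // u v u01 v01 tu tv Tu.
have [uv|vu] := leP u v; first exact: tube_weaken Tu.
have [W [Y [oW Wx HY Y1]]] := Tu.
have Zux : Z0 (u, x0) by split.
have Uu : U (H (u, x0)) by exact: HW1.
have [s Ss sE] := exU _ (Y (u, x0)) Uu.
have agree x : W x -> W1 x -> N x -> \forall w \near (u, x),
    slab u W w -> Y (u, x) = s (H (u, x)) -> Y w = s (H w).
  move=> Wx' W1x' Nx.
  have Sux : slab u W (u, x) by split=> //=; rewrite lexx; case/andP: u01.
  have Zux' : Z0 (u, x) by split.
  have [U2 [s2 [oU2 U2H Ss2 E2]]] := HY _ Sux.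
  have UHx : U (H (u, x)) by exact: HW1.
  have [W3 [oW3 W3H _ HW3]] := local_agreement (HN Zux') oU oU2 UHx U2H Ss Ss2.
  have Ex := nbhs_singleton E2 Sux.
  apply: filterS2 E2 (cH Zux' oW3 W3H) => w E2 W3w Sw E.
  rewrite E2//; apply/esym/(HW3 (H (u, x))) => //; last by rewrite -E.
  apply: W3w; case: Sw => /andP[uw w1] [_ Nw]; split=> //.
  by rewrite w1 andbT (le_trans _ uw)//; case/andP: u01.
have [e2 e20 [W2 [oW2 W2x HW2]]] := near_slab (agree x0 Wx W1x Nx0).
have sW x : (W `&` W1 `&` W2) x -> N x -> Y (u, x) = s (H (u, x)).
  move=> [[Wx' W1x'] W2x'] Nx; apply: HW2 => //; first by rewrite subrr normr0.
  by split=> //=; rewrite lexx; case/andP: u01.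
pose Y' (z : R * X) := if u <= z.1 then Y z else s (H z).
exists (W `&` W1 `&` W2), Y'; split=> //.
- by do 2! apply: openI => //.
- move=> [t1 x] [/= /andP[vt1 t11] [[[Wx' W1x'] W2x'] Nx]].
  have fst_near (A : set R) : nbhs t1 A -> \forall w \near (t1, x), A w.1.
    exact: (@near_fst _ _ A (t1, x)).
  have [t1u|ut1|t1u] := ltgtP t1 u.
  + exists U, s; split=> //.
      apply: HW1 => //; first by rewrite t11 andbT (le_trans _ vt1)//; case/andP: v01.
      move: tu tv; rewrite !ltr_norml => /andP[? ?] /andP[? ?].
      by apply/andP; split; lra.
    have : nbhs t1 [set r | r < u] by exact: lt_nbhsl.
    move=> /fst_near; apply: filterS => w wu _.
    by rewrite /Y' leNgt wu.
  + have [|U2 [s2 [oU2 U2H Ss2 E2]]] := HY (t1, x).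
      by split=> //=; rewrite t11 (ltW ut1).
    exists U2, s2; split=> //.
    have : nbhs t1 [set r | u < r] by exact: lt_nbhsr.
    move=> /fst_near uw; apply: filterS2 uw E2 => w uw E2 [/andP[_ w1] [[[Ww _] _] Nw]].
    by rewrite /Y' (ltW uw) E2//; split=> //; rewrite (ltW uw).
  + subst t1; exists U, s; split=> //; first exact: HW1.
    apply: filterS (agree x Wx' W1x' Nx) => w Hw [/andP[_ w1] [[[Ww _] _] Nw]].
    rewrite /Y'; case: ifPn => // uw; apply: Hw; last exact: sW.
    by split=> //; rewrite uw.
- move=> x [[Wx' _] _] Nx; rewrite /Y' /=.
  by case/andP: u01 => _ ->; exact: Y1.
Qed.

Lemma tube_exists : exists W Y, [/\ open W, W x0,
  lifted [set z : R * X | 0 <= z.1 <= 1 /\ (W z.2 /\ N z.2)] H Y &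
  forall x, W x -> N x -> Y (1, x) = yq].
Proof.
have one : 0 <= (1 : R) <= 1 by rewrite ler01 lexx.
have zero : 0 <= (0 : R) <= 1 by rewrite ler01 lexx.
apply: (@connected_propagation R `[0, 1] tube (@segment_connected R 0 1) _ 1 0) => //=.
- move=> t; rewrite in_itv/= => /tube_extend[e e0 He].
  exists (ball t e); split; [exact: ball_open|exact: ballxx|].
  by move=> u v; rewrite !in_itv/= => u01 Bu v01 Bv; exact: He.
Qed.

End Tube.

(** Let H contract N to q. The state at x is obtained from a suitable state at q by
    continuation along the track of x under H; continuation along a whole tube
    around that track shows that this is locally a section. *)
Theorem global_section (p : X) (yp : St) : contractible_set R N -> N p ->
  exists G : X -> St, G p = yp /\
    forall x, N x -> exists V s, [/\ open V, V x, Sol V s &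
      forall z, V z -> N z -> G z = s z].
Proof.
move=> [q [H [Nq cH HN H0 H1]]] Np.
pose Z0 : set (R * X) := [set z | 0 <= z.1 <= 1 /\ N z.2].
have Z0E : `[0, 1]%classic `*` N = Z0.
  by apply/seteqP; split=> -[t x] [/= t01 Nx]; split=> //=; move: t01; rewrite in_itv.
have {}cH : continuous_on Z0 H.
  move=> z V Zz oV Vz; rewrite Z0E in cH.
  have /subspace_continuousP/(_ z Zz) cHz := cH.
  exact: (cHz V (open_nbhs_nbhs (conj oV Vz))).
have {}HN z : Z0 z -> N (H z) by case: z => t x [t01 Nx]; exact: HN.
have seg01 : connected I01.
  have -> : I01 = `[0, 1]%classic.
    by apply/seteqP; split=> t /=; rewrite in_itv.
  exact: segment_connected.
have one : I01 1 by rewrite /I01/= ler01 lexx.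
have zero : I01 0 by rewrite /I01/= ler01 lexx.
have pair_cont (x : X) t : {for t, continuous (fun t : R => (t, x))}.
  by apply: continuous_pair_at; [exact: cvg_id|exact: cst_continuous].
have path_cont x : N x -> continuous_on I01 (fun t => H (t, x)).
  move=> Nx t V t01 oV Vt; have Zz : Z0 (t, x) by split.
  have : \forall w \near t, Z0 (w, x) -> V (H (w, x)) := pair_cont x t _ (cH _ _ Zz oV Vt).
  by apply: filterS => w Hw w01; apply: Hw; split.
have path_N x : N x -> forall t, I01 t -> N (H (t, x)).
  by move=> Nx t t01; apply: HN; split.
(* the state at q is obtained by continuing yp along the track of p *)
have [yq [yP [HyP yP0 yP1]]] : exists yq yP, [/\ lifted I01 (fun t => H (t, p)) yP,
    yP 0 = yp & yP 1 = yq].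
  pose H' (z : R * X) := H (1 - z.1, p).
  have flip t : I01 t -> I01 (1 - t).
    by rewrite /I01/= subr_ge0 gerBl => /andP[-> ->].
  have flip_cont (t : R) : {for t, continuous (fun t : R => 1 - t)}.
    by apply: continuousB; [exact: cst_continuous|exact: cvg_id].
  have cH' : continuous_on Z0 H'.
    move=> z V [z01 Nz] oV Vz.
    have : \forall w \near z.1, I01 (1 - w) -> V (H (1 - w, p)).
      exact: (flip_cont z.1 _ (path_cont p Np _ V (flip _ z01) oV Vz)).
    move=> /near_fst; apply: filterS => w Hw [w01 _]; exact/Hw/flip.
  have HN' z : Z0 z -> N (H' z) by move=> [z01 _]; apply: path_N => //; exact: flip.
  have [x Nx|W [Y [_ Wp HY Y1]]] := @tube_exists H' p yp cH' HN' Np _ p Np.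
    by rewrite /H' /= subrr H0.
  pose y t := Y (1 - t, p).
  exists (y 1), y; split=> //; last by rewrite /y subr0; exact: Y1.
  have -> : (fun t => H (t, p)) = H' \o (fun t => (1 - t, p)).
    by apply/funext => t; rewrite /H' /= subKr.
  apply: (lifted_comp _ _ HY) => t t01.
    by split=> //=; exact: flip.
  by apply: continuous_pair_at; [exact: flip_cont|exact: cst_continuous].
have tubes x : N x -> exists W Y, [/\ open W, W x,
    lifted [set z : R * X | 0 <= z.1 <= 1 /\ (W z.2 /\ N z.2)] H Y &
    forall z, W z -> N z -> Y (1, z) = yq].
  by move=> Nx; exact: (@tube_exists H q yq cH HN Nq H1 x Nx).
have tube_path W Y x : lifted [set z : R * X | 0 <= z.1 <= 1 /\ (W z.2 /\ N z.2)] H Y ->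
    W x -> N x -> lifted I01 (fun t => H (t, x)) (fun t => Y (t, x)).
  move=> HY Wx Nx; apply: (@lifted_comp _ R _ _ H Y (fun t => (t, x)) _ _ HY).
    by move=> t t01; split.
  by move=> t _; exact: pair_cont.
have [G HG] : {G : X -> St & forall x, N x -> exists y,
    [/\ lifted I01 (fun t => H (t, x)) y, y 1 = yq & y 0 = G x]}.
  apply: (@choice _ _ (fun x v => N x -> exists y,
    [/\ lifted I01 (fun t => H (t, x)) y, y 1 = yq & y 0 = v])) => x.
  have [Nx|nNx] := pselect (N x); last by exists yp.
  have [W [Y [_ Wx HY Y1]]] := tubes x Nx.
  by exists (Y (0, x)) => _; exists (fun t => Y (t, x)); split;
    [exact: (tube_path W Y x HY Wx Nx)|exact: Y1|].
have GE x y : N x -> lifted I01 (fun t => H (t, x)) y -> y 1 = yq -> G x = y 0.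
  move=> Nx Hy y1; have [y' [Hy' y'1 <-]] := HG x Nx.
  apply: (lifted_unique seg01 (path_cont x Nx) (path_N x Nx) Hy' Hy one zero).
  by rewrite y1.
exists G; split; first by rewrite (GE p yP).
move=> x Nx; have [W [Y [oW Wx HY Y1]]] := tubes x Nx.
have S0 : [set z : R * X | 0 <= z.1 <= 1 /\ (W z.2 /\ N z.2)] (0, x) by split.
have [U [s [oU Us Ss E]]] := HY _ S0.
have : nbhs x [set z | W z -> N z -> Y (0, z) = s (H (0, z))].
  have : \forall z \near x, [set z : R * X | 0 <= z.1 <= 1 /\ (W z.2 /\ N z.2)] (0, z)
      -> Y (0, z) = s (H (0, z)).
    suff c0 : {for x, continuous (fun z : X => ((0 : R), z))} by exact: (c0 _ E).
    by apply: continuous_pair_at; [exact: cst_continuous|exact: cvg_id].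
  by apply: filterS => z Hz Wz Nz; apply: Hz.
rewrite nbhsE => -[V [oV Vx] HV].
rewrite H0// in Us.
exists (V `&` W `&` U), s; split=> //.
- by do 2! apply: openI => //.
- by apply: Sol_sub Ss => z [].
- move=> z [[Vz Wz] Uz] Nz.
  rewrite (GE z (fun t => Y (t, z)))//; last exact: Y1.
    by rewrite HV// H0.
  exact: (tube_path W Y z HY Wz Nz).
Qed.

End Monodromy.

(** * Calculus in the charts of a manifold *)

Section ChartCalculus.
Context {R : realType} {n : nat} {M : manifold R n}.
Implicit Types (U V : set M) (a b : atlas M) (x : M) (f h : M -> R).

Definition chart_image U a : set 'rV[R]_n := coord a @` (U `&` dom a).

Lemma chart_imageP U a y : chart_image U a y ->
  [/\ U (param a y), dom a (param a y) & coord a (param a y) = y].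
Proof. by move=> [x [Ux dx] <-]; rewrite coordK. Qed.

Lemma chart_image_coord U a x : U x -> dom a x -> chart_image U a (coord a x).
Proof. by move=> Ux dx; exists x. Qed.

Lemma chart_image_dom U a : chart_image U a `<=` coord a @` dom a.
Proof. by move=> _ [x [Ux dx] <-]; exists x. Qed.

Lemma chart_image_sub U V a : U `<=` V -> chart_image U a `<=` chart_image V a.
Proof. by move=> UV _ [x [/UV Vx dx] <-]; exists x. Qed.

Lemma open_chart_image U a : open U -> open (chart_image U a).
Proof.
move=> oU; rewrite openE => y Vy.
have [Uy dy Ey] := chart_imageP Vy.
have iy := chart_image_dom Vy.
have H1 : nbhs y (coord a @` dom a).
  by apply: open_nbhs_nbhs; split=> //; exact: coord_open.
have H2 : \forall z \near y, (U `&` dom a) (param a z).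
  apply: (param_continuous iy); apply: open_nbhs_nbhs; split=> //.
  by apply: openI => //; exact: dom_open.
apply: filterS2 H1 H2 => z [x dx <-] []; rewrite coordK// => Ux _.
by exists x.
Qed.

Arguments open_chart_image [U] a.

Lemma near_param a x (P : M -> Prop) : dom a x -> (\forall z \near x, P z) ->
  \forall y \near coord a x, P (param a y).
Proof.
move=> dx Px; have iy : (coord a @` dom a) (coord a x) by exists x.
by apply: (param_continuous iy); rewrite coordK.
Qed.

Lemma near_coord a x (P : 'rV[R]_n -> Prop) : dom a x ->
  (\forall y \near coord a x, P y) -> \forall z \near x, P (coord a z).
Proof. by move=> dx Px; exact: (coord_continuous dx). Qed.

Definition Ck_in (k : nat) U a f := Ck_on k (chart_image U a) (f \o param a).

Definition diff_in a f x := differentiable (f \o param a) (coord a x).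

Lemma Ck_in_diff k U a f x : open U -> Ck_in k.+1 U a f -> U x -> dom a x ->
  diff_in a f x.
Proof.
move=> oU Cf Ux dx.
exact: (Ck_differentiable (open_chart_image a oU) Cf (chart_image_coord Ux dx)).
Qed.

Lemma diff_in_derivable a f x i : diff_in a f x ->
  derivable (f \o param a) (coord a x) (delta_mx 0 i).
Proof. exact: diff_derivable. Qed.

Lemma eq_pd a f h x i : dom a x -> (\forall z \near x, f z = h z) ->
  pd a i f x = pd a i h x.
Proof. by move=> dx fh; apply: near_eq_derive; exact: (near_param dx fh). Qed.

Lemma pd_cst a (c : R) x i : pd a i (fun=> c) x = 0.
Proof. exact: derive_cst. Qed.

Lemma pdD a f h x i : diff_in a f x -> diff_in a h x ->
  pd a i (fun z => f z + h z) x = pd a i f x + pd a i h x.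
Proof. by move=> fd hd; exact: partialD (diff_in_derivable fd) (diff_in_derivable hd). Qed.

Lemma pdN a f x i : diff_in a f x -> pd a i (fun z => - f z) x = - pd a i f x.
Proof. by move=> fd; exact: partialN (diff_in_derivable fd). Qed.

Lemma pdM a f h x i : dom a x -> diff_in a f x -> diff_in a h x ->
  pd a i (fun z => f z * h z) x = f x * pd a i h x + h x * pd a i f x.
Proof.
move=> dx fd hd; have := partialM (diff_in_derivable fd) (diff_in_derivable hd).
by rewrite /= coordK// => E; exact: E.
Qed.

Lemma pd_sum (I : finType) a (F : I -> M -> R) x i :
  (forall j, diff_in a (F j) x) ->
  pd a i (fun z => \sum_j F j z) x = \sum_j pd a i (F j) x.
Proof.
by move=> Fd; apply: (@partial_sum _ _ _ (fun j => F j \o param a)) => j;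
  exact: diff_in_derivable.
Qed.

Lemma diff_inM a f h x : diff_in a f x -> diff_in a h x ->
  diff_in a (fun z => f z * h z) x.
Proof. by move=> fd hd; exact: (differentiableM fd hd). Qed.

Lemma diff_in_sum (I : finType) a (F : I -> M -> R) x :
  (forall j, diff_in a (F j) x) -> diff_in a (fun z => \sum_j F j z) x.
Proof.
move=> Fd; rewrite /diff_in /comp; elim: (index_enum I) => [|j s IH].
  by under eq_fun do rewrite big_nil; exact: differentiable_cst.
under eq_fun do rewrite big_cons.
exact: (differentiableD (Fd j) IH).
Qed.

Definition pdmx a c m p (A : M -> 'M[R]_(m, p)) x : 'M[R]_(m, p) :=
  \matrix_(i, j) pd a c (fun z => A z i j) x.

Definition diff_mx a m p (A : M -> 'M[R]_(m, p)) x :=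
  forall i j, diff_in a (fun z => A z i j) x.

Lemma diff_mxM a m p q (A : M -> 'M[R]_(m, p)) (B : M -> 'M[R]_(p, q)) x :
  diff_mx a A x -> diff_mx a B x -> diff_mx a (fun z => A z *m B z) x.
Proof.
move=> Ad Bd i j.
have -> : (fun z => (A z *m B z) i j) = (fun z => \sum_k A z i k * B z k j).
  by apply/funext => z; rewrite mxE.
by apply: diff_in_sum => k; exact: diff_inM (Ad i k) (Bd k j).
Qed.

Lemma pdmxM a c m p q (A : M -> 'M[R]_(m, p)) (B : M -> 'M[R]_(p, q)) x :
  dom a x -> diff_mx a A x -> diff_mx a B x ->
  pdmx a c (fun z => A z *m B z) x = pdmx a c A x *m B x + A x *m pdmx a c B x.
Proof.
move=> dx Ad Bd; apply/matrixP => i j; rewrite !mxE.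
have -> : (fun z => (A z *m B z) i j) = (fun z => \sum_k A z i k * B z k j).
  by apply/funext => z; rewrite mxE.
rewrite pd_sum; last by move=> k; exact: diff_inM (Ad i k) (Bd k j).
rewrite -big_split/=; apply: eq_bigr => k _.
rewrite pdM// /pdmx !mxE addrC; congr (_ + _); exact: mulrC.
Qed.

Lemma pdmx_tr a c m p (A : M -> 'M[R]_(m, p)) x :
  pdmx a c (fun z => (A z)^T) x = (pdmx a c A x)^T.
Proof.
apply/matrixP => i j; rewrite !mxE.
by congr (pd a c _ x); apply/funext => z; rewrite mxE.
Qed.

Lemma eq_pdmx a c m p (A B : M -> 'M[R]_(m, p)) x : dom a x ->
  (\forall z \near x, A z = B z) -> pdmx a c A x = pdmx a c B x.
Proof.
move=> dx AB; apply/matrixP => i j; rewrite !mxE; apply: eq_pd => //.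
by apply: filterS AB => z ->.
Qed.

Lemma diff_mx_tr a m p (A : M -> 'M[R]_(m, p)) x :
  diff_mx a A x -> diff_mx a (fun z => (A z)^T) x.
Proof.
move=> Ad i j; rewrite (_ : (fun z => _) = (fun z => A z j i))//.
by apply/funext => z; rewrite mxE.
Qed.

Section Transition.
Variables (a b : atlas M).

Let phi := coord b \o param a.
Let overlap := chart_image (dom b) a.

Lemma overlap_open : open overlap.
Proof. by apply: open_chart_image; exact: dom_open. Qed.

Lemma phi_smooth k j : Ck_on k overlap (fun y => phi y 0 j).
Proof.
have := @transition_smooth _ _ M a b j k.
by rewrite /overlap /chart_image setIC.
Qed.

Lemma phi_diff x : dom a x -> dom b x -> differentiable phi (coord a x).
Proof.
move=> ax bx; apply: differentiable_row => j.
exact: (Ck_differentiable overlap_open (phi_smooth 1 j) (chart_image_coord bx ax)).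
Qed.

Lemma change_of_coordE x i j : dom a x -> dom b x ->
  change_of_coord a b x i j = pd a i (fun z => coord b z 0 j) x.
Proof. by move=> ax bx; rewrite /change_of_coord jacobian_partial//; exact: phi_diff. Qed.

Lemma param_phi x f : dom a x -> dom b x ->
  \forall y \near coord a x, ((f \o param b) \o phi) y = f (param a y).
Proof.
move=> ax bx; apply: (@near_param a x (fun z => f (param b (coord b z)) = f z)) => //.
have : nbhs x (dom b) by apply: open_nbhs_nbhs; split=> //; exact: dom_open.
by apply: filterS => z bz; rewrite coordK.
Qed.

Lemma pd_transition x f i : dom a x -> dom b x -> diff_in b f x ->
  pd a i f x = \sum_j change_of_coord a b x i j * pd b j f x.
Proof.
move=> ax bx fd; have Ephi : phi (coord a x) = coord b x by rewrite /phi/= coordK.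
have -> : pd a i f x = partial i ((f \o param b) \o phi) (coord a x).
  by apply/esym/near_eq_derive/param_phi.
rewrite partial_comp; [|exact: phi_diff|by rewrite Ephi].
by apply: eq_bigr => j _; rewrite change_of_coordE// Ephi.
Qed.

Lemma dscalar_transition x f : dom a x -> dom b x -> diff_in b f x ->
  dscalar f a x = dscalar f b x *m (change_of_coord a b x)^T.
Proof.
move=> ax bx fd; apply/rowP => i; rewrite !mxE pd_transition//.
by apply: eq_bigr => j _; rewrite !mxE mulrC.
Qed.

Lemma Ck_in_transition k U f : open U -> Ck_in k U b f ->
  Ck_in k (U `&` dom b) a f.
Proof.
move=> oU Cf; have oV := open_chart_image b oU.
have oUb : open (U `&` dom b) by apply: openI => //; exact: dom_open.
have oW := open_chart_image a oUb.
have WV y : chart_image (U `&` dom b) a y -> chart_image U b (phi y).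
  by move=> [x [[Ux bx] ax] <-]; rewrite /phi/= coordK//; exact: chart_image_coord.
apply: (@eq_Ck _ _ k _ ((f \o param b) \o phi)) => //.
  by move=> _ [x [[Ux bx] ax] <-]; rewrite /phi /= coordK// coordK.
apply: (Ck_comp oW oV WV _ Cf) => j; apply: Ck_sub (phi_smooth k j).
by move=> _ [x [[Ux bx] ax] <-]; exact: chart_image_coord.
Qed.

End Transition.

End ChartCalculus.
Arguments open_chart_image {R n M U} a.
Arguments overlap_open {R n M} a b.

(** * The Levi-Civita connection in a chart *)

Section LeviCivitaConnection.
Context {R : realType} {n : nat} {M : manifold R n}.
Variable g : cov2 M.
Hypothesis g_metric : riemannian_metric g.
Implicit Types (U : set M) (a b : atlas M) (x : M) (f h : M -> R).

Lemma metric_smooth k a i j : Ck_in k setT a (fun x => g a x i j).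
Proof. exact: (sym_form_smooth g_metric.1). Qed.

Lemma metric_tr a x : dom a x -> (g a x)^T = g a x.
Proof. by move=> ax; apply: (sym_form_sym g_metric.1). Qed.

Lemma metric_unit a x : dom a x -> g a x \in unitmx.
Proof.
move=> ax; rewrite -row_free_unit -kermx_eq0; apply: contraT => /rowV0Pn[v].
move=> /sub_kermxP vg v0; have := g_metric.2 a x ax v v0.
by rewrite vg mul0mx mxE ltxx.
Qed.

Lemma ginv_sym a x : dom a x -> (ginv g a x)^T = ginv g a x.
Proof. by move=> ax; rewrite /ginv trmx_inv metric_tr. Qed.

Lemma ginv_smooth k a i j : Ck_in k setT a (fun x => ginv g a x i j).
Proof.
have C := @Ck_invmx _ _ _ (open_chart_image a openT) k n (fun y => g a (param a y)).
apply: C => [y /chart_imageP[_ ay _]|c d]; first exact: metric_unit.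
exact: metric_smooth.
Qed.

Lemma diff_metric a x : dom a x -> diff_mx a (g a) x.
Proof. by move=> ax i j; exact: (Ck_in_diff openT (metric_smooth 1 a i j)). Qed.

Lemma diff_ginv a x : dom a x -> diff_mx a (ginv g a) x.
Proof. by move=> ax i j; exact: (Ck_in_diff openT (ginv_smooth 1 a i j)). Qed.

(** The Jacobian is a factor of the invertible matrix of the metric in the chart a. *)
Lemma change_of_coord_unit a b x : dom a x -> dom b x ->
  change_of_coord a b x \in unitmx.
Proof.
move=> ax bx; have := metric_unit ax.
rewrite (sym_form_transform g_metric.1 I ax bx) !unitmx_mul.
by case/andP => /andP[].
Qed.

Lemma dscalar_inj a b x f h : dom a x -> dom b x ->
  diff_in a f x -> diff_in a h x ->
  dscalar f b x = dscalar h b x -> dscalar f a x = dscalar h a x.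
Proof.
move=> ax bx fd hd; rewrite !(@dscalar_transition _ _ _ b a)//.
have uJ : (change_of_coord b a x)^T \in unitmx.
  by rewrite unitmx_tr change_of_coord_unit.
by move=> /(congr1 (mulmx^~ (invmx (change_of_coord b a x)^T))); rewrite !mulmxK.
Qed.

Lemma ginv_transition a b x : dom a x -> dom b x ->
  (change_of_coord a b x)^T *m ginv g a x *m change_of_coord a b x = ginv g b x.
Proof.
move=> ax bx; have uJ := change_of_coord_unit ax bx.
rewrite /ginv (sym_form_transform g_metric.1 I ax bx).
set J := change_of_coord a b x in uJ *.
have uG := metric_unit bx; have uJT : J^T \in unitmx by rewrite unitmx_tr.
have uJG : J *m g b x \in unitmx by rewrite unitmx_mul uJ.
apply: (can_inj (mulKmx uG)); rewrite mulmxV//.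
apply: (can_inj (mulKmx uJ)); rewrite mulmx1.
have E : J *m g b x *m J^T *m invmx (J *m g b x *m J^T) = 1%:M.
  by rewrite mulmxV// unitmx_mul uJG uJT.
by rewrite !mulmxA E mul1mx.
Qed.

Lemma normsqE a x (w : 'rV[R]_n) :
  covector_normsq g a x w = (w *m ginv g a x *m w^T) 0 0.
Proof.
rewrite /covector_normsq mxE exchange_big/=; apply: eq_bigr => j _.
rewrite !mxE mulr_suml; apply: eq_bigr => i _.
by rewrite (mulrC (w 0 i)).
Qed.

Lemma normsq_transition a b x f : dom a x -> dom b x -> diff_in b f x ->
  covector_normsq g a x (dscalar f a x) = covector_normsq g b x (dscalar f b x).
Proof.
move=> ax bx fd; rewrite !normsqE (dscalar_transition ax bx fd).
rewrite trmx_mul trmxK -(ginv_transition ax bx).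
by rewrite !mulmxA.
Qed.

(** The vector dual to a differential transforms contravariantly. *)
Lemma sharp_transition a b x f : dom a x -> dom b x -> diff_in b f x ->
  dscalar f a x *m ginv g a x *m change_of_coord a b x
    = dscalar f b x *m ginv g b x.
Proof.
move=> ax bx fd; rewrite (dscalar_transition ax bx fd) -(ginv_transition ax bx).
by rewrite !mulmxA.
Qed.

Definition christoffel_mx a c x : 'M[R]_n := \matrix_(d, i) christoffel g a d i c x.

Lemma pd_metricC a c i j x : dom a x ->
  pd a c (fun y => g a y i j) x = pd a c (fun y => g a y j i) x.
Proof.
move=> ax; apply: eq_pd => //.
have : nbhs x (dom a) by apply: open_nbhs_nbhs; split=> //; exact: dom_open.
by apply: filterS => z az; rewrite -[in LHS](metric_tr az) mxE.
Qed.

Lemma christoffelC a k i j x : dom a x ->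
  christoffel g a k i j x = christoffel g a k j i x.
Proof.
move=> ax; rewrite /christoffel; congr (_ * _); apply: eq_bigr => l _.
congr (_ * _); rewrite (@pd_metricC a l i j x ax); congr (_ - _).
exact: addrC.
Qed.

(** Lowering the upper index of the Christoffel symbols removes the inverse metric. *)
Lemma metric_christoffel a c x : dom a x ->
  g a x *m christoffel_mx a c x = \matrix_(j, i) (2^-1 *
    (pd a i (fun y => g a y c j) x + pd a c (fun y => g a y i j) x
     - pd a j (fun y => g a y i c) x)).
Proof.
move=> ax.
have -> : christoffel_mx a c x = ginv g a x *m \matrix_(l, i) (2^-1 *
    (pd a i (fun y => g a y c l) x + pd a c (fun y => g a y i l) x
     - pd a l (fun y => g a y i c) x)).
  apply/matrixP => d i; rewrite !mxE /christoffel mulr_sumr.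
  by apply: eq_bigr => l _; rewrite !mxE mulrCA.
by rewrite mulmxA /ginv mulmxV ?mul1mx// metric_unit.
Qed.

(** The covariant derivative of the metric vanishes. *)
Lemma metric_compatible a c x : dom a x ->
  pdmx a c (g a) x = (christoffel_mx a c x)^T *m g a x + g a x *m christoffel_mx a c x.
Proof.
move=> ax.
have -> : (christoffel_mx a c x)^T *m g a x = (g a x *m christoffel_mx a c x)^T.
  by rewrite trmx_mul metric_tr.
rewrite metric_christoffel//; apply/matrixP => i j; rewrite !mxE.
rewrite (@pd_metricC a c j i)// (@pd_metricC a j c i)// (@pd_metricC a i j c)//.
by lra.
Qed.

(** Differentiate g g^{-1} = 1. *)
Lemma pdmx_ginv a c x : dom a x ->
  pdmx a c (ginv g a) x = - (christoffel_mx a c x *m ginv g a x)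
    - ginv g a x *m (christoffel_mx a c x)^T.
Proof.
move=> ax; have uG := metric_unit ax.
have E : pdmx a c (fun z => g a z *m ginv g a z) x = 0.
  have -> : pdmx a c (fun z => g a z *m ginv g a z) x = pdmx a c (fun=> 1%:M) x.
    apply: eq_pdmx => //.
    have : nbhs x (dom a) by apply: open_nbhs_nbhs; split=> //; exact: dom_open.
    by apply: filterS => z az; rewrite /ginv mulmxV// metric_unit.
  by apply/matrixP => i j; rewrite !mxE pd_cst.
move: E; rewrite pdmxM//; [|exact: diff_metric|exact: diff_ginv].
rewrite metric_compatible// mulmxDl => /eqP.
rewrite addrC addr_eq0 => /eqP/(congr1 (mulmx (ginv g a x))).
rewrite /ginv mulKmx// => ->.
by rewrite mulmxN mulmxDr -!mulmxA !mulKmx// mulmxV// mulmx1 opprD addrC.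
Qed.

Lemma christoffel_smooth k a d i j : Ck_in k setT a (christoffel g a d i j).
Proof.
have oV := open_chart_image a (@openT M).
have dg c l m : Ck_in k setT a (pd a c (fun y => g a y l m)).
  apply: (eq_Ck oV _ (Ck_partial c (metric_smooth k.+1 a l m))) => y Vy.
  by have [_ _ Ey] := chart_imageP Vy; rewrite /= /pd Ey.
apply: (CkM oV (Ck_cst _ _ _)); apply: (Ck_sum oV) => l.
by apply: (CkM oV (ginv_smooth _ _ _ _)); exact: (CkB oV (CkD oV (dg _ _ _) (dg _ _ _)) (dg _ _ _)).
Qed.

(** In this form the transformation of the Christoffel term under a change of chart
    follows from that of the metric and of the dual vector of w. *)
Lemma christoffel_contraction a x i j (w : 'rV[R]_n) :
  \sum_d christoffel g a d i j x * w 0 d = 2^-1 * \sum_l (w *m ginv g a x) 0 l *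
    (pdmx a i (g a) x j l + pdmx a j (g a) x i l - pdmx a l (g a) x i j).
Proof.
rewrite mulr_sumr; under [RHS]eq_bigr do rewrite mxE mulr_suml mulr_sumr.
rewrite exchange_big/=; apply: eq_bigr => d _.
rewrite /christoffel mulr_sumr mulr_suml; apply: eq_bigr => l _.
by rewrite !mxE; ring.
Qed.

End LeviCivitaConnection.

(** * The Hessian is a tensor *)

(** The change of the lowered Christoffel symbols, contracted with a vector w, under
    a change of coordinates with Jacobian J and second derivatives K. In the cyclic
    combination of the derivatives of J Gb J^T the terms where K meets the index
    contracted with w cancel in pairs, and the two others are equal by the symmetry
    of K. *)
Lemma christoffel_change (F : realFieldType) n (J Gb : 'M[F]_n)
    (K dGa dGb : 'I_n -> 'M[F]_n) (w : 'rV[F]_n) :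
  Gb^T = Gb -> (forall c i p, K c i p = K i c p) ->
  (forall c, dGa c = K c *m Gb *m J^T + J *m (\sum_r J c r *: dGb r) *m J^T
                     + J *m Gb *m (K c)^T) ->
  forall i j, \sum_l w 0 l * (dGa i j l + dGa j i l - dGa l i j) =
    2 * \sum_p (w *m J *m Gb) 0 p * K i j p
    + \sum_p \sum_q J i p * J j q *
        (\sum_r (w *m J) 0 r * (dGb p q r + dGb q p r - dGb r p q)).
Proof.
move=> Gs Ks dGE i j.
have Gs' p q : Gb p q = Gb q p by rewrite -[in LHS]Gs mxE.
pose wb := w *m J; pose ub := wb *m Gb.
pose wK c p := \sum_l w 0 l * K c l p.
pose Q c d := \sum_p \sum_q wK c p * Gb p q * J d q.
pose S c d := \sum_p \sum_q J c p * J d q * \sum_r wb 0 r * dGb p q r.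
pose S' := \sum_p \sum_q J i p * J j q * \sum_r wb 0 r * dGb r p q.
have e1 c d l : (K c *m Gb *m J^T) d l = \sum_p \sum_q K c d p * Gb p q * J l q.
  rewrite mxE exchange_big/=; apply: eq_bigr => q _.
  by rewrite !mxE mulr_suml.
have e3 c d l : (J *m Gb *m (K c)^T) d l = \sum_p \sum_q J d p * Gb p q * K c l q.
  rewrite mxE exchange_big/=; apply: eq_bigr => q _.
  by rewrite !mxE mulr_suml.
have e2 c d l : (J *m (\sum_r J c r *: dGb r) *m J^T) d l =
    \sum_p \sum_q J d p * J l q * \sum_r J c r * dGb r p q.
  rewrite mxE exchange_big/=; apply: eq_bigr => q _.
  rewrite !mxE mulr_suml; apply: eq_bigr => p _.
  rewrite summxE mulrAC; congr (_ * _); apply: eq_bigr => r _.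
  by rewrite mxE.
have pull3 (f : 'I_n -> 'I_n -> F) (b : 'I_n -> 'I_n -> 'I_n -> F) :
    \sum_l w 0 l * (\sum_p \sum_q f p q * b l p q)
    = \sum_p \sum_q f p q * \sum_l w 0 l * b l p q.
  under eq_bigr do rewrite mulr_sumr; rewrite exchange_big/=; apply: eq_bigr => p _.
  under eq_bigr do rewrite mulr_sumr; rewrite exchange_big/=; apply: eq_bigr => q _.
  by rewrite mulr_sumr; apply: eq_bigr => l _; rewrite mulrCA.
have wbE q : \sum_l w 0 l * J l q = wb 0 q by rewrite mxE.
have ubE p : \sum_q Gb p q * wb 0 q = ub 0 p.
  by rewrite mxE; apply: eq_bigr => q _; rewrite Gs' mulrC.
have c1 c d : \sum_l w 0 l * (K c *m Gb *m J^T) d l = \sum_p ub 0 p * K c d p.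
  under eq_bigr do rewrite e1.
  rewrite pull3; apply: eq_bigr => p _.
  under eq_bigr do rewrite wbE -mulrA.
  by rewrite -mulr_sumr ubE mulrC.
have c3 c d : \sum_l w 0 l * (J *m Gb *m (K c)^T) d l = Q c d.
  under eq_bigr do rewrite e3.
  rewrite pull3 /Q exchange_big/=; apply: eq_bigr => q _; apply: eq_bigr => p _.
  by rewrite -/(wK c q) Gs'; ring.
have c2 c d : \sum_l w 0 l * (J *m (\sum_r J c r *: dGb r) *m J^T) d l =
    \sum_p \sum_q J d p * wb 0 q * \sum_r J c r * dGb r p q.
  under eq_bigr do rewrite e2.
  have -> : \sum_l w 0 l * (\sum_p \sum_q J d p * J l q * (\sum_r J c r * dGb r p q))
    = \sum_l w 0 l * (\sum_p \sum_q (J d p * \sum_r J c r * dGb r p q) * J l q).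
    apply: eq_bigr => l _; congr (_ * _); apply: eq_bigr => p _.
    by apply: eq_bigr => q _; rewrite mulrAC.
  rewrite pull3; apply: eq_bigr => p _; apply: eq_bigr => q _.
  by rewrite wbE mulrAC.
have c2' c d : \sum_l w 0 l * (J *m (\sum_r J c r *: dGb r) *m J^T) d l
    = \sum_p \sum_q J c p * J d q * \sum_r wb 0 r * dGb p q r.
  rewrite c2 exchange_big/=.
  transitivity (\sum_q \sum_p \sum_r J d p * wb 0 q * (J c r * dGb r p q)).
    by apply: eq_bigr => q _; apply: eq_bigr => p _; rewrite mulr_sumr.
  transitivity (\sum_p \sum_q \sum_r J c p * J d q * (wb 0 r * dGb p q r)).
    rewrite exchange_big/= [RHS]exchange_big/=; apply: eq_bigr => p _.
    rewrite exchange_big/=; apply: eq_bigr => r _; apply: eq_bigr => q _.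
    ring.
  by apply: eq_bigr => p _; apply: eq_bigr => q _; rewrite mulr_sumr.
have d1 : \sum_l w 0 l * (K l *m Gb *m J^T) i j = Q i j.
  under eq_bigr do rewrite e1.
  transitivity (\sum_l w 0 l * (\sum_p \sum_q (Gb p q * J j q) * K i l p)).
    apply: eq_bigr => l _; congr (_ * _); apply: eq_bigr => p _.
    by apply: eq_bigr => q _; rewrite Ks; ring.
  rewrite pull3; apply: eq_bigr => p _; apply: eq_bigr => q _.
  by rewrite -/(wK i p); ring.
have d3 : \sum_l w 0 l * (J *m Gb *m (K l)^T) i j = Q j i.
  under eq_bigr do rewrite e3.
  transitivity (\sum_l w 0 l * (\sum_p \sum_q (J i p * Gb p q) * K j l q)).
    apply: eq_bigr => l _; congr (_ * _); apply: eq_bigr => p _.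
    by apply: eq_bigr => q _; rewrite Ks.
  rewrite pull3 /Q exchange_big/=; apply: eq_bigr => q _; apply: eq_bigr => p _.
  by rewrite -/(wK j q) Gs'; ring.
have d2 : \sum_l w 0 l * (J *m (\sum_r J l r *: dGb r) *m J^T) i j = S'.
  under eq_bigr do rewrite e2.
  rewrite pull3; apply: eq_bigr => p _; apply: eq_bigr => q _.
  congr (_ * _); under eq_bigr do rewrite mulr_sumr; rewrite exchange_big/=.
  by apply: eq_bigr => r _; rewrite -wbE mulr_suml; apply: eq_bigr => l _; rewrite mulrA.
have -> : \sum_l w 0 l * (dGa i j l + dGa j i l - dGa l i j) =
    \sum_l w 0 l * dGa i j l + \sum_l w 0 l * dGa j i l - \sum_l w 0 l * dGa l i j.
  by rewrite -big_split/= -sumrB; apply: eq_bigr => l _; ring.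
have split3 (c d l : 'I_n -> 'I_n) : \sum_m w 0 m * dGa (c m) (d m) (l m) =
    \sum_m w 0 m * (K (c m) *m Gb *m J^T) (d m) (l m)
    + \sum_m w 0 m * (J *m (\sum_r J (c m) r *: dGb r) *m J^T) (d m) (l m)
    + \sum_m w 0 m * (J *m Gb *m (K (c m))^T) (d m) (l m).
  rewrite -!big_split/=; apply: eq_bigr => m _.
  by rewrite dGE !mxE; ring.
rewrite (split3 (fun=> i) (fun=> j) id) (split3 (fun=> j) (fun=> i) id)
  (split3 id (fun=> i) (fun=> j)) /=.
rewrite (c1 i j) (c1 j i) (c3 i j) (c3 j i) (c2' i j) (c2' j i) d1 d2 d3.
have -> : \sum_p ub 0 p * K j i p = \sum_p ub 0 p * K i j p.
  by apply: eq_bigr => p _; rewrite Ks.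
have -> : \sum_p \sum_q J i p * J j q *
    (\sum_r wb 0 r * (dGb p q r + dGb q p r - dGb r p q)) = S i j + S j i - S'.
  have -> : S j i = \sum_p \sum_q J i p * J j q * \sum_r wb 0 r * dGb q p r.
    rewrite /S exchange_big/=; apply: eq_bigr => p _; apply: eq_bigr => q _.
    by rewrite (mulrC (J j q)).
  rewrite /S /S' -big_split -sumrB/=; apply: eq_bigr => p _.
  rewrite -big_split -sumrB/=; apply: eq_bigr => q _.
  rewrite -mulrDr -mulrBr -big_split -sumrB/=; congr (_ * _).
  by apply: eq_bigr => r _; ring.
rewrite -/wb -/ub /S; ring.
Qed.

Section HessianTransition.
Context {R : realType} {n : nat} {M : manifold R n}.
Variable g : cov2 M.
Hypothesis g_metric : riemannian_metric g.
Implicit Types (U : set M) (a b : atlas M) (x : M) (f h : M -> R).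

Lemma Ck_in_pd k U a i h : open U -> Ck_in k.+1 U a h -> Ck_in k U a (pd a i h).
Proof.
move=> oU Ch; apply: (eq_Ck (open_chart_image a oU) _ (Ck_partial i Ch)) => y Vy.
by have [_ _ Ey] := chart_imageP Vy; rewrite /= /pd Ey.
Qed.

Definition second_partials a h x : 'M[R]_n :=
  \matrix_(i, c) pd a c (pd a i h) x.

Definition hessian_mx a h x : 'M[R]_n := \matrix_(i, c) hessian g h a x i c.

Section Overlap.
Variables (a b : atlas M) (x : M).
Hypotheses (ax : dom a x) (bx : dom b x).

Let J := change_of_coord a b.
Let K c : 'M[R]_n := pdmx a c J x.

Let near_b : \forall z \near x, dom a z /\ dom b z.
Proof.
have na : nbhs x (dom a) by apply: open_nbhs_nbhs; split=> //; exact: dom_open.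
have nb : nbhs x (dom b) by apply: open_nbhs_nbhs; split=> //; exact: dom_open.
exact: filterI na nb.
Qed.

Let J_smooth k i j : Ck_in k (dom b) a (fun z => J z i j).
Proof.
apply: (eq_Ck (overlap_open a b) _ (Ck_partial i (phi_smooth a b k.+1 j))) => y Vy.
have [by_ ay Ey] := chart_imageP Vy.
by rewrite /= /J change_of_coordE// /pd Ey.
Qed.

Let J_diff : diff_mx a J x.
Proof. by move=> i j; exact: (Ck_in_diff (@dom_open _ _ M b) (J_smooth 1 i j)). Qed.

(** Equality of the mixed second derivatives of the transition map. *)
Let K_sym c i p : K c i p = K i c p.
Proof.
have E d l : K d l p = partial d (partial l (fun y => (coord b \o param a) y 0 p)) (coord a x).
  rewrite mxE; apply: near_eq_derive.
  apply: (open_near (overlap_open a b) (chart_image_coord bx ax)) => y Vy.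
  have [by_ ay Ey] := chart_imageP Vy.
  by rewrite /= /J change_of_coordE// /pd Ey.
apply: (etrans (E c i)); apply: (etrans _ (esym (E i c))).
exact: (@partialC _ _ _ _ _ c i (overlap_open a b) (phi_smooth a b 2 p)
  (chart_image_coord bx ax)).
Qed.

Let diff_b k U f : open U -> U x -> Ck_in k.+1 U b f -> diff_in a f x.
Proof.
move=> oU Ux Cf; apply: Ck_in_diff (Ck_in_transition a oU Cf) _ ax => //.
by apply: openI => //; exact: dom_open.
Qed.

Let pdmx_metric c : pdmx a c (g b) x = \sum_r J x c r *: pdmx b r (g b) x.
Proof.
apply/matrixP => i j; rewrite summxE !mxE (pd_transition _ ax bx).
  by apply: eq_bigr => r _; rewrite !mxE.
exact: (diff_metric g_metric bx).
Qed.

Let metric_derivative c : pdmx a c (g a) x =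
  K c *m g b x *m (J x)^T
  + J x *m (\sum_r J x c r *: pdmx b r (g b) x) *m (J x)^T
  + J x *m g b x *m (K c)^T.
Proof.
have gb_diff : diff_mx a (g b) x.
  by move=> i j; apply: (diff_b openT I (metric_smooth g_metric 1 b i j)).
rewrite (@eq_pdmx _ _ _ a c _ _ (g a) (fun z => J z *m g b z *m (J z)^T))//; last first.
  by apply: filterS near_b => z [az bz]; exact: (sym_form_transform g_metric.1 I az bz).
rewrite pdmxM//; [|exact: diff_mxM|exact: diff_mx_tr].
by rewrite pdmxM// pdmx_tr pdmx_metric mulmxDl -/(K c).
Qed.

Variables (U : set M) (h : M -> R).
Hypotheses (oU : open U) (Ux : U x) (h_C2 : Ck_in 2 U b h).

Let second_partials_transition i c : pd a c (pd a i h) x =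
  (J x *m second_partials b h x *m (J x)^T) i c
    + \sum_p dscalar h b x 0 p * K c i p.
Proof.
have nU : nbhs x U by exact: open_nbhs_nbhs.
have dpd j : diff_in b (pd b j h) x.
  exact: Ck_in_diff oU (Ck_in_pd j oU h_C2) Ux bx.
have dpda j : diff_in a (pd b j h) x.
  exact: diff_b oU Ux (Ck_in_pd j oU h_C2).
rewrite (@eq_pd _ _ _ a (pd a i h) (fun z => \sum_j J z i j * pd b j h z))//; last first.
  apply: filterS2 nU near_b => z Uz [az bz].
  exact: (pd_transition _ az bz (Ck_in_diff oU h_C2 Uz bz)).
rewrite pd_sum; last by move=> j; apply: diff_inM; [exact: J_diff|exact: dpda].
under eq_bigr do rewrite pdM//.
rewrite big_split/=; congr (_ + _); last first.
  by apply: eq_bigr => p _; rewrite !mxE.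
under eq_bigr => j _ do rewrite (pd_transition _ ax bx (dpd j)) mulr_sumr.
rewrite mxE exchange_big/=; apply: eq_bigr => k _.
rewrite !mxE mulr_suml; apply: eq_bigr => j _.
by rewrite !mxE; ring.
Qed.

(** The second derivatives of the transition map enter the second partial derivatives
    of h and the Christoffel term with the same coefficients, and cancel. *)
Lemma hessian_transition :
  hessian_mx a h x = J x *m hessian_mx b h x *m (J x)^T.
Proof.
have dh := Ck_in_diff oU h_C2 Ux bx.
apply/matrixP => i j; rewrite mxE /hessian /covD1.
have -> : pd a j (fun y => dscalar h a y 0 i) x = pd a j (pd a i h) x.
  by congr (pd a j _ x); apply/funext => y; rewrite mxE.
rewrite second_partials_transition christoffel_contraction.
rewrite (christoffel_change _ (metric_tr g_metric bx) K_sym metric_derivative).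
have wE : dscalar h a x *m ginv g a x *m J x = dscalar h b x *m ginv g b x.
  exact: sharp_transition.
rewrite !wE.
have -> : dscalar h b x *m ginv g b x *m g b x = dscalar h b x.
  by rewrite /ginv mulmxKV// metric_unit.
rewrite mulrDr mulrA mulVf ?mul1r ?pnatr_eq0// opprD addrA.
have -> : \sum_p dscalar h b x 0 p * K j i p = \sum_p dscalar h b x 0 p * K i j p.
  by apply: eq_bigr => p _; congr (_ * _); exact: K_sym.
rewrite addrK.
have -> : hessian_mx b h x = second_partials b h x - \matrix_(p, q) (2^-1 *
    \sum_r (dscalar h b x *m ginv g b x) 0 r *
      (pdmx b p (g b) x q r + pdmx b q (g b) x p r - pdmx b r (g b) x p q)).
  apply/matrixP => p q; rewrite !mxE /hessian /covD1 christoffel_contraction.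
  congr (_ - _); congr (pd b q _ x); apply/funext => y; exact: mxE.
rewrite mulmxBr mulmxBl [RHS]mxE; congr (_ + _).
rewrite [RHS]mxE; congr (- _).
rewrite [RHS]mxE; under [RHS]eq_bigr do rewrite !mxE mulr_suml.
rewrite exchange_big mulr_sumr/=; apply: eq_bigr => p _.
rewrite mulr_sumr; apply: eq_bigr => q _.
by rewrite !mxE; ring.
Qed.

End Overlap.

End HessianTransition.

(** * The flat connection of the Gauss and Codazzi equations *)

Section GaussCodazzi.
Context {R : realType} {n : nat} {M : manifold R n}.
Variable g : cov2 M.
Hypothesis g_metric : riemannian_metric g.
Implicit Types (U : set M) (a b : atlas M) (x : M) (f h : M -> R).

Lemma near_dom a x : dom a x -> \forall z \near x, dom a z.
Proof. by move=> ax; apply: open_nbhs_nbhs; split=> //; exact: dom_open. Qed.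

Lemma diff_dscalar U a h x : open U -> Ck_in 2 U a h -> U x -> dom a x ->
  diff_mx a (dscalar h a) x.
Proof.
move=> oU Ch Ux ax i j.
rewrite (_ : (fun z => _) = pd a j h); last by apply/funext => z; rewrite mxE.
exact: Ck_in_diff oU (Ck_in_pd j oU Ch) Ux ax.
Qed.

Lemma hessianE a h x j c : hessian g h a x j c =
  (pdmx a c (dscalar h a) x - dscalar h a x *m christoffel_mx g a c x) 0 j.
Proof.
rewrite /hessian /covD1 !mxE; congr (_ - _).
by apply: eq_bigr => d _; rewrite !mxE mulrC.
Qed.

(** The derivative of the inverse metric supplies the Christoffel symbols that turn
    the partial derivatives of dh into the Hessian. *)
Lemma pd_normsq U a h x c : open U -> Ck_in 2 U a h -> U x -> dom a x ->
  pd a c (fun z => covector_normsq g a z (dscalar h a z)) x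
  = 2 * (dscalar h a x *m ginv g a x *m hessian_mx g a h x) 0 c.
Proof.
move=> oU Ch Ux ax; have du := diff_dscalar oU Ch Ux ax.
have dgi := diff_ginv g_metric ax.
have -> : pd a c (fun z => covector_normsq g a z (dscalar h a z)) x =
    pdmx a c (fun z => dscalar h a z *m ginv g a z *m (dscalar h a z)^T) x 0 0.
  by rewrite mxE; congr (pd a c _ x); apply/funext => z; rewrite normsqE.
rewrite pdmxM//; [|exact: diff_mxM|exact: diff_mx_tr].
rewrite pdmxM// pdmx_tr pdmx_ginv//.
set u := dscalar h a x; set du' := pdmx a c _ x; set G := ginv g a x.
set Ga := christoffel_mx g a c x.
have tr00 (X : 'M[R]_1) : X^T 0 0 = X 0 0 by rewrite mxE.
have GT : G^T = G by exact: ginv_sym.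
have e1 : (du' *m G *m u^T) 0 0 = (u *m G *m du'^T) 0 0.
  by rewrite -tr00 !trmx_mul !trmxK GT mulmxA.
have e2 : (u *m (Ga *m G) *m u^T) 0 0 = (u *m (G *m Ga^T) *m u^T) 0 0.
  by rewrite -tr00 !trmx_mul !trmxK GT !mulmxA.
have -> : (u *m G *m hessian_mx g a h x) 0 c = (u *m G *m (du' - u *m Ga)^T) 0 0.
  rewrite mxE [RHS]mxE; apply: eq_bigr => j _; congr (_ * _).
  by rewrite mxE [RHS]mxE; exact: hessianE.
have -> : (du' - u *m Ga)^T = du'^T - Ga^T *m u^T.
  by rewrite [LHS]linearB/= trmx_mul.
rewrite mulmxBr !mulmxDl !mulmxDr !mulmxN !mulNmx.
have eD (X Y : 'M[R]_1) : (X + Y) 0 0 = X 0 0 + Y 0 0 by rewrite mxE.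
have eN (X : 'M[R]_1) : (- X) 0 0 = - X 0 0 by rewrite mxE.
rewrite !eD !eN e2 e1 !mulmxA.
set p := (_ *m du'^T) 0 0; set q := (_ *m u^T) 0 0; ring.
Qed.

Variables (N : set M) (Pi : cov2 M).
Hypotheses (N_open : open N) (Pi_sym : sym_form_on N Pi).
Hypotheses (Pi_gauss : gauss_equation_on g N Pi)
  (Pi_codazzi : codazzi_equation_on g N Pi).

(** For u = dh these equations read u_{i;c} = f Pi_{ic} and f_{;c} = - u^l Pi_{lc}. *)
Definition parallel_eqs a h f x :=
  hessian_mx g a h x = f x *: Pi a x /\
  dscalar f a x = - (dscalar h a x *m ginv g a x *m Pi a x).

Definition parallel_pair U h f := forall a, [/\ Ck_in 2 U a h, Ck_in 1 U a f &
  forall x, U x -> dom a x -> parallel_eqs a h f x].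

Lemma parallel_eqs_transition U a b h f x : open U -> U x -> N x ->
  dom a x -> dom b x -> Ck_in 2 U b h -> Ck_in 1 U b f ->
  parallel_eqs b h f x -> parallel_eqs a h f x.
Proof.
move=> oU Ux Nx ax bx Ch Cf [E1 E2].
have PiE := sym_form_transform Pi_sym Nx ax bx.
have dh := Ck_in_diff oU Ch Ux bx; have df := Ck_in_diff oU Cf Ux bx.
split.
  rewrite (hessian_transition g_metric ax bx oU Ux Ch) E1 PiE.
  by rewrite -scalemxAr -scalemxAl.
rewrite (dscalar_transition ax bx df) E2 PiE mulNmx; congr (- _).
by rewrite -(sharp_transition g_metric ax bx dh) !mulmxA.
Qed.

(** The coefficients of a linear connection on triples (h, u, f): the index inl i
    stands for the component u_i, inr true for h and inr false for f. Its parallel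
    triples are the solutions of dh = u, u_{i;c} = f Pi_{ic}, f_{;c} = - u^l Pi_{lc}. *)
Definition conn a (c : 'I_n) x (l i : 'I_n + bool) : R :=
  match l, i with
  | inl d, inl b => christoffel g a d b c x
  | inl d, inr true => (d == c)%:R
  | inl d, inr false => - (ginv g a x *m Pi a x) d c
  | inr false, inl b => Pi a x b c
  | _, _ => 0
  end.

Lemma Pi_smooth k a i j : Ck_in k N a (fun x => Pi a x i j).
Proof. exact: (sym_form_smooth Pi_sym). Qed.

Lemma Pi_symE a x i j : N x -> dom a x -> Pi a x i j = Pi a x j i.
Proof. by move=> Nx ax; rewrite -[in LHS](sym_form_sym Pi_sym Nx ax) mxE. Qed.

Lemma Ck_in_setT k a f : Ck_in k setT a f -> Ck_in k N a f.
Proof. by apply: Ck_sub; exact: chart_image_sub. Qed.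

Lemma conn_smooth k a c l i : Ck_in k N a (fun x => conn a c x l i).
Proof.
have oV := open_chart_image a N_open.
case: l i => [d|[]] [b|[]]; try exact: Ck_cst.
- exact/Ck_in_setT/christoffel_smooth.
- apply: (CkN oV).
  apply: (@eq_Ck _ _ k _ (fun y => \sum_m ginv g a (param a y) d m * Pi a (param a y) m c)) => //.
    by move=> y _; rewrite /= mxE.
  apply: (Ck_sum oV) => m; apply: (CkM oV).
    exact: (Ck_in_setT (ginv_smooth g_metric k a d m)).
  exact: (Pi_smooth k a m c).
- exact: Pi_smooth.
Qed.

(** The Christoffel term in which b and c meet is symmetric and drops out. *)
Lemma codazziE a x (e b c : 'I_n) : N x -> dom a x ->
  pd a c (fun z => Pi a z e b) x - \sum_d christoffel g a d e c x * Pi a x d b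
  = pd a b (fun z => Pi a z e c) x - \sum_d christoffel g a d e b x * Pi a x d c.
Proof.
move=> Nx ax; have := Pi_codazzi Nx ax e b c.
move=> /eqP; rewrite mulf_eq0 invr_eq0 pnatr_eq0/= subr_eq0 => /eqP.
rewrite /covD2.
have -> : \sum_d christoffel g a d b c x * Pi a x e d =
          \sum_d christoffel g a d c b x * Pi a x e d.
  by apply: eq_bigr => d _; rewrite christoffelC.
exact: addIr.
Qed.

(** The Gauss equation with its first index raised. *)
Lemma gaussE a x (d b c e : 'I_n) : N x -> dom a x ->
  pd a c (christoffel g a d b e) x - pd a e (christoffel g a d b c) x
    + \sum_m christoffel g a d m c x * christoffel g a m b e x
    - \sum_m christoffel g a d m e x * christoffel g a m b c x
  = (ginv g a x *m Pi a x) d c * Pi a x b e - (ginv g a x *m Pi a x) d e * Pi a x b c.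
Proof.
move=> Nx ax.
have -> : pd a c (christoffel g a d b e) x - pd a e (christoffel g a d b c) x
    + \sum_m christoffel g a d m c x * christoffel g a m b e x
    - \sum_m christoffel g a d m e x * christoffel g a m b c x
    = riemann_up g a x d b c e.
  have e1 i j : pd a i (christoffel g a d b j) x = pd a i (christoffel g a d j b) x.
    by apply: eq_pd => //; apply: filterS (near_dom ax) => z az; rewrite christoffelC.
  have e2 i j : \sum_m christoffel g a d m i x * christoffel g a m b j x =
      \sum_m christoffel g a d i m x * christoffel g a m j b x.
    by apply: eq_bigr => m _; congr (_ * _); exact: christoffelC.
  by rewrite (e1 c e) (e1 e c) (e2 c e) (e2 e c).
have GE p : \sum_m g a x p m * riemann_up g a x m b c e =
    Pi a x p c * Pi a x b e - Pi a x p e * Pi a x b c.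
  exact: Pi_gauss.
pose v : 'cV[R]_n := \col_m riemann_up g a x m b c e.
have E : g a x *m v = \col_p (Pi a x p c * Pi a x b e - Pi a x p e * Pi a x b c).
  apply/colP => p; rewrite !mxE -GE; apply: eq_bigr => m _; by rewrite mxE.
have -> : riemann_up g a x d b c e = v d 0 by rewrite mxE.
rewrite -(mulKmx (metric_unit g_metric ax) v) E -/(ginv g a x) !mxE.
rewrite !mulr_suml -sumrB; apply: eq_bigr => p _.
by rewrite !mxE; ring.
Qed.

Lemma conn_sum a c e x l i : \sum_k conn a c x l k * conn a e x k i =
  \sum_k conn a c x l (inl k) * conn a e x (inl k) i
  + (conn a c x l (inr true) * conn a e x (inr true) i
     + conn a c x l (inr false) * conn a e x (inr false) i).
Proof. by rewrite big_sumType/= big_bool. Qed.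

(** The Gauss equation is the curvature from u to u, and the Codazzi equation is the
    one between u and f; the other entries vanish by the symmetry of the
    Christoffel symbols, of the metric and of Pi. *)
Lemma conn_flat a x c e l i : N x -> dom a x ->
  pd a c (fun z => conn a e z l i) x + \sum_k conn a c x l k * conn a e x k i =
  pd a e (fun z => conn a c z l i) x + \sum_k conn a e x l k * conn a c x k i.
Proof.
move=> Nx ax; rewrite !conn_sum.
have delta_sum (F : 'I_n -> R) (k : 'I_n) : \sum_m F m * (m == k)%:R = F k.
  rewrite (bigD1 k)//= eqxx mulr1 big1 ?addr0// => m /negbTE ->.
  by rewrite mulr0.
have rearrange (A B s1 s2 p q : R) :
    A - B + s1 - s2 = p - q -> A + (s1 - p) = B + (s2 - q) by move=> H; lra.
have rearrange' (A B s1 s2 : R) : A - s1 = B - s2 -> A + s2 = B + s1.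
  by move=> H; lra.
case: l i => [d|[]] [b|[]] /=; rewrite ?mul0r ?mulr0 ?addr0 ?add0r ?pd_cst ?add0r.
- by rewrite !mulNr; exact: rearrange (gaussE d b c e Nx ax).
- by rewrite !delta_sum; apply: christoffelC.
- have sum_ginvPi (k' : 'I_n) (c' : 'I_n) : \sum_k christoffel g a d k c' x *
      - (ginv g a x *m Pi a x) k k' = - (christoffel_mx g a c' x *m (ginv g a x *m Pi a x)) d k'.
    rewrite [in RHS]mxE -sumrN; apply: eq_bigr => k _.
    by rewrite mulrN [in RHS]mxE.
  rewrite (sum_ginvPi e c) (sum_ginvPi c e).
  have dP : diff_mx a (Pi a) x.
    by move=> i j; exact: (Ck_in_diff N_open (Pi_smooth 1 a i j)).
  have dgi := diff_ginv g_metric ax.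
  pose Z c' := (christoffel_mx g a c' x)^T *m Pi a x - pdmx a c' (Pi a) x.
  have step c' e' : pd a c' (fun z => - (ginv g a z *m Pi a z) d e') x +
      - (christoffel_mx g a c' x *m (ginv g a x *m Pi a x)) d e'
      = (ginv g a x *m Z c') d e'.
    rewrite pdN; last exact: diff_mxM.
    have -> : pd a c' (fun z => (ginv g a z *m Pi a z) d e') x =
        pdmx a c' (fun z => ginv g a z *m Pi a z) x d e' by rewrite mxE.
    rewrite pdmxM// pdmx_ginv// /Z mulmxBr mulmxBl mulNmx !mulmxA.
    have eD (X Y : 'M[R]_n) : (X + Y) d e' = X d e' + Y d e' by rewrite mxE.
    have eN (X : 'M[R]_n) : (- X) d e' = - X d e' by rewrite mxE.
    by rewrite !eD !eN; ring.
  apply: etrans (step c e) (etrans _ (esym (step e c))).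
  rewrite [LHS]mxE [RHS]mxE; apply: eq_bigr => m _; congr (_ * _).
  have ZE c' e' : Z c' m e' = \sum_k christoffel g a k m c' x * Pi a x k e'
      - pd a c' (fun z => Pi a z m e') x.
    by rewrite !mxE; congr (_ - _); apply: eq_bigr => k _; rewrite !mxE.
  apply: etrans (ZE c e) (etrans _ (esym (ZE e c))).
  by apply: oppr_inj; rewrite !opprB; exact: codazziE.
- by rewrite !big1// => k _; rewrite mul0r.
- by rewrite !big1// => k _; rewrite mul0r.
- by rewrite !big1// => k _; rewrite mul0r.
- have := @codazziE a x b e c Nx ax.
  have sE c' e' : \sum_k Pi a x k c' * christoffel g a k b e' x =
      \sum_k christoffel g a k b e' x * Pi a x k c'.
    by apply: eq_bigr => k _; rewrite mulrC.
  by rewrite !sE; exact: rearrange'.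
- by rewrite !delta_sum; exact: Pi_symE.
- have sE c' e' : \sum_k Pi a x k c' * - (ginv g a x *m Pi a x) k e' =
      - ((Pi a x)^T *m (ginv g a x *m Pi a x)) c' e'.
    rewrite mxE -sumrN; apply: eq_bigr => k _.
    by rewrite mulrN [in RHS]mxE.
  rewrite !sE; congr (- _).
  have S : ((Pi a x)^T *m (ginv g a x *m Pi a x))^T =
      (Pi a x)^T *m (ginv g a x *m Pi a x).
    by rewrite !trmx_mul trmxK ginv_sym// mulmxA.
  by rewrite -[in LHS]S mxE.
Qed.

End GaussCodazzi.

(** * Parallel pairs of functions *)

Section LocalSections.
Context {R : realType} {n : nat} {M : manifold R n}.
Variables (g : cov2 M) (N : set M) (Pi : cov2 M).
Hypothesis g_metric : riemannian_metric g.
Hypotheses (N_open : open N) (Pi_sym : sym_form_on N Pi).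
Hypotheses (Pi_gauss : gauss_equation_on g N Pi)
  (Pi_codazzi : codazzi_equation_on g N Pi).
Implicit Types (U W : set M) (a b : atlas M) (x : M) (f h : M -> R).

Let sys a (c : 'I_n) (y : 'rV[R]_n) := conn g Pi a c (param a y).

Let sys_smooth a k c l i : Ck_on k (chart_image N a) (fun y => sys a c y l i).
Proof. exact: (conn_smooth g_metric N_open Pi_sym k a c l i). Qed.

Let sys_flat a : flat_system (chart_image N a) (sys a).
Proof.
move=> y Vy c e l i; have [Ny ay Ey] := chart_imageP Vy.
have := conn_flat g_metric N_open Pi_sym Pi_gauss Pi_codazzi c e l i Ny ay.
by rewrite /pd Ey.
Qed.

Definition coord_preimage a (V : set 'rV[R]_n) : set M :=
  [set x | dom a x /\ V (coord a x)].

Lemma open_coord_preimage a V : open V -> open (coord_preimage a V).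
Proof.
move=> oV; rewrite openE => x [ax Vx].
have nV : \forall y \near coord a x, V y by apply: open_nbhs_nbhs.
by apply: filterS2 (near_dom ax) (near_coord ax nV) => z az Vz.
Qed.

Lemma chart_image_preimage a V : V `<=` coord a @` dom a ->
  chart_image (coord_preimage a V) a = V.
Proof.
move=> Va; apply/seteqP; split=> y; first by move=> [x [[ax Vx] _] <-].
move=> Vy; have [x ax E] := Va _ Vy; rewrite -E.
by exists x => //; split=> //; split=> //; rewrite E.
Qed.

Definition frame a h f (y : 'rV[R]_n) (i : 'I_n + bool) : R :=
  match i with
  | inl j => partial j (h \o param a) y
  | inr true => h (param a y)
  | inr false => f (param a y)
  end.

Let sys_sum a c y (F : 'I_n + bool -> R) i : \sum_l F l * sys a c y l i =
  \sum_d F (inl d) * sys a c y (inl d) i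
  + (F (inr true) * sys a c y (inr true) i + F (inr false) * sys a c y (inr false) i).
Proof. by rewrite big_sumType/= big_bool. Qed.

(** In a chart, the triple formed by a parallel pair and the differential of its
    first member solves the linear system with coefficients conn. *)
Lemma pair_solution U a h f (V : set 'rV[R]_n) : open U -> U `<=` N ->
  parallel_pair g Pi U h f -> V `<=` chart_image U a ->
  linear_solution V (sys a) (frame a h f).
Proof.
move=> oU UN hf VU y Vy i; have Uy := VU y Vy; have [Ux ax Ey] := chart_imageP Uy.
have [Ch_in Cf_in /(_ _ Ux ax) [E1 E2]] := hf a.
have Ch : Ck_on 2 (chart_image U a) (h \o param a) := Ch_in.
have Cf : Ck_on 1 (chart_image U a) (f \o param a) := Cf_in.
case: i => [b|[]] /=.
- have C := Ck_continuous (Ck_partial b Ch) Uy.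
  split=> [|c]; first exact: C.
  split; first exact: Ck_derivable (Ck_partial b Ch) Uy.
  rewrite sys_sum/= mulr0 add0r.
  have -> : 'D_(delta_mx 0 c) (fun y => partial b (h \o param a) y) y =
      pd a c (pd a b h) (param a y).
    rewrite /pd Ey; apply: near_eq_derive.
    apply: (open_near (open_chart_image a oU) Uy) => z /chart_imageP[_ _ Ez].
    by rewrite /= Ez.
  have /matrixP/(_ b c) := E1; rewrite !mxE /hessian /covD1 => E.
  have {}E : pd a c (pd a b h) (param a y) =
      \sum_d christoffel g a d b c (param a y) * dscalar h a (param a y) 0 d
      + f (param a y) * Pi a (param a y) b c.
    rewrite -E addrC; apply/esym; rewrite [RHS](_ : _ = pd a c (fun z => dscalar h a z 0 b) (param a y)).
      exact: subrK.
    by congr (pd a c _ _); apply/funext => z; rewrite mxE.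
  rewrite E; congr (_ + _); apply: eq_bigr => d _.
  by rewrite mulrC mxE /pd Ey.
- have C := Ck_continuous Ch Uy.
  split=> [|c]; first exact: C.
  split; first exact: Ck_derivable Ch Uy.
  rewrite sys_sum/= !mulr0 !addr0 (bigD1 c)//= eqxx mulr1 big1 ?addr0// => d /negbTE ->.
  by rewrite mulr0.
- have C := Ck_continuous Cf Uy.
  split=> [|c]; first exact: C.
  split; first exact: Ck_derivable Cf Uy.
  rewrite sys_sum/= !mulr0 !addr0.
  have /rowP/(_ c) := E2; rewrite mxE /pd Ey => E; apply: (etrans E).
  rewrite -mulmxA !mxE -sumrN; apply: eq_bigr => d _.
  by rewrite mulrN; congr (- (_ * _)); rewrite mxE /pd Ey.
Qed.

(** Conversely, the system makes its components u the partial derivatives of h. The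
    equations hold first in the chart a, then in all charts as they are tensorial. *)
Lemma solution_pair a (V : set 'rV[R]_n) Y : open V -> V `<=` chart_image N a ->
  linear_solution V (sys a) Y ->
  let h x := Y (coord a x) (inr true) in
  let f x := Y (coord a x) (inr false) in
  [/\ parallel_pair g Pi (coord_preimage a V) h f,
      forall k b, Ck_in k (coord_preimage a V) b h &
      forall x, coord_preimage a V x -> dscalar h a x = \row_j Y (coord a x) (inl j)].
Proof.
move=> oV VN YA h f; set W := coord_preimage a V.
have oW : open W by exact: open_coord_preimage.
have Va : V `<=` coord a @` dom a by move=> y /VN; exact: chart_image_dom.
have WE : chart_image W a = V by exact: chart_image_preimage.
have Y_smooth := linear_solution_smooth oV
  (fun k c l i => Ck_sub VN (sys_smooth a k c l i)) YA.
have paramK y : V y -> coord a (param a y) = y.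
  by move=> /VN/chart_imageP[].
have Cha k : Ck_in k W a h.
  rewrite /Ck_in WE; apply: eq_Ck (Y_smooth k (inr true)) => // y Vy.
  by rewrite /h /= paramK.
have Cfa k : Ck_in k W a f.
  rewrite /Ck_in WE; apply: eq_Ck (Y_smooth k (inr false)) => // y Vy.
  by rewrite /f /= paramK.
have chart_b k b F : Ck_in k W a F -> Ck_in k W b F.
  move=> CF; have := Ck_in_transition b oW CF.
  suff -> : W `&` dom a = W by [].
  by apply/seteqP; split=> x [] // ax Vx; split=> //; split.
have dY y i c : V y -> partial c (fun y => Y y i) y = \sum_l Y y l * sys a c y l i.
  by move=> Vy; have [_ /(_ c) d] := YA y Vy i; rewrite /partial derive_val.
have pdh x j : W x -> pd a j h x = Y (coord a x) (inl j).
  move=> [ax Vx].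
  have -> : pd a j h x = partial j (fun y => Y y (inr true)) (coord a x).
    apply: (eq_partial _ oV Vx) => y Vy.
    by rewrite /h /= paramK.
  rewrite dY// sys_sum/= !mulr0 !addr0 (bigD1 j)//= eqxx mulr1 big1 ?addr0//.
  by move=> d /negbTE ->; rewrite mulr0.
have dsh x : W x -> dscalar h a x = \row_j Y (coord a x) (inl j).
  by move=> Wx; apply/rowP => j; rewrite !mxE pdh.
split=> //; last by move=> k b; exact: chart_b.
have eqs_a x : W x -> parallel_eqs g Pi a h f x.
  move=> Wx; have [ax Vx] := Wx; split.
    apply/matrixP => i c; rewrite !mxE /hessian /covD1.
    have -> : pd a c (fun z => dscalar h a z 0 i) x =
        partial c (fun y => Y y (inl i)) (coord a x).
      apply: (eq_partial _ oV Vx) => y Vy /=.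
      have [_ ay Ey] := chart_imageP (VN _ Vy).
      by rewrite mxE pdh ?Ey//; split=> //; rewrite Ey.
    rewrite dY// sys_sum/= mulr0 add0r dsh// /sys coordK//.
    rewrite addrAC -[RHS]add0r; congr (_ + _).
    apply/eqP; rewrite subr_eq0; apply/eqP; apply: eq_bigr => d _.
    by rewrite mxE mulrC.
  apply/rowP => c; rewrite [LHS]mxE.
  have -> : pd a c f x = partial c (fun y => Y y (inr false)) (coord a x).
    apply: (eq_partial _ oV Vx) => y Vy /=.
    by rewrite /f /= paramK.
  rewrite dY// sys_sum/= !mulr0 !addr0 dsh// /sys coordK// -mulmxA.
  rewrite [RHS]mxE [in RHS]mxE -sumrN; apply: eq_bigr => d _.
  by rewrite mulrN [in RHS]mxE.
move=> b; split; [exact: chart_b|exact: chart_b|].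
move=> x Wx bx; have [ax Vx] := Wx.
have Nx : N x by have [] := chart_imageP (VN _ Vx); rewrite coordK.
by apply: (parallel_eqs_transition g_metric Pi_sym oW Wx Nx bx ax (Cha 2%N) (Cfa 1%N)); exact: eqs_a.
Qed.

(** A chart chosen once and for all at each point, so that the differential at that
    point is recorded by one row vector. *)
Definition chart_at x : atlas M := sval (cid (dom_cover x)).

Lemma dom_chart_at x : dom (chart_at x) x.
Proof. exact: svalP (cid (dom_cover x)). Qed.

Definition state h f x : R * 'rV[R]_n * R := (h x, dscalar h (chart_at x) x, f x).

Definition flat_section U (s : M -> R * 'rV[R]_n * R) :=
  exists h f, parallel_pair g Pi U h f /\ forall x, U x -> s x = state h f x.

Lemma parallel_pair_sub U W h f : W `<=` U ->
  parallel_pair g Pi U h f -> parallel_pair g Pi W h f.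
Proof.
move=> WU hf a; have [Ch Cf E] := hf a; split.
- by apply: Ck_sub Ch; exact: chart_image_sub.
- by apply: Ck_sub Cf; exact: chart_image_sub.
- by move=> x /WU; exact: E.
Qed.

Lemma flat_section_sub U W s : W `<=` U -> flat_section U s -> flat_section W s.
Proof.
move=> WU [h [f [hf sE]]]; exists h, f; split; first exact: parallel_pair_sub hf.
by move=> x /WU; exact: sE.
Qed.

Lemma parallel_pair_diff U h f a x : open U -> parallel_pair g Pi U h f ->
  U x -> dom a x -> diff_in a h x.
Proof. by move=> oU hf Ux ax; have [Ch _ _] := hf a; exact: Ck_in_diff oU Ch Ux ax. Qed.

(** In a chart this is [flat_system_local]; the invertible Jacobians translate
    between the differential in that chart and in the chosen chart at each point. *)
Lemma flat_section_basis x (V : set M) : N x -> open V -> V x ->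
  exists U, [/\ open U, U x, U `<=` V & transport_set flat_section U].
Proof.
move=> Nx oV Vx; pose a := chart_at x; have ax : dom a x := dom_chart_at x.
have oVN : open (V `&` N) by exact: openI.
have VNx : chart_image (V `&` N) a (coord a x) by apply: chart_image_coord.
have VN_N : chart_image (V `&` N) a `<=` chart_image N a.
  by apply: chart_image_sub => z [].
have [r [r0 Br ex uq]] := flat_system_local (open_chart_image a oVN) VNx
  (fun c l i => Ck_sub VN_N (sys_smooth a 2 c l i))
  (fun y Vy => sys_flat (VN_N _ Vy)).
set B := ball _ r in Br ex uq.
have oB : open B by exact: ball_open.
pose U := coord_preimage a B.
have oU : open U by exact: open_coord_preimage.
have Ua z : U z -> dom a z by case.
have UVN : U `<=` V `&` N.
  by move=> z [az /Br/chart_imageP[]]; rewrite coordK.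
have UB : B `<=` chart_image U a.
  move=> y By; have [_ ay Ey] := chart_imageP (Br _ By).
  by exists (param a y) => //; split=> //; split=> //; rewrite Ey.
exists U; split=> //.
- by split=> //; exact: ballxx.
- by move=> z /UVN[].
split.
- move=> x1 [[h1 u1] f1] Ux1; have [ax1 Bx1] := Ux1.
  have bx1 := dom_chart_at x1; set b := chart_at x1 in bx1.
  pose y0 (i : 'I_n + bool) := match i with
    | inl j => (u1 *m (change_of_coord a b x1)^T) 0 j
    | inr true => h1 | inr false => f1 end.
  have [Y [Y0 HY]] := ex _ y0 Bx1.
  have [hf _ dsh] := solution_pair oB (subset_trans Br VN_N) HY.
  set h := fun z => Y _ (inr true) in hf dsh.
  set f := fun z => Y _ (inr false) in hf.
  exists (state h f); first by exists h, f.
  rewrite /state /h /f !Y0/=; congr ((_, _), _).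
  have uJ : (change_of_coord a b x1)^T \in unitmx.
    by rewrite unitmx_tr (change_of_coord_unit g_metric).
  apply: (can_inj (mulmxK uJ)).
  rewrite -dscalar_transition//; last exact: parallel_pair_diff oU hf Ux1 bx1.
  by rewrite dsh//; apply/rowP => j; rewrite mxE Y0.
- move=> x1 s s' Ux1 [h [f [hf sE]]] [h' [f' [hf' sE']]].
  rewrite sE// sE'// => -[Eh Ed Ef] z Uz; rewrite sE// sE'//.
  have [[ax1 Bx1] [az Bz]] := (Ux1, Uz).
  have UN : U `<=` N by move=> t /UVN[].
  have S := pair_solution oU UN hf UB; have S' := pair_solution oU UN hf' UB.
  have dh t : U t -> forall b, dom b t -> diff_in b h t.
    by move=> Ut b bt; exact: parallel_pair_diff oU hf Ut bt.
  have dh' t : U t -> forall b, dom b t -> diff_in b h' t.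
    by move=> Ut b bt; exact: parallel_pair_diff oU hf' Ut bt.
  have Eda := dscalar_inj g_metric ax1 (dom_chart_at x1) (dh _ Ux1 _ ax1) (dh' _ Ux1 _ ax1) Ed.
  have E0 i : frame a h f (coord a x1) i = frame a h' f' (coord a x1) i.
    case: i => [j|[]] /=; rewrite ?coordK//.
    by have /rowP/(_ j) := Eda; rewrite !mxE.
  have E := uq _ _ _ Bx1 S S' E0 _ Bz.
  have /= := E (inr true); have /= := E (inr false); rewrite coordK// => Efz Ehz.
  rewrite /state Efz Ehz; congr ((_, _), _).
  apply: (dscalar_inj g_metric (dom_chart_at z) az).
  + exact: dh Uz _ (dom_chart_at z).
  + exact: dh' Uz _ (dom_chart_at z).
  + by apply/rowP => j; rewrite !mxE; exact: E (inl j).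
Qed.

End LocalSections.

(** * Solutions of the Hessian equation *)

Section Solutions.
Context {R : realType} {n : nat} {M : manifold R n}.
Variables (g : cov2 M) (N : set M) (Pi : cov2 M).
Hypothesis g_metric : riemannian_metric g.
Hypotheses (N_open : open N) (Pi_sym : sym_form_on N Pi).
Hypotheses (Pi_gauss : gauss_equation_on g N Pi)
  (Pi_codazzi : codazzi_equation_on g N Pi).
Implicit Types (U W S : set M) (a b : atlas M) (x : M) (f h : M -> R).

(** The second member of the pair formed from a solution h; [slopeE] evaluates it in
    any chart. *)
Definition slope h x : R :=
  Num.sqrt (1 - covector_normsq g (chart_at x) x (dscalar h (chart_at x) x)).

Lemma slopeE a h x : dom a x -> diff_in a h x ->
  slope h x = Num.sqrt (1 - covector_normsq g a x (dscalar h a x)).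
Proof.
move=> ax dh; rewrite /slope (normsq_transition g_metric (dom_chart_at x) ax)//.
Qed.

Lemma normsq_C1 U a h : open U -> Ck_in 2 U a h ->
  Ck_in 1 U a (fun z => covector_normsq g a z (dscalar h a z)).
Proof.
move=> oU Ch; have oV := open_chart_image a oU.
have Cg i j : Ck_in 1 U a (fun z => ginv g a z i j).
  by apply: Ck_sub (ginv_smooth g_metric 1 a i j); exact: chart_image_sub.
have Cd i : Ck_in 1 U a (fun z => dscalar h a z 0 i).
  apply: (eq_Ck oV _ (Ck_in_pd i oU Ch)) => y _.
  by rewrite /= mxE.
apply: (Ck_sum oV) => i; apply: (Ck_sum oV) => j.
by apply: (CkM oV (CkM oV (Cg i j) (Cd i)) (Cd j)).
Qed.

(** Differentiating f^2 = 1 - |dh|^2 along a solution gives the equation of f. *)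
Lemma solution_parallel S h : open S -> scalar_field_on S h ->
  hessian_equation_on g S Pi h -> parallel_pair g Pi S h (slope h).
Proof.
move=> oS hS hE a; have oV := open_chart_image a oS.
have Ch : Ck_in 2 S a h by exact: hS.
pose E z := 1 - covector_normsq g a z (dscalar h a z).
have CE : Ck_in 1 S a E.
  by apply: (CkB oV (Ck_cst 1 _ 1)); exact: normsq_C1.
have slE z : S z -> dom a z -> slope h z = Num.sqrt (E z).
  by move=> Sz az; rewrite (slopeE az)//; exact: Ck_in_diff oS Ch Sz az.
have E0 z : S z -> dom a z -> 0 < E z.
  by move=> Sz az; rewrite subr_gt0; exact: (hE a z Sz az).1.
have Csq : Ck_in 1 S a (fun z => Num.sqrt (E z)).
  by apply: (C1_sqrt oV _ CE) => y /chart_imageP[Sy ay _]; exact: E0.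
split; first exact: Ch.
  apply: (eq_Ck oV _ Csq) => y /chart_imageP[Sy ay _].
  by apply/esym; exact: slE.
move=> x Sx ax; have s0 : 0 < Num.sqrt (E x) by rewrite sqrtr_gt0 E0.
have H1 : hessian_mx g a h x = slope h x *: Pi a x.
  apply/matrixP => b c; rewrite !mxE slE// (hE a x Sx ax).2 mulrC divfK//.
  by rewrite gt_eqF.
split; first exact: H1.
apply/rowP => c; rewrite [LHS]mxE [RHS]mxE.
have -> : pd a c (slope h) x = pd a c (fun z => Num.sqrt (E z)) x.
  apply: eq_pd => //; have nS : nbhs x S by exact: open_nbhs_nbhs.
  by apply: filterS2 nS (near_dom ax) => z Sz az; exact: slE.
have Vx := chart_image_coord Sx ax.
have dE : pd a c E x = - (2 * (dscalar h a x *m ginv g a x *m hessian_mx g a h x) 0 c).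
  rewrite -(pd_normsq g_metric c oS Ch Sx ax).
  have := @pdD _ _ _ a (fun=> 1) (fun z => - covector_normsq g a z (dscalar h a z)) x c.
  rewrite pd_cst add0r => -> //.
  - rewrite pdN//; exact: Ck_in_diff oS (normsq_C1 oS Ch) Sx ax.
  - exact: differentiable_cst.
  - by apply: differentiableN; exact: Ck_in_diff oS (normsq_C1 oS Ch) Sx ax.
have Ep : 0 < (E \o param a) (coord a x) by rewrite /= coordK// E0.
have ds := is_derive_sqrt (delta_mx 0 c) Ep (@Ck_differentiable _ _ 0 _ _ _ oV CE Vx).
rewrite [LHS](@derive_val _ _ _ _ _ _ _ ds) /= coordK//.
rewrite -[X in _ * X]/(pd a c E x) dE H1.
have -> : (dscalar h a x *m ginv g a x *m (slope h x *: Pi a x)) 0 c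
    = slope h x * (dscalar h a x *m ginv g a x *m Pi a x) 0 c.
  by rewrite -scalemxAr mxE.
rewrite (slE _ Sx ax).
set q := (_ *m Pi a x) 0 c; set s := Num.sqrt (E x) in s0 *.
rewrite mulrN; congr (- _); rewrite [2 * (s * q)]mulrA mulKf//.
by rewrite mulf_neq0 ?pnatr_eq0// gt_eqF.
Qed.

(** A solution of a linear system with smooth coefficients is smooth. *)
Lemma parallel_smooth U h f : open U -> U `<=` N -> parallel_pair g Pi U h f ->
  scalar_field_on U h.
Proof.
move=> oU UN hf a k; have oV := open_chart_image a oU.
have S := pair_solution (V := chart_image U a) oU UN hf (fun y Vy => Vy).
have C := linear_solution_smooth oV _ S k (inr true).
apply: C => k' c l i; apply: Ck_sub (conn_smooth g_metric N_open Pi_sym k' a c l i).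
exact: chart_image_sub.
Qed.

(** For the parallel pair with the initial values h0, w, (1 - |w|^2)^(1/2) at p the
    function f^2 + |dh|^2 is constant, hence 1; where moreover f > 0, f is the
    square root in the equation. *)
Lemma local_solution (p : M) a (h0 : R) (w : 'rV[R]_n) : N p -> dom a p ->
  covector_normsq g a p w < 1 -> exists S, solution_domain g N Pi p a h0 w S.
Proof.
move=> Np ap w1.
have [U [oU Up UN [ex _]]] := flat_section_basis g_metric N_open Pi_sym
  Pi_gauss Pi_codazzi Np N_open Np.
pose f0 := Num.sqrt (1 - covector_normsq g a p w).
have f00 : 0 < f0 by rewrite sqrtr_gt0 subr_gt0.
pose J := change_of_coord (chart_at p) a p.
have [s [h [f [hf sE]]]] := ex p (h0, w *m J^T, f0) Up.
rewrite sE// => -[hp dp fp].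
have [Ch Cf E] := hf a; have oV := open_chart_image a oU.
have uJ : J^T \in unitmx.
  by rewrite unitmx_tr (change_of_coord_unit g_metric (dom_chart_at p) ap).
have dw : dscalar h a p = w.
  apply: (can_inj (mulmxK uJ)).
  rewrite -(dscalar_transition (dom_chart_at p) ap)//.
  exact: parallel_pair_diff oU hf Up ap.
have Vp := chart_image_coord Up ap.
have [r /= r0 Br] : exists2 r : R, 0 < r &
    ball (coord a p) r `<=` chart_image U a `&` [set y | 0 < f (param a y)].
  have n1 : nbhs (coord a p) (chart_image U a) by exact: open_nbhs_nbhs.
  have n2 : nbhs (coord a p) [set y | 0 < f (param a y)].
    have c := @Ck_continuous _ _ 1 _ _ _ Cf Vp.
    have f_pos : nbhs (f (param a (coord a p))) [set t : R | 0 < t].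
      by apply: lt_nbhsr; rewrite coordK// fp.
    exact: (c _ f_pos).
  by have [r r0 Br] := (nbhs_ballP (coord a p) _).1 (filterI n1 n2); exists r.
set B := ball _ r in Br.
have oB : open B by exact: ball_open.
pose S := coord_preimage a B.
have oS : open S by exact: open_coord_preimage.
have SU : S `<=` U by move=> x [ax /Br[/chart_imageP[]]]; rewrite coordK.
have Sf x : S x -> 0 < f x by move=> [ax /Br[_]] /=; rewrite coordK.
have Sp : S p by split=> //; exact: ballxx.
pose e z := f z * f z + covector_normsq g a z (dscalar h a z).
have Ce : Ck_in 1 U a e.
  by apply: (CkD oV); [exact: (CkM oV)|exact: normsq_C1].
have de x c : U x -> dom a x -> pd a c e x = 0.
  move=> Ux ax; have [E1 E2] := E x Ux ax.
  have df := Ck_in_diff oU Cf Ux ax.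
  rewrite pdD; [|exact: diff_inM|exact: Ck_in_diff oU (normsq_C1 oU Ch) Ux ax].
  rewrite pdM// (pd_normsq g_metric c oU Ch Ux ax) E1.
  have -> : pd a c f x = - (dscalar h a x *m ginv g a x *m Pi a x) 0 c.
    by have /rowP/(_ c) := E2; rewrite mxE [RHS]mxE.
  have -> : (dscalar h a x *m ginv g a x *m (f x *: Pi a x)) 0 c
      = f x * (dscalar h a x *m ginv g a x *m Pi a x) 0 c.
    by rewrite -scalemxAr mxE.
  by set q := (_ *m Pi a x) 0 c; ring.
have e1 x : S x -> e x = 1.
  move=> [ax Bx].
  have ep : e p = 1.
    by rewrite /e fp dw -expr2 sqr_sqrtr ?subr_ge0 ?ltW// subrK.
  have := @partial_lipschitz _ _ (coord a p) r 0 (e \o param a) _ _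
    (coord a p) (coord a x) (ballxx _ r0) Bx.
  rewrite /= !coordK// ep mul0r normr_le0 subr_eq0 => H; apply/eqP/H.
  - by move=> z /Br[Vz _] i; exact: (@Ck_derivable _ _ 0 _ _ _ _ Ce Vz).
  - move=> z /Br[/chart_imageP[Uz az Ez] _] i.
    by have := de _ i Uz az; rewrite /pd Ez => ->; rewrite normr0.
exists S; split=> //.
- have -> : S = param a @` B.
    apply/seteqP; split=> x.
      by move=> [ax Bx]; exists (coord a x) => //; rewrite coordK.
    move=> [y By <-]; have [/chart_imageP[Uy ay Ey] _] := Br _ By.
    by split=> //; rewrite Ey.
  apply: connected_continuous_connected; first exact: connected_ball.
  apply: continuous_in_subspaceT => y; rewrite inE => By.
  by apply: param_continuous; apply: chart_image_dom; exact: (Br _ By).1.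
- by move=> x /SU/UN.
exists h; split=> //.
- move=> b k; apply: Ck_sub (parallel_smooth oU UN hf b k).
  exact: chart_image_sub.
- move=> b x Sx bx; have [ax _] := Sx; have Ux := SU _ Sx.
  have nE : covector_normsq g b x (dscalar h b x) = 1 - f x * f x.
    rewrite (normsq_transition g_metric bx ax); last exact: Ck_in_diff oU Ch Ux ax.
    by rewrite -(e1 x Sx) /e addrAC subrr add0r.
  have fx := Sf _ Sx.
  rewrite nE; split; first by rewrite gtrBl mulr_gt0.
  move=> i j; rewrite opprB addrCA subrr addr0 -expr2 sqrtr_sqr gtr0_norm//.
  have [_ _ /(_ x Ux bx) [/matrixP/(_ i j) E1 _]] := hf b.
  by move: E1; rewrite !mxE => ->; rewrite mulrAC mulfV ?mul1r// gt_eqF.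
Qed.

End Solutions.

Section LocalEquality.
Context {R : realType} {n : nat} {M : manifold R n}.
Implicit Types (a : atlas M) (x : M) (h : M -> R).

Lemma eq_near_dscalar a h h' x : dom a x -> (\forall z \near x, h z = h' z) ->
  dscalar h a x = dscalar h' a x.
Proof. by move=> ax E; apply/rowP => i; rewrite !mxE; exact: eq_pd. Qed.

Lemma eq_near_hessian g a h h' x b c : dom a x ->
  (\forall z \near x, h z = h' z) -> hessian g h a x b c = hessian g h' a x b c.
Proof.
move=> ax E; rewrite /hessian /covD1.
have -> : pd a c (fun y => dscalar h a y 0 b) x = pd a c (fun y => dscalar h' a y 0 b) x.
  apply: eq_pd => //.
  have E' : \forall z \near x, \forall u \near z, h u = h' u by apply: nbhs_interior.
  by apply: filterS2 (near_dom ax) E' => z az Ez; rewrite (eq_near_dscalar az Ez).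
by rewrite (eq_near_dscalar ax E).
Qed.

End LocalEquality.

Theorem lemma3p3 (R : realType) (n : nat) (M : manifold R n) (g : cov2 M)
  (g_metric : riemannian_metric g)
  (N : set M) (N_open : open N) (N_contractible : contractible_set R N)
  (Pi : cov2 M) (Pi_sym : sym_form_on N Pi)
  (Pi_gauss : gauss_equation_on g N Pi)
  (Pi_codazzi : codazzi_equation_on g N Pi)
  (p : M) (Np : N p) (a : atlas M) (ap : dom a p)
  (h0 : R) (w : 'rV[R]_n) (w_lt1 : covector_normsq g a p w < 1) :
  exists S : set M,
    [/\ solution_domain g N Pi p a h0 w S,
        forall S' : set M, solution_domain g N Pi p a h0 w S' -> S' `<=` S &
        exists h : M -> R,
          solution_on g Pi p a h0 w S h /\
          forall h' : M -> R, solution_on g Pi p a h0 w S h' ->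
            forall x, S x -> h' x = h x].
Proof.
pose J := change_of_coord (chart_at p) a p.
pose f0 := Num.sqrt (1 - covector_normsq g a p w).
have [G [Gp G_loc]] := global_section
  (fun U V s (VU : V `<=` U) => flat_section_sub VU)
  (flat_section_basis g_metric N_open Pi_sym Pi_gauss Pi_codazzi)
  (h0, w *m J^T, f0) N_contractible Np.
pose hG x := (G x).1.1.
have G_unique S h : open S -> connected S -> S `<=` N -> S p ->
    solution_on g Pi p a h0 w S h -> forall x, S x -> hG x = h x.
  move=> oS cS SN Sp [hS hE hp dp] x Sx.
  have hf := solution_parallel g_metric oS hS hE.
  have S_sec : flat_section g Pi S (state h (slope g h)) by exists h, (slope g h).
  have dh := parallel_pair_diff oS hf Sp ap.
  suff : G x = state h (slope g h) x by rewrite /hG => ->.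
  apply: (@connected_propagation M S (fun x => G x = state h (slope g h) x)
    cS _ p x Sp Sx).
    move=> y Sy; have Ny := SN y Sy.
    have [V [s [oV Vy Vs Es]]] := G_loc y Ny.
    have [W [oW Wy WVS HW]] := local_agreement
      (fun U V s (VU : V `<=` U) => flat_section_sub VU)
      (flat_section_basis g_metric N_open Pi_sym Pi_gauss Pi_codazzi)
      Ny oV oS Vy Sy Vs S_sec.
    exists W; split=> // u v Su Wu Sv Wv.
    have [[Vu _] [Vv _]] := (WVS u Wu, WVS v Wv).
    rewrite (Es u Vu (SN u Su)) (Es v Vv (SN v Sv)); exact: HW.
  rewrite Gp /state (slopeE g_metric ap dh) dp hp.
  by rewrite (dscalar_transition (dom_chart_at p) ap dh) dp.
pose dom_sol := [set S | solution_domain g N Pi p a h0 w S].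
pose S := \bigcup_(S' in dom_sol) S'.
have hG_near S' h x : solution_domain g N Pi p a h0 w S' ->
    solution_on g Pi p a h0 w S' h -> S' x -> \forall z \near x, hG z = h z.
  move=> [oS' cS' S'N S'p _] hS' S'x.
  have : nbhs x S' by exact: open_nbhs_nbhs.
  by apply: filterS => z; exact: G_unique.
have [S0 HS0] := local_solution g_metric N_open Pi_sym Pi_gauss Pi_codazzi
  h0 Np ap w_lt1.
have oS : open S by apply: bigcup_open => S' [].
have cS : connected S.
  by apply: bigcup_connected; [exists p => S' []|move=> S' []].
have SN : S `<=` N by move=> x [S' [_ _ S'N _ _] S'x]; exact: S'N.
have Sp : S p by exists S0 => //; case: HS0.
have hG_sol : solution_on g Pi p a h0 w S hG.
  have [_ _ _ S0p [h1 h1S]] := HS0; have h1_near := hG_near _ _ _ HS0 h1S S0p.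
  have [_ _ h1p h1d] := h1S.
  split.
  - move=> b k; apply: Ck_local => _ [x [[S' HS' S'x] bx] <-].
    have [oS' _ _ _ [h hS']] := HS'; have [h_smooth _ _ _] := hS'.
    exists (chart_image S' b); first exact: chart_image_coord.
    apply: (eq_Ck (open_chart_image b oS') _ (h_smooth b k)) => y /chart_imageP[S'y _ _].
    by rewrite /= (nbhs_singleton (hG_near _ _ _ HS' hS' S'y)).
  - move=> b x [S' HS' S'x] bx.
    have [_ _ _ _ [h hS']] := HS'; have [_ h_eq _ _] := hS'.
    have E := hG_near _ _ _ HS' hS' S'x.
    rewrite (eq_near_dscalar bx E); have [E1 E2] := h_eq b x S'x bx.
    by split=> // i j; rewrite (eq_near_hessian _ _ _ bx E).
  - by rewrite (nbhs_singleton h1_near).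
  - by rewrite (eq_near_dscalar ap h1_near).
exists S; split.
- by split=> //; exists hG.
- by move=> S' HS' x S'x; exists S'.
exists hG; split=> // h' h'S x Sx.
by rewrite (G_unique S h').
Qed.
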